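(* Let $H$ and $A$ be weak bialgebras over $\Bbbk$ and let $(H,A)$ be a compatible weak matched pair. Then the subspace $A\underline{\overline{\#}}H$ of $A\otimes H$ is a weak bialgebra with the following structure, for all $x,y\in A$ and $h,g\in H$: (i) multiplication: $(x\underline{\overline{\#}}h)(y\underline{\overline{\#}}g)=x(h_1\cdot y)\,\underline{\overline{\#}}\,h_2g$; (ii) unity: $1_A\underline{\overline{\#}}1_H$; (iii) comultiplication: $\Delta(x\underline{\overline{\#}}h)=x_1\underline{\overline{\#}}{h_1}^0\otimes x_2{h_1}^1\underline{\overline{\#}}h_2$; (iv) counit: $\varepsilon(x\underline{\overline{\#}}h)=\varepsilon(x({h_1}^0\cdot 1_A){h_1}^1(h_2\cdot 1_A))$.
   Context: Everything is over a fixed field $\Bbbk$, $\otimes=\otimes_\Bbbk$; algebras are associative and unital, coalgebras coassociative and counital; Sweedler notation $\Delta(h)=h_1\otimes h_2$ (summation understood). A weak bialgebra $H$ is an algebra and a coalgebra such that $\Delta(hk)=\Delta(h)\Delta(k)$; $\varepsilon(hk\ell)=\varepsilon(hk_1)\varepsilon(k_2\ell)=\varepsilon(hk_2)\varepsilon(k_1\ell)$; and $(1_H\otimes\Delta(1_H))(\Delta(1_H)\otimes 1_H)=(\Delta(1_H)\otimes 1_H)(1_H\otimes\Delta(1_H))=\Delta^2(1_H)$, where $\Delta^2=(\Delta\otimes \mathrm{id})\Delta$. Write $\Delta(1_H)=1_{H1}\otimes 1_{H2}$; primes denote further copies. Put $\varepsilon_t(h)=\varepsilon(1_{H1}h)1_{H2}$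 and $\varepsilon_s(h)=1_{H1}\varepsilon(h1_{H2})$ (similarly for $A$). For a weak bialgebra $H$ and an algebra $A$, $A$ is a left $H$-module algebra if there is a linear map $\cdot:H\otimes A\to A$ with $1_H\cdot a=a$; $h\cdot ab=(h_1\cdot a)(h_2\cdot b)$; $h\cdot(k\cdot a)=hk\cdot a$; $h\cdot 1_A=\varepsilon_t(h)\cdot 1_A$. For a weak bialgebra $A$ and a coalgebra $H$, $H$ is a right $A$-comodule coalgebra if there is a linear map $\rho:H\to H\otimes A$, $\rho(h)=h^0\otimes h^1$, with $\varepsilon(h^1)h^0=h$; ${h^0}_1\otimes{h^0}_2\otimes h^1={h_1}^0\otimes{h_2}^0\otimes{h_1}^1{h_2}^1$; $h^{00}\otimes h^{01}\otimes h^1=h^0\otimes{h^1}_1\otimes{h^1}_2$; $h^1\varepsilon(h^0)=\varepsilon_s(h^1)\varepsilon(h^0)$. Here $h^{00}\otimes h^{01}\otimes h^1=(\rho\otimes\mathrm{id})\rho(h)$, ${h_1}^0\otimes {h_1}^1$ is $\rho$ applied to the leg $h_1$, and ${h^0}_1\otimes{h^0}_2$ is $\Delta$ applied to the leg $h^0$. A pair $(H,A)$ of weak bialgebras is a weak matched pair if: (i) $A$ is a left $H$-module algebra via $\cdot$; (ii) $H$ is a right $A$-comodule coalgebra via $\rho$; (iii) $(h_2g)^0\otimes(h_1\cdot x)_1\otimes(h_1\cdot x)_2(h_2g)^1={h_3}^0g^0\otimes({h_1}^0\cdot x_1)\otimes{h_1}^1(h_2\cdot x_2){h_3}^1(h_4\cdot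 g^1)$; (iv) $\varepsilon_s(h\cdot x)=\varepsilon_s(h\cdot 1_A)\varepsilon_s(x)$; (v) $\rho(1_{H1})\otimes 1_{H2}=1_{H1}\otimes\varepsilon({1_{H1}'}^0){1_{H1}'}^1\otimes 1_{H2}1_{H2}'$; for all $h,g\in H$, $x\in A$. It is abelian if $H$ is cocommutative and $A$ is commutative. A compatible weak matched pair is an abelian weak matched pair such that, for all $h,g\in H$: $h\cdot 1_A=h_1\cdot 1_{A1}\,\varepsilon(h_2\cdot 1_{A2})$ and $h\cdot 1_{A1}\otimes g\cdot 1_{A2}=(h\cdot 1_A)1_{A1}\otimes(g\cdot 1_A)1_{A2}$. $A\#H$ denotes $A\otimes H$ (with $x\#h=x\otimes h$) equipped with the product $(x\#h)(y\#g)=x(h_1\cdot y)\#h_2g$, the map $\Delta(x\#h)=x_1\#{h_1}^0\otimes x_2{h_1}^1\#h_2$, and $\varepsilon(x\#h)=\varepsilon(x)\varepsilon(h)$. Put $x\underline{\#}h=(x\#h)(1_A\#1_H)=x(h_1\cdot 1_A)\#h_2$, and $x\underline{\overline{\#}}h=(\mathrm{id}\otimes\varepsilon)\Delta(x\underline{\#}h)=x_1({h_1}^0\cdot 1_A)\#{h_2}^0\,\varepsilon(x_2{h_1}^1{h_2}^1(h_3\cdot 1_A))$. $A\underline{\overline{\#}}H$ is the image of the linear map $A\otimes H\to A\otimes H$, $x\otimes h\mapsto x\underline{\overline{\#}}h$. *)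

(* Defs.v *)
From HB Require Import structures.
From mathcomp Require Import all_boot all_order all_algebra.
From mathcomp Require Import boolp.

Set Implicit Arguments.
Unset Strict Implicit.
Unset Printing Implicit Defensive.

Import GRing.Theory.
Local Open Scope ring_scope.
Local Open Scope quotient_scope.

Reserved Notation "U ⨂ V" (at level 41, right associativity).
Reserved Notation "u ⊗ v" (at level 41, right associativity).
Reserved Notation "x ∗ y" (at level 40, left associativity).
Reserved Notation "h ⋅ x" (at level 39, left associativity).
Reserved Notation "'\1_' V" (at level 8, V at level 2, format "'\1_' V").
Reserved Notation "'\Sw_' ( x , y <- t ) E"
  (at level 41, x name, y name, t at level 200, E at level 41,
   right associativity,
   format "'[' '\Sw_' ( x ,  y  <-  t ) '/  '  E ']'").

(* MathComp has no tensor product of arbitrary vector spaces: U ⨂ V is built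
   here as a quotient of formal sums. The list [:: (u_1, v_1); ...; (u_n, v_n)]
   stands for u_1 ⊗ v_1 + ... + u_n ⊗ v_n, and two lists are identified iff no
   bilinear map separates them. *)
Section Tensor.
Variables (k : fieldType) (U V : lmodType k).

Definition tens_eq (s t : seq (U * V)) : bool :=
  `[< forall (W : lmodType k) (F : {bilinear U -> V -> W}),
        \sum_(p <- s) F p.1 p.2 = \sum_(p <- t) F p.1 p.2 >].

Lemma tens_eq_refl : reflexive tens_eq.
Proof. by move=> s; apply/asboolP. Qed.

Lemma tens_eq_sym : symmetric tens_eq.
Proof.
by move=> s t; apply/idP/idP => /asboolP e; apply/asboolP => W F; rewrite e.
Qed.

Lemma tens_eq_trans : transitive tens_eq.
Proof.
move=> t s r /asboolP e1 /asboolP e2; apply/asboolP => W F.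
by rewrite e1 e2.
Qed.

Canonical tens_equiv := EquivRel tens_eq tens_eq_refl tens_eq_sym tens_eq_trans.

Definition tensor := {eq_quot tens_equiv}.
HB.instance Definition _ := Choice.copy tensor {eq_quot tens_equiv}.
HB.instance Definition _ := EqQuotient.copy tensor {eq_quot tens_equiv}.

Definition tens (u : U) (v : V) : tensor := \pi_tensor [:: (u, v)].

End Tensor.

(* In both scopes, since the arguments of {linear _ -> _} are read in
   ring_scope. *)
Notation "U ⨂ V" := (tensor U V) : type_scope.
Notation "U ⨂ V" := (tensor U V) : ring_scope.
Notation "u ⊗ v" := (tens u v) : ring_scope.

(* Sweedler summation: \Sw_(u, v <- t) F u v is the sum of the F u_i v_i over a
   decomposition of t as the sum of the u_i ⊗ v_i. The decomposition is the one
   chosen by the quotient; the sum does not depend on this choice as soon as F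
   is bilinear (tsum_pi, tsum_tens below), and this is the only use made of
   it. *)
Definition tsum (k : fieldType) (U V : lmodType k) (W : nmodType)
    (t : U ⨂ V) (F : U -> V -> W) : W :=
  \sum_(p <- repr t) F p.1 p.2.

Notation "'\Sw_' ( x , y <- t ) E" := (tsum t (fun x y => E)) : ring_scope.

Notation is_bilinear F := (bilinear_for *:%R *:%R F).

Section TensorLmodule.
Variables (k : fieldType) (U V : lmodType k).
Implicit Types t : U ⨂ V.

Section Evaluation.
Variables (W : lmodType k) (F : U -> V -> W).
Hypothesis bF : is_bilinear F.

Lemma tsum_pi s : tsum (\pi_(U ⨂ V) s) F = \sum_(p <- s) F p.1 p.2.
Proof.
have : tens_eq (repr (\pi_(U ⨂ V) s)) s.
  have /eqmodP// : repr (\pi_(U ⨂ V) s) = s %[mod U ⨂ V] by rewrite reprK.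
pose G : {bilinear U -> V -> W} :=
  HB.pack F (bilinear_isBilinear.Build k U V W *:%R *:%R F bF).
by move/asboolP => /(_ W G).
Qed.

Lemma tsum_tens u v : tsum (u ⊗ v) F = F u v.
Proof. by rewrite tsum_pi big_seq1. Qed.

End Evaluation.

Lemma tens_ext t1 t2 :
  (forall (W : lmodType k) (F : U -> V -> W), is_bilinear F ->
     tsum t1 F = tsum t2 F) -> t1 = t2.
Proof.
move=> e; rewrite -[t1]reprK -[t2]reprK; apply/eqmodP/asboolP => W F.
by apply: (e W F); split => x a u v; rewrite ?linearPl ?linearPr.
Qed.

Definition tens_add t1 t2 : U ⨂ V := \pi_(U ⨂ V) (repr t1 ++ repr t2).
Definition tens_zero : U ⨂ V := \pi_(U ⨂ V) [::].
Definition tens_scale (a : k) t : U ⨂ V :=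
  \pi_(U ⨂ V) [seq (a *: p.1, p.2) | p <- repr t].
Definition tens_opp t : U ⨂ V := tens_scale (-1) t.

Section EvaluationOps.
Variables (W : lmodType k) (F : U -> V -> W).
Hypothesis bF : is_bilinear F.

Lemma tsum_add t1 t2 : tsum (tens_add t1 t2) F = tsum t1 F + tsum t2 F.
Proof. by rewrite tsum_pi // big_cat. Qed.

Lemma tsum_zero : tsum tens_zero F = 0.
Proof. by rewrite tsum_pi // big_nil. Qed.

Lemma tsum_scale a t : tsum (tens_scale a t) F = a *: tsum t F.
Proof.
rewrite tsum_pi // big_map scaler_sumr; apply: eq_bigr => p _ /=.
by have := scalable_linear (bF.1 p.2) a p.1.
Qed.

End EvaluationOps.

Let tsumE := (tsum_add, tsum_zero, tsum_scale).

Fact tens_addA : associative tens_add.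
Proof. by move=> *; apply: tens_ext => W F bF; rewrite !tsumE // addrA. Qed.
Fact tens_addC : commutative tens_add.
Proof. by move=> *; apply: tens_ext => W F bF; rewrite !tsumE // addrC. Qed.
Fact tens_add0 : left_id tens_zero tens_add.
Proof. by move=> *; apply: tens_ext => W F bF; rewrite !tsumE // add0r. Qed.
Fact tens_addN : left_inverse tens_zero tens_opp tens_add.
Proof.
by move=> *; apply: tens_ext => W F bF; rewrite !tsumE // scaleN1r addNr.
Qed.

HB.instance Definition _ :=
  GRing.isZmodule.Build (U ⨂ V) tens_addA tens_addC tens_add0 tens_addN.

Fact tens_scaleA a b t : tens_scale a (tens_scale b t) = tens_scale (a * b) t.
Proof. by apply: tens_ext => W F bF; rewrite !tsumE // scalerA. Qed.
Fact tens_scale1 : left_id 1 tens_scale.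
Proof. by move=> *; apply: tens_ext => W F bF; rewrite !tsumE // scale1r. Qed.
Fact tens_scaleDr : right_distributive tens_scale +%R.
Proof. by move=> *; apply: tens_ext => W F bF; rewrite !tsumE // scalerDr. Qed.
Fact tens_scaleDl t : {morph tens_scale^~ t : a b / a + b}.
Proof. by move=> a b; apply: tens_ext => W F bF; rewrite !tsumE // scalerDl. Qed.

HB.instance Definition _ := GRing.Zmodule_isLmodule.Build k (U ⨂ V)
  tens_scaleA tens_scale1 tens_scaleDr tens_scaleDl.

Lemma tens_bilinear : is_bilinear (@tens k U V).
Proof.
split => [v a u1 u2|u a v1 v2]; apply: tens_ext => W F bF;
  rewrite tsum_add // tsum_scale // !tsum_tens //.
- exact: bF.1.
- exact: bF.2.
Qed.

Lemma tsum_linear (W : lmodType k) (F : U -> V -> W) :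
  is_bilinear F -> linear (fun t : U ⨂ V => tsum t F).
Proof. by move=> bF a t1 t2; rewrite tsum_add // tsum_scale. Qed.

Lemma tsum_id t : \Sw_(u, v <- t) (u ⊗ v) = t.
Proof.
apply: tens_ext => W F bF.
have L := tsum_linear bF.
pose f : {linear U ⨂ V -> W} :=
  HB.pack (fun t => tsum t F) (GRing.isLinear.Build k (U ⨂ V) W *:%R _ L).
rewrite -[LHS]/(f _) linear_sum; apply: eq_bigr => p _ /=.
exact: tsum_tens.
Qed.

End TensorLmodule.

Section LinearityTools.
Variables (k : fieldType) (X U V W : lmodType k).

Lemma linear_tsum_body (t : U ⨂ V) (F : X -> U -> V -> W) :
  (forall u v, linear (fun x => F x u v)) -> linear (fun x => tsum t (F x)).
Proof.
move=> lF a x y; rewrite /tsum scaler_sumr -big_split; apply: eq_bigr => p _.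
exact: lF.
Qed.

Lemma linear_tsum_arg (g : X -> U ⨂ V) (F : U -> V -> W) :
  is_bilinear F -> linear g -> linear (fun x => tsum (g x) F).
Proof. by move=> bF lg a x y; rewrite lg tsum_linear. Qed.

Lemma linear_app (f : U -> W) (g : X -> U) :
  linear f -> linear g -> linear (fun x => f (g x)).
Proof. by move=> lf lg a x y; rewrite lg lf. Qed.

End LinearityTools.

Section LinearImage.
Variables (k : fieldType) (U V : lmodType k) (f : {linear U -> V}).

Definition in_limage : {pred V} := [pred v | `[< exists u, v = f u >]].

Fact in_limage_submod : submod_closed in_limage.
Proof.
split=> [|a v w]; first by apply/asboolP; exists 0; rewrite linear0.
move=> /asboolP[u ->] /asboolP[u' ->]; apply/asboolP.
by exists (a *: u + u'); rewrite linearP.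
Qed.

HB.instance Definition _ :=
  GRing.isSubmodClosed.Build k V in_limage in_limage_submod.

Record limage := LImage { limage_val :> V; _ : limage_val \in in_limage }.

HB.instance Definition _ := [isSub for limage_val].
HB.instance Definition _ := [Choice of limage by <:].
HB.instance Definition _ := [SubChoice_isSubLmodule of limage by <:].

Fact corestr_subproof u : f u \in in_limage.
Proof. by apply/asboolP; exists u. Qed.

Definition corestr (u : U) : limage := LImage (corestr_subproof u).

End LinearImage.

(* MathComp's algType requires 1 != 0. The zero algebra has to be allowed here:
   the space weak_smash defined below can vanish even if neither A nor H does.
   Take for instance H = k e_1 ⊕ k e_2 and A = k a_1 ⊕ k a_2 with orthogonal
   grouplike idempotents, ρ(e_i) = e_i ⊗ a_i, e_1 ⋅ x = a_2 x, e_2 ⋅ x = a_1 x. *)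
Class algebra (k : fieldType) (V : lmodType k) := Algebra {
  amul : V -> V -> V;
  aone : V;
  amul_bilinear : is_bilinear amul;
  amulA : associative amul;
  amul1l : left_id aone amul;
  amul1r : right_id aone amul
}.
Arguments aone {k} V {_}.

Notation "x ∗ y" := (amul x y) : ring_scope.
Notation "'\1_' V" := (aone V) : ring_scope.

(* Iterated tensor products are bracketed to the right. *)
Class coalgebra (k : fieldType) (V : lmodType k) := Coalgebra {
  comul : {linear V -> V ⨂ V};
  counit : {scalar V};
  coassoc : forall h,
    \Sw_(h', h3 <- comul h) \Sw_(h1, h2 <- comul h') (h1 ⊗ h2 ⊗ h3)
    = \Sw_(h1, h' <- comul h) \Sw_(h2, h3 <- comul h') (h1 ⊗ h2 ⊗ h3);
  counitl : forall h, \Sw_(h1, h2 <- comul h) (counit h1 *: h2) = h;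
  counitr : forall h, \Sw_(h1, h2 <- comul h) (counit h2 *: h1) = h
}.

Class weak_bialgebra (k : fieldType) (V : lmodType k) := WeakBialgebra {
  wb_algebra :: algebra V;
  wb_coalgebra :: coalgebra V;
  comul_mul : forall h g : V,
    comul (h ∗ g)
    = \Sw_(h1, h2 <- comul h) \Sw_(g1, g2 <- comul g) ((h1 ∗ g1) ⊗ (h2 ∗ g2));
  counit_mul12 : forall h g l : V,
    counit (h ∗ g ∗ l)
    = \Sw_(g1, g2 <- comul g) (counit (h ∗ g1) * counit (g2 ∗ l));
  counit_mul21 : forall h g l : V,
    counit (h ∗ g ∗ l)
    = \Sw_(g1, g2 <- comul g) (counit (h ∗ g2) * counit (g1 ∗ l));
  (* (1 ⊗ Δ(1)) (Δ(1) ⊗ 1) = Δ²(1) *)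
  comul_one_l :
    \Sw_(a1, a2 <- comul \1_V) \Sw_(b1, b2 <- comul \1_V)
      ((\1_V ∗ b1) ⊗ (a1 ∗ b2) ⊗ (a2 ∗ \1_V))
    = \Sw_(a', a3 <- comul \1_V) \Sw_(a1, a2 <- comul a') (a1 ⊗ a2 ⊗ a3);
  (* (Δ(1) ⊗ 1) (1 ⊗ Δ(1)) = Δ²(1) *)
  comul_one_r :
    \Sw_(a1, a2 <- comul \1_V) \Sw_(b1, b2 <- comul \1_V)
      ((a1 ∗ \1_V) ⊗ (a2 ∗ b1) ⊗ (\1_V ∗ b2))
    = \Sw_(a', a3 <- comul \1_V) \Sw_(a1, a2 <- comul a') (a1 ⊗ a2 ⊗ a3)
}.

Section CounitalMaps.
Variables (k : fieldType) (V : lmodType k) (bV : weak_bialgebra V).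

Definition eps_t (h : V) : V :=
  \Sw_(a1, a2 <- comul \1_V) (counit (a1 ∗ h) *: a2).

Definition eps_s (h : V) : V :=
  \Sw_(a1, a2 <- comul \1_V) (counit (h ∗ a2) *: a1).

End CounitalMaps.
Arguments eps_t {k V bV} h.
Arguments eps_s {k V bV} h.

Section ModuleAlgebra.
Variables (k : fieldType) (H A : lmodType k).
Variables (bH : weak_bialgebra H) (aA : algebra A).
Variable act : {bilinear H -> A -> A}.
Local Notation "h ⋅ x" := (act h x).

Record module_algebra : Prop := ModuleAlgebra {
  act_one : forall x, \1_H ⋅ x = x;
  act_mul : forall h x y,
    h ⋅ (x ∗ y) = \Sw_(h1, h2 <- comul h) ((h1 ⋅ x) ∗ (h2 ⋅ y));
  act_act : forall h g x, h ⋅ (g ⋅ x) = (h ∗ g) ⋅ x;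
  act_unit : forall h, h ⋅ \1_A = eps_t h ⋅ \1_A
}.

End ModuleAlgebra.

Section ComoduleCoalgebra.
Variables (k : fieldType) (H A : lmodType k).
Variables (cH : coalgebra H) (bA : weak_bialgebra A).
Variable rho : {linear H -> H ⨂ A}.

Record comodule_coalgebra : Prop := ComoduleCoalgebra {
  coact_counit : forall h, \Sw_(h0, h1 <- rho h) (counit h1 *: h0) = h;
  coact_comul : forall h,
    \Sw_(u, a <- rho h) \Sw_(u1, u2 <- comul u) (u1 ⊗ u2 ⊗ a)
    = \Sw_(h1, h2 <- comul h) \Sw_(u1, a1 <- rho h1) \Sw_(u2, a2 <- rho h2)
        (u1 ⊗ u2 ⊗ (a1 ∗ a2));
  coact_coact : forall h,
    \Sw_(h0, h1 <- rho h) \Sw_(h00, h01 <- rho h0) (h00 ⊗ h01 ⊗ h1)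
    = \Sw_(h0, h1 <- rho h) \Sw_(a1, a2 <- comul h1) (h0 ⊗ a1 ⊗ a2);
  coact_unit : forall h,
    \Sw_(h0, h1 <- rho h) (counit h0 *: h1)
    = \Sw_(h0, h1 <- rho h) (counit h0 *: eps_s h1)
}.

End ComoduleCoalgebra.

Section MatchedPair.
Variables (k : fieldType) (H A : lmodType k).
Variables (bH : weak_bialgebra H) (bA : weak_bialgebra A).
Variables (act : {bilinear H -> A -> A}) (rho : {linear H -> H ⨂ A}).
Local Notation "h ⋅ x" := (act h x).

Record weak_matched_pair : Prop := WeakMatchedPair {
  wmp_module : module_algebra bH wb_algebra act;
  wmp_comodule : comodule_coalgebra wb_coalgebra bA rho;
  wmp_compat : forall (h g : H) (x : A),
    \Sw_(h1, h2 <- comul h) \Sw_(u, a <- rho (h2 ∗ g))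
      \Sw_(y1, y2 <- comul (h1 ⋅ x)) (u ⊗ y1 ⊗ (y2 ∗ a))
    = \Sw_(h1, h' <- comul h) \Sw_(h2, h'' <- comul h')
      \Sw_(h3, h4 <- comul h'')
      \Sw_(u1, a1 <- rho h1) \Sw_(u3, a3 <- rho h3) \Sw_(v, b <- rho g)
      \Sw_(x1, x2 <- comul x)
        ((u3 ∗ v) ⊗ (u1 ⋅ x1) ⊗ (a1 ∗ (h2 ⋅ x2) ∗ a3 ∗ (h4 ⋅ b)));
  wmp_eps_s : forall (h : H) (x : A),
    eps_s (h ⋅ x) = eps_s (h ⋅ \1_A) ∗ eps_s x;
  wmp_coact_one :
    \Sw_(i1, i2 <- comul \1_H) \Sw_(u, a <- rho i1) (u ⊗ a ⊗ i2)
    = \Sw_(i1, i2 <- comul \1_H) \Sw_(j1, j2 <- comul \1_H)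
      \Sw_(u, a <- rho j1) (i1 ⊗ (counit u *: a) ⊗ (i2 ∗ j2))
}.

Record abelian_weak_matched_pair : Prop := AbelianWeakMatchedPair {
  abelian_wmp :> weak_matched_pair;
  abelian_cocomm : forall h : H,
    comul h = \Sw_(h1, h2 <- comul h) (h2 ⊗ h1);
  abelian_comm : forall x y : A, x ∗ y = y ∗ x
}.

Record compatible_weak_matched_pair : Prop := CompatibleWeakMatchedPair {
  compatible_awmp :> abelian_weak_matched_pair;
  compatible_counit : forall h : H,
    h ⋅ \1_A
    = \Sw_(h1, h2 <- comul h) \Sw_(i1, i2 <- comul \1_A)
        (counit (h2 ⋅ i2) *: (h1 ⋅ i1));
  compatible_comul : forall h g : H,
    \Sw_(i1, i2 <- comul \1_A) ((h ⋅ i1) ⊗ (g ⋅ i2))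
    = \Sw_(i1, i2 <- comul \1_A) (((h ⋅ \1_A) ∗ i1) ⊗ ((g ⋅ \1_A) ∗ i2))
}.

(* The operations of A # H, on the vector space A ⨂ H. *)
Definition smash_mul (z w : A ⨂ H) : A ⨂ H :=
  \Sw_(x, h <- z) \Sw_(y, g <- w) \Sw_(h1, h2 <- comul h)
    ((x ∗ (h1 ⋅ y)) ⊗ (h2 ∗ g)).

Definition smash_comul (z : A ⨂ H) : (A ⨂ H) ⨂ (A ⨂ H) :=
  \Sw_(x, h <- z) \Sw_(x1, x2 <- comul x) \Sw_(h1, h2 <- comul h)
    \Sw_(u, a <- rho h1) ((x1 ⊗ u) ⊗ ((x2 ∗ a) ⊗ h2)).

Definition smash_counit (z : A ⨂ H) : k :=
  \Sw_(x, h <- z) (counit x * counit h).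

(* smash_under (x ⊗ h) = (x # h) (1 # 1) is the element written with one
   underline; smash_proj = (id ⊗ ε) Δ smash_under, whose value at x ⊗ h is the
   element written with an underline and an overline. *)
Definition smash_under (z : A ⨂ H) : A ⨂ H := smash_mul z (\1_A ⊗ \1_H).

Definition smash_proj (z : A ⨂ H) : A ⨂ H :=
  \Sw_(p, q <- smash_comul (smash_under z)) (smash_counit q *: p).

Fact smash_mul_body_bilinear (w : A ⨂ H) :
  is_bilinear (fun x h => \Sw_(y, g <- w) \Sw_(h1, h2 <- comul h)
    ((x ∗ (h1 ⋅ y)) ⊗ (h2 ∗ g))).
Proof.
split=> [h|x]; apply: linear_tsum_body => y g.
  apply: linear_tsum_body => h1 h2.
  by apply: (linear_app ((tens_bilinear _ _).1 _)); exact: amul_bilinear.1.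
apply: linear_tsum_arg; last exact: linearP.
split=> [h2|h1].
  apply: (linear_app ((tens_bilinear _ _).1 _)).
  apply: (linear_app (amul_bilinear.2 _)).
  by move=> a u v; rewrite linearPl.
by apply: (linear_app ((tens_bilinear _ _).2 _)); exact: amul_bilinear.1.
Qed.

Fact smash_comul_body_bilinear :
  is_bilinear (fun x h => \Sw_(x1, x2 <- comul x) \Sw_(h1, h2 <- comul h)
    \Sw_(u, a <- rho h1) ((x1 ⊗ u) ⊗ ((x2 ∗ a) ⊗ h2))).
Proof.
split=> [h|x].
  apply: linear_tsum_arg; last exact: linearP.
  split=> [x2|x1]; apply: linear_tsum_body => h1 h2;
    apply: linear_tsum_body => u a.
    by apply: (linear_app ((tens_bilinear _ _).1 _)); exact: (tens_bilinear _ _).1.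
  apply: (linear_app ((tens_bilinear _ _).2 _)).
  by apply: (linear_app ((tens_bilinear _ _).1 _)); exact: amul_bilinear.1.
apply: linear_tsum_body => x1 x2.
apply: linear_tsum_arg; last exact: linearP.
split=> [h2|h1]; last first.
  apply: linear_tsum_body => u a.
  by apply: (linear_app ((tens_bilinear _ _).2 _)); exact: (tens_bilinear _ _).2.
apply: linear_tsum_arg; last exact: linearP.
split=> [a|u].
  by apply: (linear_app ((tens_bilinear _ _).1 _)); exact: (tens_bilinear _ _).2.
apply: (linear_app ((tens_bilinear _ _).2 _)).
by apply: (linear_app ((tens_bilinear _ _).1 _)); exact: amul_bilinear.2.
Qed.

Fact smash_counit_body_bilinear :
  is_bilinear (fun (x : A) (h : H) => (counit x * counit h : k^o)).
Proof.
by split=> [h|x] a u v; rewrite linearP ?mulrDl ?mulrDr -?mulrA //= mulrCA.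
Qed.

Lemma smash_mul_tens x h y g :
  smash_mul (x ⊗ h) (y ⊗ g)
  = \Sw_(h1, h2 <- comul h) ((x ∗ (h1 ⋅ y)) ⊗ (h2 ∗ g)).
Proof.
rewrite /smash_mul (tsum_tens (smash_mul_body_bilinear _)).
apply: (@tsum_tens _ _ _ _
  (fun y g => \Sw_(h1, h2 <- comul h) ((x ∗ (h1 ⋅ y)) ⊗ (h2 ∗ g)))).
split=> [g'|y']; apply: linear_tsum_body => h1 h2.
  apply: (linear_app ((tens_bilinear _ _).1 _)).
  by apply: (linear_app (amul_bilinear.2 _)) => a u v; rewrite linearPr.
by apply: (linear_app ((tens_bilinear _ _).2 _)); exact: amul_bilinear.2.
Qed.

Lemma smash_comul_tens x h :
  smash_comul (x ⊗ h)
  = \Sw_(x1, x2 <- comul x) \Sw_(h1, h2 <- comul h) \Sw_(u, a <- rho h1)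
      ((x1 ⊗ u) ⊗ ((x2 ∗ a) ⊗ h2)).
Proof. exact: tsum_tens smash_comul_body_bilinear _ _. Qed.

Lemma smash_counit_tens x h : smash_counit (x ⊗ h) = counit x * counit h.
Proof. exact: tsum_tens smash_counit_body_bilinear _ _. Qed.

Fact smash_proj_linear : linear smash_proj.
Proof.
apply: linear_tsum_arg.
  split=> [q|p] a u v /=.
    by rewrite scalerDr !scalerA [_ * a]mulrC.
  have -> : smash_counit (a *: u + v) = a * smash_counit u + smash_counit v.
    exact: tsum_linear smash_counit_body_bilinear a u v.
  by rewrite scalerDl -scalerA.
apply: (linear_app (tsum_linear smash_comul_body_bilinear)).
exact: tsum_linear (smash_mul_body_bilinear _).
Qed.

HB.instance Definition _ :=
  GRing.isLinear.Build k (A ⨂ H) (A ⨂ H) *:%R smash_proj smash_proj_linear.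

Definition weak_smash : lmodType k := limage smash_proj.

Definition wsmash (x : A) (h : H) : weak_smash := corestr smash_proj (x ⊗ h).

End MatchedPair.

(* Main.v *)
(** Let α(h) = h ⋅ 1, γ(h) = ε(h^0) h^1 and π = α ⋆ γ in the convolution algebra
    Hom(H, A), which is commutative since H is cocommutative and A commutative.
    Then the projection P onto the weak smash product is
    x ⊗ h |-> x π(h_1) ⊗ h_2, and most of the theorem reduces to identities
    between convolution products.

    Commutativity of A makes ε_s and ε_t multiplicative, so axiom (iv) reads
    ε((h ⋅ x) b) = ε(α(h) x b), and the compatibility conditions give
    h ⋅ a = α(h) a for a in the images of ε_s and ε_t, and α = α ⋆ ε_s α.
    With these, axiom (iii) shows that P(P(z) w) = P(z w) = P(z P(w)) and that
    (P ⊗ P) Δ P = (P ⊗ P) Δ, while the product and the coproduct of A # H are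
    associative, coassociative and compatible. Hence the structure of A # H
    descends along P, with counit x ⊗ h |-> ε(x π(h)). The weak multiplicativity
    of this counit comes from p(h g) = p(h_1) p(g_1) ε(h_2 g_2) for p = ε_s π. *)

From HB Require Import structures.
Require Import Defs.
From mathcomp Require Import all_boot all_order all_algebra.
From mathcomp Require Import boolp.
From Stdlib Require Import Ring.

Set Implicit Arguments.
Unset Strict Implicit.
Unset Printing Implicit Defensive.

Import GRing.Theory.
Local Open Scope ring_scope.

(** * Multilinear maps and Sweedler sums *)

(** Axiom (iii) lives in H ⊗ A ⊗ A. It becomes an identity of convolution products once H and both
    copies of A are mapped linearly into one commutative algebra B, because all legs of h then land
    in B. Its consequences come from the choice of maps. Taking ε on the first copy of A describes α
    and γ under right multiplication by g. The statements about Δ need maps that lose nothing; these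
    go into (A ⊗ A) ⊗ (k ⊕ H), where H is an ideal of square zero.

    The obstacle is that axiom (iii) at x = 1, g = 1 is not a plain absorption rule: it leaves a
    factor κ(h) = ε_t(h^0 ⋅ 1) h^1 and a right multiplication by ρ(1). As ρ(1) is idempotent,
    substituting the identity into itself shows that this multiplication is invisible next to α;
    then κ is absorbed as well.

    For the counit, ε on A sees a factor only through ε_s, so the value on a triple product depends
    on p alone. Commutativity of Hom(H, A) makes the order of the legs of g irrelevant, so both
    forms of weak multiplicativity have the same proof. *)

Section Multilinear.
Variable k : fieldType.
Implicit Types U V W X : lmodType k.

Lemma lin_id U : linear (fun x : U => x).
Proof. by []. Qed.

Lemma lin_fun X U W (f : {linear U -> W}) (g : X -> U) :
  linear g -> linear (fun x => f (g x)).
Proof. by move=> lg a x y; rewrite lg linearP. Qed.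

Lemma lin_bil_l X U V W (b : {bilinear U -> V -> W}) (g : X -> U) v :
  linear g -> linear (fun x => b (g x) v).
Proof. by move=> lg a x y; rewrite lg linearPl. Qed.

Lemma lin_bil_r X U V W (b : {bilinear U -> V -> W}) (g : X -> V) u :
  linear g -> linear (fun x => b u (g x)).
Proof. by move=> lg a x y; rewrite lg linearPr. Qed.

Lemma lin_tens_l X U V (g : X -> U) (v : V) :
  linear g -> linear (fun x => g x ⊗ v).
Proof. exact: linear_app ((tens_bilinear U V).1 v). Qed.

Lemma lin_tens_r X U V (g : X -> V) (u : U) :
  linear g -> linear (fun x => u ⊗ g x).
Proof. exact: linear_app ((tens_bilinear U V).2 u). Qed.

Lemma lin_amul_l X V (aV : algebra V) (g : X -> V) (v : V) :
  linear g -> linear (fun x => g x ∗ v).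
Proof. exact: linear_app (amul_bilinear.1 v). Qed.

Lemma lin_amul_r X V (aV : algebra V) (g : X -> V) (v : V) :
  linear g -> linear (fun x => v ∗ g x).
Proof. exact: linear_app (amul_bilinear.2 v). Qed.

Lemma lin_counit X V (cV : coalgebra V) (g : X -> V) :
  linear g -> linear (fun x => counit (g x) : k^o).
Proof. by move=> lg a x y; rewrite lg linearP. Qed.

Lemma lin_scale_l X V (g : X -> k^o) (v : V) :
  linear g -> linear (fun x => (g x : k) *: v).
Proof. by move=> lg a x y; rewrite lg scalerDl scalerA. Qed.

Lemma lin_scale_r X V (g : X -> V) (c : k) :
  linear g -> linear (fun x => c *: g x).
Proof. by move=> lg a x y; rewrite lg scalerDr !scalerA mulrC. Qed.

Lemma lin_mulk_l X (g : X -> k^o) (c : k) :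
  linear g -> linear (fun x => (g x : k) * c : k^o).
Proof. by move=> lg a x y; rewrite lg mulrDl -mulrA. Qed.

Lemma lin_mulk_r X (g : X -> k^o) (c : k) :
  linear g -> linear (fun x => c * (g x : k) : k^o).
Proof. by move=> lg a x y; rewrite lg mulrDr mulrCA. Qed.

Lemma lin_pair_r X U V (g : X -> V) : 
  linear g -> linear (fun x => (0 : U, g x)).
Proof. by move=> lg a x y; rewrite lg; congr pair; rewrite /= scaler0 addr0. Qed.

Section AlgebraScale.
Variables (V : lmodType k) (aV : algebra V).
Implicit Types x y z : V.

Lemma amulZl c x y : (c *: x) ∗ y = c *: (x ∗ y).
Proof. by have := scalable_linear ((@amul_bilinear _ _ aV).1 y) c x. Qed.
Lemma amulZr c x y : x ∗ (c *: y) = c *: (x ∗ y).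
Proof. by have := scalable_linear ((@amul_bilinear _ _ aV).2 x) c y. Qed.
Lemma amulDl x y z : (x + y) ∗ z = x ∗ z + y ∗ z.
Proof. by have := (@amul_bilinear _ _ aV).1 z 1 x y; rewrite /= !scale1r. Qed.
Lemma amulDr x y z : z ∗ (x + y) = z ∗ x + z ∗ y.
Proof. by have := (@amul_bilinear _ _ aV).2 z 1 x y; rewrite /= !scale1r. Qed.
Lemma amul0l z : 0 ∗ z = 0.
Proof. by rewrite -[X in X ∗ _](scale0r (0 : V)) amulZl scale0r. Qed.

End AlgebraScale.

Lemma tensZl U V c (u : U) (v : V) : (c *: u) ⊗ v = c *: (u ⊗ v).
Proof. by have := scalable_linear ((tens_bilinear U V).1 v) c u. Qed.

End Multilinear.

Definition is_trilinear (k : fieldType) (U V W X : lmodType k)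
    (F : U -> V -> W -> X) :=
  [/\ forall v w, linear (fun u => F u v w), forall u w, linear (fun v => F u v w)
    & forall u v, linear (fun w => F u v w)].

(* Redefined once further operations are available. *)
Ltac lin_extra := fail.

(** Peels the outermost operation. The argument that must be constant fails to unify when it
    contains the variable, and this decides between the left and right versions. *)
Ltac lin_step := lazymatch goal with
  | |- _ (fun x => x) => apply: lin_id
  | |- _ (fun x => tens _ _) => first [apply: lin_tens_l | apply: lin_tens_r]
  | |- _ (fun x => amul _ _) => first [apply: lin_amul_l | apply: lin_amul_r]
  | |- _ (fun x => tsum _ _) =>
      first [apply: linear_tsum_body => ? ? | apply: linear_tsum_arg]
  | |- _ (fun x => GRing.scale _ _) =>
      first [apply: lin_scale_l | apply: lin_scale_r]
  | |- _ (fun x => GRing.mul _ _) =>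
      first [apply: lin_mulk_l | apply: lin_mulk_r]
  | |- _ => first [lin_extra | apply: lin_counit | apply: lin_bil_l | apply: lin_bil_r
                  | apply: lin_fun | lin_hyp ]
  end
with lin_hyp := match goal with
  | lF : GRing.linear_for _ _ |- _ => apply: (linear_app lF)
  | bF : bilinear_for _ _ ?F |- _ =>
      first [apply: (linear_app (bF.1 _)) | apply: (linear_app (bF.2 _))]
  | tF : is_trilinear ?F |- _ =>
      let F1 := fresh in let F2 := fresh in let F3 := fresh in
      have [F1 F2 F3] := tF;
      first [apply: (linear_app (F1 _ _)) | apply: (linear_app (F2 _ _))
            | apply: (linear_app (F3 _ _))]; clear F1 F2 F3
  end.

Ltac lin_eta := lazymatch goal with
  | |- GRing.linear_for _ (fun _ => _) => idtac
  | |- GRing.linear_for ?s ?f => change (GRing.linear_for s (fun x => f x))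
  end.

(* Also uses the multilinearity hypotheses of the context. *)
Ltac lin := cbv beta; lazymatch goal with
  | |- is_trilinear _ => split=> ? ?; lin
  | |- bilinear_for _ _ _ => split=> ?; lin
  | |- _ => lin_eta; lin_step; lin
  end.

Section Sums.
Variable k : fieldType.
Implicit Types U V W X Y : lmodType k.

Lemma eq_tsum U V (W : nmodType) (t : U ⨂ V) (F G : U -> V -> W) :
  (forall u v, F u v = G u v) -> tsum t F = tsum t G.
Proof. by move=> e; apply: eq_bigr => p _. Qed.

Lemma exchange_tsum U V X Y (W : nmodType) (t : U ⨂ V) (s : X ⨂ Y)
    (F : U -> V -> X -> Y -> W) :
  \Sw_(u, v <- t) \Sw_(x, y <- s) F u v x y
  = \Sw_(x, y <- s) \Sw_(u, v <- t) F u v x y.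
Proof. exact: exchange_big. Qed.

Lemma exchange_tsum2 U V X Y U' V' (W : nmodType) (t : U ⨂ V) (s : X ⨂ Y)
    (r : U' ⨂ V') (F : U -> V -> X -> Y -> U' -> V' -> W) :
  \Sw_(u, v <- t) \Sw_(x, y <- s) \Sw_(p, q <- r) F u v x y p q
  = \Sw_(p, q <- r) \Sw_(u, v <- t) \Sw_(x, y <- s) F u v x y p q.
Proof.
rewrite -[RHS]exchange_tsum; apply: eq_tsum => u v; exact: exchange_tsum.
Qed.

Lemma linear_tsum U V X Y (f : {linear X -> Y}) (t : U ⨂ V) (F : U -> V -> X) :
  f (tsum t F) = \Sw_(u, v <- t) f (F u v).
Proof. exact: linear_sum. Qed.

Lemma lin_tsum U V X Y (f : X -> Y) (t : U ⨂ V) (F : U -> V -> X) :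
  linear f -> f (tsum t F) = \Sw_(u, v <- t) f (F u v).
Proof.
move=> lf; pose g : {linear X -> Y} := HB.pack f (GRing.isLinear.Build k X Y *:%R
  f lf).
exact: (linear_tsum g).
Qed.

Lemma amul_tsuml U V W (aW : algebra W) (t : U ⨂ V) (F : U -> V -> W) w :
  tsum t F ∗ w = \Sw_(u, v <- t) (F u v ∗ w).
Proof. exact: lin_tsum _ _ (amul_bilinear.1 w). Qed.

Lemma amul_tsumr U V W (aW : algebra W) (t : U ⨂ V) (F : U -> V -> W) w :
  w ∗ tsum t F = \Sw_(u, v <- t) (w ∗ F u v).
Proof. exact: lin_tsum _ _ (amul_bilinear.2 w). Qed.

Lemma scale_tsuml U V W (t : U ⨂ V) (F : U -> V -> k) (w : W) :
  tsum t F *: w = \Sw_(u, v <- t) (F u v *: w).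
Proof. exact: scaler_suml. Qed.

Lemma scale_tsumr U V W (t : U ⨂ V) (F : U -> V -> W) (c : k) :
  c *: tsum t F = \Sw_(u, v <- t) (c *: F u v).
Proof. exact: scaler_sumr. Qed.

Lemma tens_tsuml U V X Y (t : U ⨂ V) (F : U -> V -> X) (y : Y) :
  tsum t F ⊗ y = \Sw_(u, v <- t) (F u v ⊗ y).
Proof. exact: lin_tsum _ _ ((tens_bilinear X Y).1 y). Qed.

Lemma tsum_tsum U V X Y W (t : U ⨂ V) (F : U -> V -> X ⨂ Y) (G : X -> Y -> W) :
  is_bilinear G ->
  tsum (tsum t F) G = \Sw_(u, v <- t) tsum (F u v) G.
Proof. by move=> bG; rewrite (lin_tsum _ _ (tsum_linear bG)). Qed.

Section Evaluation3.
Variables (U V W X : lmodType k) (F : U -> V -> W -> X).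
Hypothesis tF : is_trilinear F.

Definition ev3 (t : U ⨂ V ⨂ W) : X := \Sw_(u, t' <- t) \Sw_(v, w <- t') F u v w.

Let bF2 u : is_bilinear (F u).
Proof. by case: tF => F1 F2 F3; split=> ?; [apply: F2|apply: F3]. Qed.

Let bF : is_bilinear (fun u t' => \Sw_(v, w <- t') F u v w).
Proof.
split=> ?; last exact: tsum_linear (bF2 _).
by apply: linear_tsum_body; case: tF.
Qed.

Lemma ev3_tsum (Y Z : lmodType k) (t : Y ⨂ Z) G :
  ev3 (tsum t G) = \Sw_(y, z <- t) ev3 (G y z).
Proof. exact: (lin_tsum _ _ (tsum_linear bF)). Qed.

Lemma ev3_tens u v w : ev3 (u ⊗ v ⊗ w) = F u v w.
Proof. by rewrite /ev3 tsum_tens // tsum_tens. Qed.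

End Evaluation3.

End Sums.

(* Moves the sum found under n sums to the front. *)
Ltac pull_sum n := lazymatch n with
  | O => reflexivity
  | S ?m => etransitivity;
      [apply: eq_tsum => ? ?; pull_sum m | exact: exchange_tsum]
  end.

(* Evaluates a trilinear map on both sides of an identity between Sweedler sums
   in a threefold tensor product. *)
Ltac ev3_push :=
  repeat (rewrite ev3_tsum; [|assumption]; apply: eq_tsum => ? ?);
  rewrite ev3_tens //.
Ltac ev3_of F E :=
  apply: (etrans _ (etrans (congr1 (ev3 F) E) _)); [symmetry|]; ev3_push.

Section Coalgebra.
Variables (k : fieldType) (H : lmodType k) (cH : coalgebra H).
Implicit Types W : lmodType k.

(* The suffix F marks an identity between tensors that is stated as an equality
   of the values of an arbitrary multilinear map F. *)
Lemma coassocF W (F : H -> H -> H -> W) h : is_trilinear F ->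
  \Sw_(h', h3 <- comul h) \Sw_(h1, h2 <- comul h') F h1 h2 h3
  = \Sw_(h1, h' <- comul h) \Sw_(h2, h3 <- comul h') F h1 h2 h3.
Proof. by move=> tF; ev3_of F (coassoc h). Qed.

Hypothesis cocomm : forall h : H, comul h = \Sw_(h1, h2 <- comul h) (h2 ⊗ h1).

Lemma cocommF W (F : H -> H -> W) h : is_bilinear F ->
  \Sw_(h1, h2 <- comul h) F h1 h2 = \Sw_(h1, h2 <- comul h) F h2 h1.
Proof.
move=> bF; rewrite {1}cocomm tsum_tsum //; apply: eq_tsum => u v.
by rewrite tsum_tens.
Qed.

Lemma cocommAF W (F : H -> H -> H -> W) h : is_trilinear F ->
  \Sw_(h1, h' <- comul h) \Sw_(h2, h3 <- comul h') F h1 h2 h3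
  = \Sw_(h1, h' <- comul h) \Sw_(h2, h3 <- comul h') F h2 h1 h3.
Proof.
move=> tF; rewrite -coassocF // -[RHS]coassocF; last lin; apply: eq_tsum => u v;
  by apply: cocommF; lin.
Qed.

End Coalgebra.

(** A semiring theory is enough for [ring] here: the goals given to it contain no subtraction. *)
Lemma commutative_srt (k : fieldType) (B : lmodType k) (aB : algebra B) :
  (forall x y : B, x ∗ y = y ∗ x) -> semi_ring_theory (R := B) 0 \1_B +%R amul eq.
Proof.
move=> commB; split=> *;
  rewrite ?add0r ?amul1l ?amul0l ?amulA ?amulDl ?addrA //; exact: addrC.
Qed.

(** * Convolution algebras *)

(** It receives an [lmodType] structure below and can then serve as a target B itself, so that
    Hom(H, Hom(H, A)) makes sense. *)
Record conv (k : fieldType) (H B : lmodType k) := Conv {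
  conv_fun :> H -> B;
  conv_lin : linear conv_fun
}.

Section ConvModule.
Variables (k : fieldType) (H B : lmodType k).
Implicit Types f g : conv H B.

HB.instance Definition _ f :=
  GRing.isLinear.Build k H B *:%R (conv_fun f) (conv_lin f).

Lemma convP f g : f =1 g -> f = g.
Proof.
case: f g => [f lf] [g lg] /= /funext e; rewrite {f}e in lf *.
by congr Conv; apply: Prop_irrelevance.
Qed.

HB.instance Definition _ := gen_eqMixin (conv H B).
HB.instance Definition _ := gen_choiceMixin (conv H B).

Definition conv0 : conv H B := @Conv _ H B (fun=> 0) (fun a x y => esym (etrans
  (addr0 _) (scaler0 _ _))).
Fact conv_add_linear f g : linear (fun h => f h + g h).
Proof. by move=> a x y; rewrite !linearP /= addrACA -scalerDr. Qed.
Definition conv_add f g := Conv (conv_add_linear f g).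
Fact conv_scale_linear (c : k) f : linear (fun h => c *: f h).
Proof. lin. Qed.
Definition conv_scale c f := Conv (conv_scale_linear c f).
Definition conv_opp f := conv_scale (-1) f.

Fact conv_addA : associative conv_add.
Proof. by move=> *; apply: convP => h /=; rewrite addrA. Qed.
Fact conv_addC : commutative conv_add.
Proof. by move=> *; apply: convP => h /=; rewrite addrC. Qed.
Fact conv_add0 : left_id conv0 conv_add.
Proof. by move=> *; apply: convP => h /=; rewrite add0r. Qed.
Fact conv_addN : left_inverse conv0 conv_opp conv_add.
Proof. by move=> *; apply: convP => h /=; rewrite scaleN1r addNr. Qed.
HB.instance Definition _ :=
  GRing.isZmodule.Build (conv H B) conv_addA conv_addC conv_add0 conv_addN.

Fact conv_scaleA a b f : conv_scale a (conv_scale b f) = conv_scale (a * b) f.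
Proof. by apply: convP => h /=; rewrite scalerA. Qed.
Fact conv_scale1 : left_id 1 conv_scale.
Proof. by move=> *; apply: convP => h /=; rewrite scale1r. Qed.
Fact conv_scaleDr : right_distributive conv_scale +%R.
Proof. by move=> *; apply: convP => h /=; rewrite scalerDr. Qed.
Fact conv_scaleDl f : {morph conv_scale^~ f : a b / a + b}.
Proof. by move=> a b; apply: convP => h /=; rewrite scalerDl. Qed.
HB.instance Definition _ := GRing.Zmodule_isLmodule.Build k (conv H B)
  conv_scaleA conv_scale1 conv_scaleDr conv_scaleDl.

Lemma conv_tsumE (U V : lmodType k) (t : U ⨂ V) (F : U -> V -> conv H B) h :
  (tsum t F) h = \Sw_(u, v <- t) F u v h.
Proof.
have lh : linear (fun f : conv H B => f h) by [].
exact: (lin_tsum _ _ lh).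
Qed.

Lemma lin_conv_app (X : lmodType k) (f : X -> conv H B) h :
  linear f -> linear (fun x => f x h).
Proof. by move=> lf a x y; rewrite lf. Qed.

End ConvModule.

Ltac lin_extra ::= apply: lin_conv_app.

Section Convolution.
Variables (k : fieldType) (H B : lmodType k).
Variables (cH : coalgebra H) (aB : algebra B).
Implicit Types f g : conv H B.

(* For H cocommutative and B commutative this product is commutative: then an
   identity in which every Sweedler leg of h ends up in B is left to ring. *)
Fact conv_mul_linear f g : linear (fun h => \Sw_(h1, h2 <- comul h) (f h1 ∗ g h2)).
Proof. lin. Qed.
Definition conv_mul f g := Conv (conv_mul_linear f g).
Local Notation "f ⋆ g" := (conv_mul f g) (at level 40, left associativity).

Fact conv_cst_linear (b : B) : linear (fun h : H => counit h *: b).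
Proof. lin. Qed.
Definition conv_cst b := Conv (conv_cst_linear b).
Definition conv_one := conv_cst \1_B.

Lemma conv_mulE f g h : (f ⋆ g) h = \Sw_(h1, h2 <- comul h) (f h1 ∗ g h2).
Proof. by []. Qed.

Lemma conv_mulA : associative conv_mul.
Proof.
move=> f g e; apply: convP => h /=.
transitivity (\Sw_(h1, h' <- comul h) \Sw_(h2, h3 <- comul h') (f h1 ∗ g h2 ∗ e h3)).
  apply: eq_tsum => u v; rewrite amul_tsumr.
  by apply: eq_tsum => *; rewrite amulA.
rewrite -coassocF; last by split=> *; lin.
by apply: eq_tsum => u v; rewrite amul_tsuml.
Qed.

Lemma conv_mul1 : left_id conv_one conv_mul.
Proof.
move=> f; apply: convP => h /=; rewrite -{2}[h]counitl linear_tsum.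
by apply: eq_tsum => u v; rewrite amulZl amul1l linearZ.
Qed.

Lemma conv_mul_lin_l g : linear (conv_mul^~ g).
Proof.
move=> a f f'; apply: convP => h /=; rewrite scale_tsumr -big_split.
by apply: eq_bigr => p _; rewrite /= amulDl amulZl.
Qed.

Lemma conv_mul_lin_r f : linear (conv_mul f).
Proof.
move=> a g g'; apply: convP => h /=; rewrite scale_tsumr -big_split.
by apply: eq_bigr => p _; rewrite /= amulDr amulZr.
Qed.

Lemma conv_mulDl f g e : (f + g) ⋆ e = f ⋆ e + g ⋆ e.
Proof. by have := conv_mul_lin_l e 1 f g; rewrite !scale1r. Qed.

Lemma conv_mul0l g : 0 ⋆ g = 0.
Proof. by have := conv_mul_lin_l g (-1) 0 0; rewrite !scaleN1r oppr0 add0r addNr. Qed.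

Lemma conv_mul_tsumr (U V : lmodType k) f (t : U ⨂ V) F :
  f ⋆ tsum t F = \Sw_(u, v <- t) (f ⋆ F u v).
Proof. exact: lin_tsum _ _ (conv_mul_lin_r f). Qed.

Lemma conv_mul_tsuml (U V : lmodType k) f (t : U ⨂ V) F :
  tsum t F ⋆ f = \Sw_(u, v <- t) (F u v ⋆ f).
Proof. exact: lin_tsum _ _ (conv_mul_lin_l f). Qed.

Hypothesis cocomm : forall h : H, comul h = \Sw_(h1, h2 <- comul h) (h2 ⊗ h1).

(** Coassociativity merges the legs sent to B while the last one stays in H; this is how identities
    in Hom(H, B) are used inside A ⊗ H. *)
Lemma conv_mul_leg (W : lmodType k) (F : B -> H -> W) f g h : is_bilinear F ->
  \Sw_(h1, h' <- comul h) \Sw_(h2, h3 <- comul h') F (f h1 ∗ g h2) h3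
  = \Sw_(h1, h2 <- comul h) F ((f ⋆ g) h1) h2.
Proof.
move=> bF; rewrite -coassocF; last lin.
by apply: eq_tsum => u v; rewrite /= (lin_tsum _ _ (bF.1 v)).
Qed.

Hypothesis commB : forall x y : B, x ∗ y = y ∗ x.

Lemma conv_mulC : commutative conv_mul.
Proof.
move=> f g; apply: convP => h /=; rewrite cocommF //; last lin.
by apply: eq_tsum => u v; rewrite commB.
Qed.

Lemma conv_srt : semi_ring_theory (R := conv H B) 0 conv_one +%R conv_mul eq.
Proof.
split=> *; rewrite ?add0r ?conv_mul1 ?conv_mulA ?conv_mulDl ?addrA //.
- exact: addrC.
- exact: conv_mul0l.
- exact: conv_mulC.
Qed.

Lemma conv_cst_mulr f b h : (f ⋆ conv_cst b) h = f h ∗ b.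
Proof.
rewrite /= -{2}[h]counitr linear_tsum amul_tsuml.
by apply: eq_tsum => *; rewrite amulZr linearZ amulZl.
Qed.

Lemma conv_cst_mull f b h : (conv_cst b ⋆ f) h = b ∗ f h.
Proof. by rewrite conv_mulC conv_cst_mulr commB. Qed.

Lemma conv_cstM b c : conv_cst (b ∗ c) = conv_cst b ⋆ conv_cst c.
Proof. by apply: convP => h; rewrite conv_cst_mulr /= amulZl. Qed.

Lemma conv_mulr1 f : f ⋆ conv_one = f.
Proof. by rewrite conv_mulC conv_mul1. Qed.

Fact conv_mul_bilinear : is_bilinear conv_mul.
Proof. by split=> ?; [exact: conv_mul_lin_l|exact: conv_mul_lin_r]. Qed.

Definition conv_algebra : algebra (conv H B) :=
  Algebra conv_mul_bilinear conv_mulA conv_mul1 conv_mulr1.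

End Convolution.

Arguments conv_mul {k H B cH aB} f g.
Arguments conv_cst {k H B cH} b.
Arguments conv_one {k H B cH aB}.
Notation "f ⋆ g" := (conv_mul f g) (at level 40, left associativity) : ring_scope.

HB.instance Definition _ (k : fieldType) (H B : lmodType k) (cH : coalgebra H)
    (aB : algebra B) :=
  bilinear_isBilinear.Build k (conv H B) (conv H B) (conv H B) *:%R *:%R
    (@conv_mul k H B cH aB) (conv_mul_bilinear cH aB).

Section ConvMaps.
Variables (k : fieldType) (H B C : lmodType k) (cH : coalgebra H).

Fact conv_cst_is_linear : linear (@conv_cst k H B cH).
Proof.
by move=> a b c; apply: convP => h; rewrite /= scalerDr !scalerA [a * _]mulrC.
Qed.
HB.instance Definition _ :=
  GRing.isLinear.Build k B (conv H B) *:%R _ conv_cst_is_linear.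

Fact conv_map_linear (i : {linear B -> C}) (f : conv H B) : linear (fun h => i (f h)).
Proof. lin. Qed.
Definition conv_map i f := Conv (conv_map_linear i f).
Fact conv_map_is_linear i : linear (conv_map i).
Proof. by move=> a f g; apply: convP => h; rewrite /= linearP. Qed.
HB.instance Definition _ i :=
  GRing.isLinear.Build k (conv H B) (conv H C) *:%R _ (conv_map_is_linear i).

Lemma conv_map_cst (i : {linear B -> C}) b : conv_map i (conv_cst b) = conv_cst (i b).
Proof. by apply: convP => h; rewrite /= linearZ. Qed.

Definition amul_morphism (aB : algebra B) (aC : algebra C) (i : B -> C) :=
  forall b c, i (b ∗ c) = i b ∗ i c.

Lemma conv_mapM (aB : algebra B) (aC : algebra C) (i : {linear B -> C}) f g :
  amul_morphism aB aC i ->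
  conv_map i (f ⋆ g) = conv_map i f ⋆ conv_map i g.
Proof.
by move=> iM; apply: convP => h; rewrite /= linear_tsum; apply: eq_tsum.
Qed.

End ConvMaps.

(** * Weak bialgebras *)

Lemma linZ (k : fieldType) (U V : lmodType k) (f : U -> V) c u :
  linear f -> f (c *: u) = c *: f u.
Proof. by move=> lf; have := scalable_linear lf c u. Qed.

Lemma counit_tsum (k : fieldType) (U V X : lmodType k) (cX : coalgebra X)
    (t : U ⨂ V) (F : U -> V -> X) :
  counit (tsum t F) = \Sw_(u, v <- t) counit (F u v).
Proof. exact: linear_sum. Qed.

Lemma counitZ (k : fieldType) (X : lmodType k) (cX : coalgebra X) c (x : X) :
  counit (c *: x) = c * counit x.
Proof. exact: linearZ. Qed.

Section WeakBialgebra.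
Variables (k : fieldType) (V : lmodType k) (bV : weak_bialgebra V).
Implicit Types (W : lmodType k) (a x y : V).

Lemma comul_mulF W (F : V -> V -> W) x y : is_bilinear F ->
  tsum (comul (x ∗ y)) F
  = \Sw_(x1, x2 <- comul x) \Sw_(y1, y2 <- comul y) F (x1 ∗ y1) (x2 ∗ y2).
Proof.
move=> bF; rewrite comul_mul tsum_tsum //; apply: eq_tsum => *.
by rewrite tsum_tsum //; apply: eq_tsum => *; rewrite tsum_tens.
Qed.

Lemma comul_one_lF W (F : V -> V -> V -> W) : is_trilinear F ->
  \Sw_(a1, a2 <- comul \1_V) \Sw_(b1, b2 <- comul \1_V) F b1 (a1 ∗ b2) a2
  = \Sw_(a', a3 <- comul \1_V) \Sw_(a1, a2 <- comul a') F a1 a2 a3.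
Proof.
by move=> tF; ev3_of F (@comul_one_l _ _ bV); rewrite amul1l amul1r.
Qed.

Lemma comul_one_rF W (F : V -> V -> V -> W) : is_trilinear F ->
  \Sw_(a1, a2 <- comul \1_V) \Sw_(b1, b2 <- comul \1_V) F a1 (a2 ∗ b1) b2
  = \Sw_(a', a3 <- comul \1_V) \Sw_(a1, a2 <- comul a') F a1 a2 a3.
Proof.
by move=> tF; ev3_of F (@comul_one_r _ _ bV); rewrite amul1l amul1r.
Qed.

Lemma eps_s_linear : linear (eps_s : V -> V).
Proof. by rewrite /eps_s; lin. Qed.
Lemma eps_t_linear : linear (eps_t : V -> V).
Proof. by rewrite /eps_t; lin. Qed.
HB.instance Definition _ := GRing.isLinear.Build k V V *:%R eps_s eps_s_linear.
HB.instance Definition _ := GRing.isLinear.Build k V V *:%R eps_t eps_t_linear.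

(** Weak multiplicativity of ε with 1 as the middle factor: ε does not distinguish a factor from its
    ε_s. *)
Lemma counit_eps_s a x : counit (eps_s a ∗ x) = counit (a ∗ x).
Proof.
rewrite amul_tsuml counit_tsum -{2}[a]amul1r counit_mul21.
by apply: eq_tsum => *; rewrite amulZl counitZ.
Qed.

Section Commutative.
Hypothesis commV : forall x y : V, x ∗ y = y ∗ x.

Lemma counit_eps_t a x : counit (eps_t a ∗ x) = counit (a ∗ x).
Proof.
rewrite amul_tsuml counit_tsum -{2}[a]amul1r counit_mul12.
by apply: eq_tsum => *; rewrite amulZl counitZ [_ ∗ a]commV.
Qed.

Lemma comul_eps_s W (F : V -> V -> W) a : is_bilinear F ->
  tsum (comul (eps_s a)) F = \Sw_(i1, i2 <- comul \1_V) F i1 (eps_s a ∗ i2).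
Proof.
move=> bF; have [F1 F2] := bF.
rewrite {1}/eps_s linear_tsum tsum_tsum //.
transitivity (\Sw_(i', i3 <- comul \1_V) \Sw_(i1, i2 <- comul i')
    (counit (a ∗ i3) *: F i1 i2)).
  by apply: eq_tsum => *; rewrite linearZ /= (linZ _ _ (tsum_linear bF)) scale_tsumr.
rewrite -comul_one_rF; last lin.
apply: eq_tsum => i1 i2; rewrite commV amul_tsumr (lin_tsum _ _ (F2 _)).
by apply: eq_tsum => *; rewrite amulZr (linZ _ _ (F2 _)).
Qed.

Lemma comul_eps_t W (F : V -> V -> W) a : is_bilinear F ->
  tsum (comul (eps_t a)) F = \Sw_(i1, i2 <- comul \1_V) F (eps_t a ∗ i1) i2.
Proof.
move=> bF; have [F1 F2] := bF.
rewrite {1}/eps_t linear_tsum tsum_tsum //.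
transitivity (\Sw_(i1, i' <- comul \1_V) \Sw_(i2, i3 <- comul i')
    (counit (i1 ∗ a) *: F i2 i3)).
  by apply: eq_tsum => *; rewrite linearZ /= (linZ _ _ (tsum_linear bF)) scale_tsumr.
have tF : is_trilinear (fun i1 i2 i3 => counit (i1 ∗ a) *: F i2 i3).
  by lin.
rewrite -(coassocF _ _ tF) -(comul_one_lF tF).
apply: eq_tsum => i1 i2; rewrite commV amul_tsumr (lin_tsum _ _ (F1 _)).
by apply: eq_tsum => *; rewrite amulZr (linZ _ _ (F1 _)).
Qed.

Lemma comul_eps_s_mul W (F : V -> V -> W) a x : is_bilinear F ->
  tsum (comul (eps_s a ∗ x)) F
  = \Sw_(x1, x2 <- comul x) F x1 (eps_s a ∗ x2).
Proof.
move=> bF; have [F1 F2] := bF.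
have bF' : is_bilinear (fun x1 x2 => F x1 (eps_s a ∗ x2)).
  by lin.
have bG : is_bilinear (fun u v => \Sw_(x1, x2 <- comul x) F (u ∗ x1) (v ∗ x2)).
  by lin.
rewrite comul_mulF // comul_eps_s // -[in RHS](amul1l x) comul_mulF //.
by apply: eq_tsum => *; apply: eq_tsum => *; rewrite amulA.
Qed.

Lemma comul_eps_t_mul W (F : V -> V -> W) a x : is_bilinear F ->
  tsum (comul (eps_t a ∗ x)) F
  = \Sw_(x1, x2 <- comul x) F (eps_t a ∗ x1) x2.
Proof.
move=> bF; have [F1 F2] := bF.
have bF' : is_bilinear (fun x1 x2 => F (eps_t a ∗ x1) x2).
  by lin.
have bG : is_bilinear (fun u v => \Sw_(x1, x2 <- comul x) F (u ∗ x1) (v ∗ x2)).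
  by lin.
rewrite comul_mulF // comul_eps_t // -[in RHS](amul1l x) comul_mulF //.
by apply: eq_tsum => *; apply: eq_tsum => *; rewrite amulA.
Qed.

(** Apply id ⊗ ε to Δ(ε_s(a) x) = x_1 ⊗ ε_s(a) x_2, where ε does not distinguish ε_s(a) from a. This
    and its ε_t form evaluate a counit taken on one leg only. *)
Lemma eps_s_mulE a x : \Sw_(x1, x2 <- comul x) (counit (a ∗ x2) *: x1) = eps_s a ∗ x.
Proof.
rewrite -[RHS]counitr comul_eps_s_mul; last lin.
by apply: eq_tsum => *; rewrite counit_eps_s.
Qed.

Lemma eps_t_mulE a x : \Sw_(x1, x2 <- comul x) (counit (a ∗ x1) *: x2) = eps_t a ∗ x.
Proof.
rewrite -[RHS]counitl comul_eps_t_mul; last lin.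
by apply: eq_tsum => *; rewrite counit_eps_t.
Qed.

(** In Δ(ε_s(x)) = 1_1 ⊗ ε_s(x) 1_2 the factor ε_s(x) is moved to the front by commutativity, where
    ε lets x replace it. *)
Lemma eps_sM a x : eps_s (a ∗ x) = eps_s a ∗ eps_s x.
Proof.
rewrite -[RHS]eps_s_mulE comul_eps_s; last lin.
by apply: eq_tsum => i1 i2;
  rewrite [in RHS]amulA [in RHS](commV a) -[in RHS]amulA counit_eps_s amulA (commV x).
Qed.

Lemma eps_tM a x : eps_t (a ∗ x) = eps_t a ∗ eps_t x.
Proof.
rewrite -[RHS]eps_t_mulE comul_eps_t; last lin.
by apply: eq_tsum => i1 i2;
  rewrite [in RHS]amulA [in RHS](commV a) -[in RHS]amulA counit_eps_t [in
    RHS]amulA (commV x) (commV i1).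
Qed.

(** Apply ε ⊗ id to Δ(1) Δ(x) = Δ(x). *)
Lemma eps_t_comul x : \Sw_(x1, x2 <- comul x) (eps_t x1 ∗ x2) = x.
Proof.
rewrite -{2}[x]amul1l -[in RHS](@counitl _ _ _ (_ ∗ x)) comul_mulF; last lin.
rewrite exchange_tsum; apply: eq_tsum => x1 x2; rewrite amul_tsuml.
by apply: eq_tsum => *; rewrite amulZl.
Qed.

End Commutative.
End WeakBialgebra.

(* The type of an equation has to be normalized for ring to recognize it. *)
Ltac ring_in T := lazymatch goal with
  |- @eq _ ?x ?y => change (@eq T x y); ring end.

Section CocommutativeUnit.
Variables (k : fieldType) (H : lmodType k) (bH : weak_bialgebra H).
Hypothesis cocomm : forall h : H, comul h = \Sw_(h1, h2 <- comul h) (h2 ⊗ h1).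
Variables (W : lmodType k) (F : H -> H -> H -> W).
Hypothesis tF : is_trilinear F.

Let S3 (G : H -> H -> H -> W) :=
  \Sw_(i1, i' <- comul \1_H) \Sw_(i2, i3 <- comul i') G i1 i2 i3.

Let swap12 : S3 F = S3 (fun x y z => F y x z).
Proof. exact: cocommAF. Qed.

Let swap23 (G : H -> H -> H -> W) : is_trilinear G -> S3 G
  = S3 (fun x y z => G x z y).
Proof. by move=> tG; apply: eq_tsum => u v; apply: cocommF; last lin. Qed.

(** The unit axiom puts the product of two copies of Δ(1) in the middle leg. For cocommutative H,
    Δ²(1) is symmetric, so the product may sit in an outer leg, although H is not assumed
    commutative. *)
Lemma comul_one_mul12 :
  \Sw_(i1, i2 <- comul \1_H) \Sw_(j1, j2 <- comul \1_H) F (i1 ∗ j1) i2 j2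
  = \Sw_(i1, i' <- comul \1_H) \Sw_(i2, i3 <- comul i') F i1 i2 i3.
Proof.
rewrite -/(S3 F) swap12 -[RHS]coassocF; last lin.
rewrite -comul_one_rF; last lin.
rewrite (cocommF cocomm); last lin.
by apply: eq_tsum => *; apply: eq_tsum.
Qed.

Lemma comul_one_mul22 :
  \Sw_(i1, i2 <- comul \1_H) \Sw_(j1, j2 <- comul \1_H) F i1 j1 (i2 ∗ j2)
  = \Sw_(i1, i' <- comul \1_H) \Sw_(i2, i3 <- comul i') F i1 i2 i3.
Proof.
rewrite -/(S3 F) swap23 // -[RHS]coassocF; last lin.
rewrite -comul_one_rF; last lin.
by apply: eq_tsum => i1 i2; rewrite (cocommF cocomm) //; lin.
Qed.

End CocommutativeUnit.

(** * Compatible weak matched pairs *)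

Section MatchedPair.
Variables (k : fieldType) (H A : lmodType k).
Variables (bH : weak_bialgebra H) (bA : weak_bialgebra A).
Variables (act : {bilinear H -> A -> A}) (rho : {linear H -> H ⨂ A}).
Hypothesis cHA : compatible_weak_matched_pair bH bA act rho.
Local Notation "h ⋅ x" := (act h x).
Implicit Types (W : lmodType k) (h g : H) (x y a b : A).

Let wmp := abelian_wmp cHA.
Let ma := wmp_module wmp.
Let cc := wmp_comodule wmp.

Lemma cocommH h : comul h = \Sw_(h1, h2 <- comul h) (h2 ⊗ h1).
Proof. exact: abelian_cocomm cHA h. Qed.
Lemma commA x y : x ∗ y = y ∗ x.
Proof. exact: abelian_comm cHA x y. Qed.

Lemma coact_comulF W (F : H -> H -> A -> W) h : is_trilinear F ->
  \Sw_(u, a <- rho h) \Sw_(u1, u2 <- comul u) F u1 u2 a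
  = \Sw_(h1, h2 <- comul h) \Sw_(u1, a1 <- rho h1) \Sw_(u2, a2 <- rho h2)
      F u1 u2 (a1 ∗ a2).
Proof. by move=> tF; ev3_of F (coact_comul cc h). Qed.

Lemma coact_coactF W (F : H -> A -> A -> W) h : is_trilinear F ->
  \Sw_(u, a <- rho h) \Sw_(v, b <- rho u) F v b a
  = \Sw_(u, a <- rho h) \Sw_(a1, a2 <- comul a) F u a1 a2.
Proof. by move=> tF; ev3_of F (coact_coact cc h). Qed.

Lemma wmp_compatF W (F : H -> A -> A -> W) h g x : is_trilinear F ->
    \Sw_(h1, h2 <- comul h) \Sw_(u, a <- rho (h2 ∗ g))
      \Sw_(y1, y2 <- comul (h1 ⋅ x)) F u y1 (y2 ∗ a)
    = \Sw_(h1, h' <- comul h) \Sw_(h2, h'' <- comul h')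
      \Sw_(h3, h4 <- comul h'')
      \Sw_(u1, a1 <- rho h1) \Sw_(u3, a3 <- rho h3) \Sw_(v, b <- rho g)
      \Sw_(x1, x2 <- comul x)
        F (u3 ∗ v) (u1 ⋅ x1) (a1 ∗ (h2 ⋅ x2) ∗ a3 ∗ (h4 ⋅ b)).
Proof. by move=> tF; ev3_of F (wmp_compat wmp h g x). Qed.

Lemma compatible_comulF W (F : A -> A -> W) h g : is_bilinear F ->
  \Sw_(i1, i2 <- comul \1_A) F (h ⋅ i1) (g ⋅ i2)
  = \Sw_(i1, i2 <- comul \1_A) F ((h ⋅ \1_A) ∗ i1) ((g ⋅ \1_A) ∗ i2).
Proof.
move=> bF; have := congr1 (fun t => tsum t F) (compatible_comul cHA h g).
rewrite !tsum_tsum // => e; apply: etrans (etrans e _).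
  by apply: eq_tsum => *; rewrite tsum_tens.
by apply: eq_tsum => *; rewrite tsum_tens.
Qed.

(** * The convolution elements α, γ and π *)

Fact acts_linear x : linear (fun h => h ⋅ x).
Proof. lin. Qed.
Definition acts x : conv H A := Conv (acts_linear x).
Fact acts_is_linear : linear acts.
Proof. by move=> a x y; apply: convP => h; rewrite /= linearPr. Qed.
HB.instance Definition _ :=
  GRing.isLinear.Build k A (conv H A) *:%R acts acts_is_linear.

Definition alpha : conv H A := acts \1_A.

Fact gamma_linear : linear (fun h => \Sw_(u, a <- rho h) (counit u *: a)).
Proof. lin. Qed.
Definition gamma : conv H A := Conv gamma_linear.

Definition ppi : conv H A := alpha ⋆ gamma.

Lemma actsM x y : acts (x ∗ y) = acts x ⋆ acts y.
Proof. by apply: convP => h /=; rewrite (act_mul ma). Qed.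

Lemma alpha_acts x : alpha ⋆ acts x = acts x.
Proof. by rewrite -actsM amul1l. Qed.

Lemma alpha_idem : alpha ⋆ alpha = alpha.
Proof. exact: alpha_acts. Qed.

Lemma eps_s_act h x : eps_s (h ⋅ x) = eps_s (alpha h) ∗ eps_s x.
Proof. exact: wmp_eps_s wmp h x. Qed.

Lemma counit_act h x b : counit ((h ⋅ x) ∗ b) = counit (alpha h ∗ x ∗ b).
Proof.
rewrite -counit_eps_s // eps_s_act -eps_sM ?counit_eps_s //; exact: commA.
Qed.

Lemma act_eps_s h b : h ⋅ eps_s b = alpha h ∗ eps_s b.
Proof.
rewrite /eps_s linear_tsum amul_tsumr.
(* Writing i2 as 1_H ⋅ i2 makes the compatibility condition applicable, with g = 1_H. *)
transitivity (\Sw_(i1, i2 <- comul \1_A) (counit (b ∗ (\1_H ⋅ i2)) *: (h ⋅ i1))).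
  by apply: eq_tsum => *; rewrite linearZ /= (act_one ma).
rewrite (@compatible_comulF _ (fun y z => counit (b ∗ z) *: y)); last lin.
by apply: eq_tsum => *; rewrite (act_one ma) amul1l amulZr.
Qed.

Lemma act_eps_t h b : h ⋅ eps_t b = alpha h ∗ eps_t b.
Proof.
rewrite /eps_t linear_tsum amul_tsumr.
transitivity (\Sw_(i1, i2 <- comul \1_A) (counit ((\1_H ⋅ i1) ∗ b) *: (h ⋅ i2))).
  by apply: eq_tsum => *; rewrite linearZ /= (act_one ma).
rewrite (@compatible_comulF _ (fun y z => counit (y ∗ b) *: z)); last lin.
by apply: eq_tsum => *; rewrite (act_one ma) amul1l amulZr.
Qed.

Lemma acts_eps_s b : acts (eps_s b) = alpha ⋆ conv_cst (eps_s b).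
Proof. by apply: convP => h; rewrite conv_cst_mulr; apply: act_eps_s. Qed.

(** The counit axiom of the comodule coalgebra: γ takes values in the image of ε_s, where Δ and the
    action of H are explicit. *)
Lemma eps_s_gamma h : eps_s (gamma h) = gamma h.
Proof.
rewrite /= linear_tsum; apply: etrans (esym (coact_unit cc h)).
by apply: eq_tsum => *; rewrite linearZ.
Qed.

(** Apply ε to the second leg of h^0 in the compatibility of ρ with Δ. In this sense ρ absorbs γ. *)
Lemma gamma_coact W (G : H -> A -> W) h : is_bilinear G ->
  \Sw_(h1, h2 <- comul h) \Sw_(u, a <- rho h1) G u (a ∗ gamma h2)
  = tsum (rho h) G.
Proof.
move=> bG; transitivity
  (\Sw_(u, a <- rho h) \Sw_(u1, u2 <- comul u) (counit u2 *: G u1 a)).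
  rewrite coact_comulF; last lin.
  apply: eq_tsum => h1 h2; apply: eq_tsum => u a.
  rewrite /= amul_tsumr (lin_tsum _ _ (bG.2 _)).
  by apply: eq_tsum => *; rewrite amulZr (linZ _ _ (bG.2 _)).
apply: eq_tsum => u a; rewrite -{2}[u]counitr (lin_tsum _ _ (bG.1 _)).
by apply: eq_tsum => *; rewrite (linZ _ _ (bG.1 _)).
Qed.

(* γ(h^0) ⊗ h^1 = 1_1 ⊗ 1_2 γ(h) *)
Lemma coact_gamma W (F : A -> A -> W) h : is_bilinear F ->
  \Sw_(u, a <- rho h) F (gamma u) a = \Sw_(i1, i2 <- comul \1_A) F i1 (gamma h ∗ i2).
Proof.
move=> bF.
transitivity (\Sw_(u, a <- rho h) \Sw_(v, b <- rho u) (counit v *: F b a)).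
  apply: eq_tsum => u a; rewrite /= (lin_tsum _ _ (bF.1 _)).
  by apply: eq_tsum => *; rewrite (linZ _ _ (bF.1 _)).
rewrite coact_coactF; last lin.
rewrite -eps_s_gamma -comul_eps_s //; last exact: commA.
rewrite eps_s_gamma /= linear_tsum tsum_tsum //; apply: eq_tsum => u a.
by rewrite linearZ /= (linZ _ _ (tsum_linear bF)) scale_tsumr.
Qed.

(* h^0 ⊗ ε_s(h^1) = h_1 ⊗ γ(h_2) *)
Lemma coact_eps_s W (F : H -> A -> W) h : is_bilinear F ->
  \Sw_(u, a <- rho h) F u (eps_s a) = \Sw_(h1, h2 <- comul h) F h1 (gamma h2).
Proof.
move=> bF; apply: esym.
(* Start from h = ε(h^1) h^0 and split h^0. The leg γ(h_2^0) ⊗ h_2^1 becomes 1_1 ⊗ 1_2 γ(h_2), and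
   ε(h_1^1 γ(h_2) 1_2) 1_1 is an ε_s whose γ is absorbed by ρ(h_1). *)
transitivity (\Sw_(u, a <- rho h) \Sw_(u1, u2 <- comul u) (counit a *:
  F u1 (gamma u2))).
  have bF' : is_bilinear (fun h1 h2 => F h1 (gamma h2)) by lin.
  rewrite -{1}[h](coact_counit cc) linear_tsum tsum_tsum //.
  apply: eq_tsum => u a.
  by rewrite linearZ /= (linZ _ _ (tsum_linear bF')) scale_tsumr.
rewrite coact_comulF; last lin.
rewrite -(@gamma_coact _ (fun u a => F u (eps_s a))); last lin.
apply: eq_tsum => h1 h2; apply: eq_tsum => u a.
rewrite (@coact_gamma _ (fun b c => counit (a ∗ c) *: F u b)); last lin.
rewrite /eps_s (lin_tsum _ _ (bF.2 _)); apply: eq_tsum => i1 i2.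
by rewrite (linZ _ _ (bF.2 _)) amulA.
Qed.

(** Axiom (v), once cocommutativity has replaced 1_1 ⊗ 1'_1 ⊗ 1_2 1'_2 by Δ²(1). *)
Lemma coact_one_leg W (F : H -> A -> H -> W) : is_trilinear F ->
  \Sw_(i1, i2 <- comul \1_H) \Sw_(u, a <- rho i1) F u a i2
  = \Sw_(i1, i' <- comul \1_H) \Sw_(i2, i3 <- comul i') F i1 (gamma i2) i3.
Proof.
move=> tF; have [F1 F2 F3] := tF.
rewrite -(comul_one_mul22 cocommH); last lin.
transitivity (\Sw_(i1, i2 <- comul \1_H) \Sw_(j1, j2 <- comul \1_H)
    \Sw_(u, a <- rho j1) F i1 (counit u *: a) (i2 ∗ j2)).
  by ev3_of F (wmp_coact_one wmp).
apply: eq_tsum => i1 i2; apply: eq_tsum => j1 j2.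
by rewrite /= (lin_tsum _ _ (F2 _ _)).
Qed.

Lemma coact_one W (F : H -> A -> W) : is_bilinear F ->
  tsum (rho \1_H) F = \Sw_(i1, i2 <- comul \1_H) F i1 (gamma i2).
Proof.
move=> bF.
have tF : is_trilinear (fun u a (i : H) => counit i *: F u a) by lin.
apply: etrans (etrans (coact_one_leg tF) _).
  rewrite -{1}[\1_H](@counitr _ _ _) linear_tsum tsum_tsum //; apply: eq_tsum => *.
  by rewrite linearZ /= (linZ _ _ (tsum_linear bF)) scale_tsumr.
apply: eq_tsum => i1 i'; rewrite -{2}[i'](@counitr _ _ _) linear_tsum.
rewrite (lin_tsum _ _ (bF.2 _)); apply: eq_tsum => *.
by rewrite linearZ /= (linZ _ _ (bF.2 _)).
Qed.

Fact rtr_linear B (f : conv H B) g : linear (fun h => f (h ∗ g)).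
Proof. lin. Qed.
Definition rtr B (f : conv H B) g : conv H B := Conv (rtr_linear f g).
Fact rtr_is_linear B (f : conv H B) : linear (rtr f).
Proof.
move=> a g g'; apply: convP => h /=.
by rewrite ((@amul_bilinear _ _ (@wb_algebra _ _ bH)).2 h) linearP.
Qed.

HB.instance Definition _ B (f : conv H B) :=
  GRing.isLinear.Build k H (conv H B) *:%R (rtr f) (rtr_is_linear f).

Lemma rtr_one B (f : conv H B) : rtr f \1_H = f.
Proof. by apply: convP => h; rewrite /= amul1r. Qed.

Lemma rtr_rtr B (f : conv H B) g g' : rtr (rtr f g) g' = rtr f (g' ∗ g).
Proof. by apply: convP => h; rewrite /= amulA. Qed.

Fact coact_linear B (aB : algebra B) (j : {linear A -> B}) (f : conv H B) :
  linear (fun h => \Sw_(u, a <- rho h) (f u ∗ j a)).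
Proof. lin. Qed.
(** The coaction as an operator on Hom(H, B), its A-leg pushed to B along [j]. It is multiplicative
    by [coactM] but not unital: the unit goes to γ. *)
Definition coact B (aB : algebra B) (j : {linear A -> B}) f :=
  Conv (coact_linear aB j f).
Fact coact_is_linear B (aB : algebra B) (j : {linear A -> B}) :
  linear (coact aB j).
Proof.
move=> a f f'; apply: convP => h; rewrite /= scale_tsumr -big_split.
by apply: eq_bigr => p _; rewrite /= amulDl amulZl.
Qed.
HB.instance Definition _ B (aB : algebra B) (j : {linear A -> B}) :=
  GRing.isLinear.Build k (conv H B) (conv H B) *:%R (coact aB j)
    (coact_is_linear aB j).

Definition lid : {linear A -> A} := idfun.

(** The factor that axiom (iii) at x = 1 leaves behind once ε is applied to its first A-leg. *)
Definition kappa : conv H A := coact _ lid (conv_map eps_t alpha).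

Add Ring A_ring : (commutative_srt commA).
Add Ring conv_A_ring : (conv_srt cocommH commA).

Lemma gamma_idem : gamma ⋆ gamma = gamma.
Proof.
apply: convP => h; rewrite [RHS]/= -(@gamma_coact _ (fun u a => counit u *: a));
  last lin.
by apply: eq_tsum => *; rewrite /= amul_tsuml; apply: eq_tsum => *; rewrite amulZl.
Qed.

Lemma alpha_ppi : alpha ⋆ ppi = ppi.
Proof. by rewrite /ppi -{3}alpha_idem; ring_in (conv H A). Qed.

(** * Axiom (iii) with values in a commutative algebra B *)

Section Target.
Variables (B : lmodType k) (aB : algebra B).
Hypothesis commB : forall x y : B, x ∗ y = y ∗ x.
Variables (j : {linear A -> B}).
Hypothesis jM : amul_morphism wb_algebra aB j.
Implicit Types f chi : conv H B.

Add Ring B_ring : (commutative_srt commB).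
Add Ring conv_B_ring : (conv_srt cocommH commB).

Local Notation "f ^ρ" := (coact aB j f) (at level 2, format "f ^ρ").
Local Notation J := (conv_map j).

Let JM (f f' : conv H A) : J (f ⋆ f') = J f ⋆ J f'.
Proof. exact: conv_mapM. Qed.

Lemma coactM f f' : (f ⋆ f')^ρ = f^ρ ⋆ f'^ρ.
Proof.
apply: convP => h /=.
transitivity (\Sw_(u, a <- rho h) \Sw_(u1, u2 <- comul u) (f u1 ∗ f' u2 ∗ j a)).
  by apply: eq_tsum => *; rewrite amul_tsuml.
rewrite coact_comulF; last lin.
apply: eq_tsum => h1 h2; rewrite amul_tsuml; apply: eq_tsum => u1 a1.
rewrite amul_tsumr; apply: eq_tsum => u2 a2; rewrite jM; ring_in B.
Qed.

Lemma coact_conv_one : conv_one^ρ = J gamma.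
Proof.
apply: convP => h /=; rewrite linear_tsum; apply: eq_tsum => u a.
by rewrite amulZl amul1l linearZ.
Qed.

Lemma coact_gamma_mul f : f^ρ ⋆ J gamma = f^ρ.
Proof. by rewrite -coact_conv_one -coactM; congr coact; ring_in (conv H B). Qed.

Fact comul_act_linear (i : {linear A -> B}) x :
  linear (fun h => \Sw_(y1, y2 <- comul (h ⋅ x)) (i y1 ∗ j y2)).
Proof. lin. Qed.
Definition comul_act i x := Conv (comul_act_linear i x).

(** Axiom (iii) mapped to B by [chi], [i] and [j]: all legs of h land in B, so both sides are
    convolution products. Any linear [i] is allowed, in particular ε. *)
Lemma comul_act_compat (i : {linear A -> B}) x chi g :
  comul_act i x ⋆ rtr chi^ρ g
  = \Sw_(v, b <- rho g) \Sw_(x1, x2 <- comul x)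
      ((conv_map i (acts x1))^ρ ⋆ J (acts x2) ⋆ (rtr chi v)^ρ ⋆ J (acts b)).
Proof.
apply: convP => h; rewrite conv_tsumE.
transitivity (\Sw_(h1, h2 <- comul h) \Sw_(u, a <- rho (h2 ∗ g))
      \Sw_(y1, y2 <- comul (h1 ⋅ x)) (chi u ∗ (i y1 ∗ j (y2 ∗ a)))).
  apply: eq_tsum => h1 h2; rewrite /= amul_tsumr; apply: eq_tsum => u a.
  rewrite amul_tsuml; apply: eq_tsum => y1 y2; rewrite jM; ring_in B.
rewrite (@wmp_compatF _ (fun u y z => chi u ∗ (i y ∗ j z))); last lin.
transitivity (\Sw_(v, b <- rho g) \Sw_(x1, x2 <- comul x)
  \Sw_(h1, h' <- comul h) \Sw_(h2, h'' <- comul h') \Sw_(h3, h4 <- comul h'')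
  \Sw_(u1, a1 <- rho h1) \Sw_(u3, a3 <- rho h3)
     (chi (u3 ∗ v) ∗ (i (u1 ⋅ x1) ∗ j (a1 ∗ (h2 ⋅ x2) ∗ a3 ∗ (h4 ⋅ b))))).
  do 5 (rewrite exchange_tsum2; apply: eq_tsum => ? ?).
  by [].
apply: eq_tsum => v b; rewrite conv_tsumE; apply: eq_tsum => x1 x2.
rewrite -!conv_mulA; apply: eq_tsum => h1 h'.
rewrite /= amul_tsumr; apply: eq_tsum => h2 h''.
rewrite amul_tsumr amul_tsumr; apply: eq_tsum => h3 h4.
rewrite amul_tsuml; apply: eq_tsum => u1 a1.
rewrite amul_tsuml !amul_tsumr; apply: eq_tsum => u3 a3.
rewrite !jM; ring_in B.
Qed.

Lemma alpha_coact chi g :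
  J alpha ⋆ rtr chi^ρ g
  = \Sw_(v, b <- rho g) (J kappa ⋆ J alpha ⋆ (rtr chi v)^ρ ⋆ J (acts b)).
Proof.
(* This [i] is a |-> ε(a) 1, for which [comul_act i \1_A] is α followed by [j]. *)
pose i : conv A B := @conv_cst k A B (@wb_coalgebra _ _ bA) (@aone _ _ aB).
transitivity (comul_act i \1_A ⋆ rtr chi^ρ g).
  congr (_ ⋆ _); apply: convP => h /=; rewrite -{1}[h ⋅ _]counitl linear_tsum.
  by apply: eq_tsum => *; rewrite linearZ /= amulZl amul1l.
rewrite comul_act_compat; apply: eq_tsum => v b.
transitivity ((\Sw_(x1, x2 <- comul \1_A) ((conv_map i (acts x1))^ρ ⋆ J (acts x2)))
              ⋆ ((rtr chi v)^ρ ⋆ J (acts b))).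
  by rewrite conv_mul_tsuml; apply: eq_tsum => *; rewrite !conv_mulA.
rewrite -conv_mulA; congr (_ ⋆ _); apply: convP => h; rewrite conv_tsumE.
rewrite /= exchange_tsum; apply: eq_tsum => h1 h2.
rewrite linear_tsum amul_tsuml.
transitivity (\Sw_(x1, x2 <- comul \1_A) \Sw_(u, a <- rho h1)
    (counit (u ⋅ x1) *: (j a ∗ j (h2 ⋅ x2)))).
  apply: eq_tsum => x1 x2; rewrite amul_tsuml; apply: eq_tsum => u a.
  by rewrite !amulZl amul1l.
rewrite exchange_tsum; apply: eq_tsum => u a.
(* The sum of ε(u ⋅ 1_1) 1_2 is ε_t(u ⋅ 1), because ε(u ⋅ x) = ε(α(u) x); h_2 acts on such an
   element as multiplication by α(h_2). *)
transitivity (j a ∗ j (h2 ⋅ eps_t (alpha u))); last first.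
  by rewrite act_eps_t !jM /=; ring_in B.
rewrite /eps_t !linear_tsum amul_tsumr; apply: eq_tsum => x1 x2.
rewrite !linearZ /= amulZr -[u ⋅ x1]amul1r counit_act.
by rewrite amul1r commA.
Qed.

(* The sum is the effect on χ^ρ of right multiplication by ρ(1) = 1_1 ⊗ γ(1_2). *)
Lemma alpha_coact_one chi :
  J alpha ⋆ chi^ρ = J kappa ⋆ (J alpha ⋆
    \Sw_(i1, i2 <- comul \1_H) ((rtr chi i1)^ρ ⋆ conv_cst (j (gamma i2)))).
Proof.
rewrite -{1}[chi^ρ]rtr_one alpha_coact coact_one; last lin.
rewrite !conv_mul_tsumr; apply: eq_tsum => i1 i2.
rewrite -eps_s_gamma acts_eps_s JM conv_map_cst eps_s_gamma.
have := congr1 J alpha_idem; rewrite JM => e.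
rewrite -{3}e; ring_in (conv H B).
Qed.

(** Substituting [alpha_coact_one] into the left side multiplies by ρ(1) twice. Since ρ(1) is
    idempotent, by the unit axiom of H and γ ⋆ γ = γ, this equals the result of multiplying once. *)
Lemma alpha_coact_rone chi :
  J alpha ⋆ (\Sw_(i1, i2 <- comul \1_H)
               ((rtr chi i1)^ρ ⋆ conv_cst (j (gamma i2))))
  = J alpha ⋆ chi^ρ.
Proof.
rewrite [RHS]alpha_coact_one !conv_mul_tsumr.
transitivity (\Sw_(i1, i2 <- comul \1_H)
   ((J alpha ⋆ (rtr chi i1)^ρ) ⋆ conv_cst (j (gamma i2)))).
  by apply: eq_tsum => i1 i2; rewrite conv_mulA.
transitivity (\Sw_(i1, i2 <- comul \1_H) \Sw_(j1, j2 <- comul \1_H)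
   (J kappa ⋆ (J alpha ⋆ ((rtr chi (j1 ∗ i1))^ρ ⋆
       conv_cst (j (gamma j2) ∗ j (gamma i2)))))).
  apply: eq_tsum => i1 i2; rewrite alpha_coact_one !conv_mul_tsumr conv_mul_tsuml.
  apply: eq_tsum => j1 j2; rewrite rtr_rtr conv_cstM; ring_in (conv H B).
rewrite exchange_tsum (@comul_one_mul12 _ _ _ cocommH _ (fun x y z : H => 
   (J kappa ⋆ (J alpha ⋆ ((rtr chi x)^ρ ⋆ conv_cst (j (gamma y) ∗ j (gamma
     z))))))); last first.
  lin.
apply: eq_tsum => i1 i'.
rewrite -[in RHS]gamma_idem /= linear_tsum linear_tsum !conv_mul_tsumr.
by apply: eq_tsum => *; rewrite jM.
Qed.

Lemma alpha_coact_kappa chi : J alpha ⋆ chi^ρ = J kappa ⋆ (J alpha ⋆ chi^ρ).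
Proof. by rewrite {1}alpha_coact_one alpha_coact_rone. Qed.

(** Axiom (iii) at x = 1 and g = 1. The compatibility condition turns the action on Δ(1) into
    multiplication by values of α, and [alpha_coact_rone] removes the multiplication by ρ(1). *)
Lemma comul_act_coact (i : {linear A -> B}) chi :
  amul_morphism wb_algebra aB i ->
  comul_act i \1_A ⋆ chi^ρ
  = (conv_map i alpha)^ρ ⋆ J alpha ⋆ chi^ρ
    ⋆ conv_cst (\Sw_(i1, i2 <- comul \1_A) (i i1 ∗ j i2)).
Proof.
move=> iM.
rewrite -{1}[chi^ρ]rtr_one comul_act_compat.
set D := conv_cst _.
have e1 : \Sw_(x1, x2 <- comul \1_A) ((conv_map i (acts x1))^ρ ⋆ J (acts x2))
    = (conv_map i alpha)^ρ ⋆ J alpha ⋆ D.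
  apply: convP => h; rewrite conv_tsumE conv_cst_mulr /= exchange_tsum amul_tsuml.
  apply: eq_tsum => h1 h2; rewrite !amul_tsuml.
  transitivity (\Sw_(x1, x2 <- comul \1_A) \Sw_(u, a <- rho h1)
      (i (u ⋅ x1) ∗ j a ∗ j (h2 ⋅ x2))).
    by apply: eq_tsum => x1 x2; rewrite amul_tsuml.
  rewrite exchange_tsum; apply: eq_tsum => u a.
  rewrite (@compatible_comulF _ (fun y z => i y ∗ j a ∗ j z)); last lin.
  by rewrite amul_tsumr; apply: eq_tsum => x1 x2; rewrite iM jM; ring_in B.
transitivity (\Sw_(v, b <- rho \1_H)
    ((conv_map i alpha)^ρ ⋆ J alpha ⋆ D ⋆ ((rtr chi v)^ρ ⋆ J (acts b)))).
  apply: eq_tsum => v b; rewrite -e1 conv_mul_tsuml.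
  by apply: eq_tsum => *; rewrite !conv_mulA.
rewrite coact_one; last lin.
have e2 := congr1 J alpha_idem; rewrite JM in e2.
transitivity ((conv_map i alpha)^ρ ⋆ D ⋆ (J alpha ⋆ (\Sw_(i1, i2 <- comul \1_H)
               ((rtr chi i1)^ρ ⋆ conv_cst (j (gamma i2)))))).
  rewrite !conv_mul_tsumr; apply: eq_tsum => i1 i2.
  rewrite -eps_s_gamma acts_eps_s JM conv_map_cst eps_s_gamma -{3}e2.
  ring_in (conv H B).
by rewrite alpha_coact_rone; ring_in (conv H B).
Qed.

(** Both α factors of [comul_act_coact] disappear into a π, one of them under the coaction, which is
    multiplicative. Next to π, the element Δ(h ⋅ 1) thus behaves like Δ(1). *)
Lemma comul_act_ppi (i : {linear A -> B}) chi :
  amul_morphism wb_algebra aB i ->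
  comul_act i \1_A ⋆ (conv_map i ppi ⋆ chi)^ρ ⋆ J ppi
  = (conv_map i ppi ⋆ chi)^ρ ⋆ J ppi
    ⋆ conv_cst (\Sw_(i1, i2 <- comul \1_A) (i i1 ∗ j i2)).
Proof.
move=> iM; rewrite comul_act_coact //; set D := conv_cst _.
transitivity ((conv_map i alpha ⋆ conv_map i ppi ⋆ chi)^ρ ⋆ (J alpha ⋆ J ppi) ⋆ D).
  by rewrite !coactM; ring_in (conv H B).
by rewrite -JM -conv_mapM // alpha_ppi.
Qed.

Lemma comul_act_mul (i : {linear A -> B}) x chi g :
  comul_act i x ⋆ rtr chi^ρ g
  = \Sw_(v, b <- rho g) \Sw_(x1, x2 <- comul x)
      ((conv_map i (acts x1) ⋆ rtr chi v)^ρ ⋆ J (acts (x2 ∗ b))).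
Proof.
rewrite comul_act_compat; apply: eq_tsum => v b; apply: eq_tsum => x1 x2.
by rewrite actsM JM coactM; ring_in (conv H B).
Qed.

End Target.

(** * Absorption rules in Hom(H, A) *)

Local Notation "f ^ρ" := (coact _ lid f) (at level 2, format "f ^ρ").

Let idM : amul_morphism wb_algebra wb_algebra lid.
Proof. by []. Qed.

Let conv_map_idfun (f : conv H A) : conv_map lid f = f.
Proof. exact: convP. Qed.

Let one_A : conv H A := conv_one.

Lemma coact_conv_one_id : one_A^ρ = gamma.
Proof. by rewrite [LHS]coact_conv_one conv_map_idfun. Qed.

(** [alpha_coact] for the unit of Hom(H, A), which the coaction sends to γ; the factor κ is then
    absorbed by [alpha_coact_kappa]. *)
Lemma alpha_rtr_gamma g :
  alpha ⋆ rtr gamma g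
  = \Sw_(v, b <- rho g) (alpha ⋆ (rtr one_A v)^ρ ⋆ acts b).
Proof.
have := @alpha_coact A _ commA lid idM one_A g.
rewrite !conv_map_idfun coact_conv_one_id => ->; apply: eq_tsum => v b.
have := @alpha_coact_kappa A _ commA lid idM (rtr one_A v).
rewrite !conv_map_idfun -/kappa => e; rewrite e.
by ring_in (conv H A).
Qed.

Lemma kappa_ppi : kappa ⋆ ppi = ppi.
Proof.
have := @alpha_coact_kappa A _ commA lid idM one_A.
by rewrite !conv_map_idfun coact_conv_one_id.
Qed.

Definition alpha_s : conv H A := conv_map eps_s alpha.
Definition ppi_s : conv H A := conv_map eps_s ppi.

Lemma ppi_sE : ppi_s = alpha_s ⋆ gamma.
Proof.
rewrite /ppi_s conv_mapM; last exact: eps_sM commA.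
by congr (_ ⋆ _); apply: convP => h; apply: eps_s_gamma.
Qed.

Lemma alpha_alpha_s : alpha ⋆ alpha_s = alpha.
Proof.
apply: convP => h; rewrite [RHS](compatible_counit cHA); apply: eq_tsum => h1 h2.
rewrite (@compatible_comulF _ (fun y z => counit z *: y)); last lin.
by rewrite amul_tsumr; apply: eq_tsum => *; rewrite amulZr.
Qed.

Lemma ppi_ppi_s : ppi ⋆ ppi_s = ppi.
Proof.
rewrite ppi_sE /ppi.
transitivity (alpha ⋆ alpha_s ⋆ (gamma ⋆ gamma)); first ring_in (conv H A).
by rewrite alpha_alpha_s gamma_idem.
Qed.

(** Needed for the left counit axiom. Since ε_t is multiplicative, the coaction gives κ times the
    image of ε_t γ; that image is γ because ε_t(1_1) 1_2 = 1. *)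
Lemma coact_eps_t_ppi : (conv_map eps_t ppi)^ρ ⋆ ppi = ppi.
Proof.
rewrite conv_mapM; last exact: eps_tM commA.
rewrite (coactM commA idM) -/kappa.
have -> : (conv_map eps_t gamma)^ρ = gamma.
  apply: convP => h; rewrite [LHS](@coact_gamma _ (fun b c => eps_t b ∗ c)); last lin.
  rewrite -[RHS]amul1l -[in RHS](eps_t_comul bA \1_A) amul_tsuml.
  by apply: eq_tsum => *; rewrite [gamma h ∗ _]commA amulA.
transitivity (kappa ⋆ (alpha ⋆ (gamma ⋆ gamma))); first by rewrite /ppi;
  ring_in (conv H A).
by rewrite gamma_idem kappa_ppi.
Qed.

(** Under ε the factor h_1^0 ⋅ 1 may be replaced by its ε_t. Together with h_1^1 this gives κ, and κ
    ⋆ π = π. *)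
Lemma counit_ppi x h :
  \Sw_(h1, h2 <- comul h) \Sw_(u, a <- rho h1)
     counit (x ∗ (u ⋅ \1_A) ∗ a ∗ (h2 ⋅ \1_A))
  = counit (x ∗ ppi h).
Proof.
transitivity (counit (x ∗ (alpha^ρ ⋆ alpha) h)).
  rewrite /= amul_tsumr counit_tsum; apply: eq_tsum => h1 h2.
  rewrite amul_tsuml amul_tsumr counit_tsum; apply: eq_tsum => u a.
  by rewrite !amulA.
have -> : alpha^ρ ⋆ alpha = alpha^ρ ⋆ ppi.
  rewrite -{1}(coact_gamma_mul commA idM) conv_map_idfun /ppi; ring_in (conv H A).
rewrite -[in RHS]kappa_ppi /= !amul_tsumr !counit_tsum; apply: eq_tsum => h1 h2.
rewrite !amul_tsuml !amul_tsumr !counit_tsum; apply: eq_tsum => u a.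
rewrite /=; set b := tsum _ _; set c := u ⋅ _.
transitivity (counit (c ∗ (x ∗ a ∗ b))); first by congr (counit _); ring_in A.
rewrite -(counit_eps_t commA); congr (counit _); ring_in A.
Qed.

(** * Right translation of α, γ and π in Hom(H, Hom(H, A)) *)

#[local] Instance cA : algebra (conv H A) := conv_algebra cocommH commA.
Let amulE (f f' : conv H A) : f ∗ f' = f ⋆ f'.
Proof. by []. Qed.
Let conv_mulCA (f f' : conv H A) : f ∗ f' = f' ∗ f.
Proof. exact: conv_mulC cocommH commA f f'. Qed.

Let conv_conv_srt :
  semi_ring_theory (R := conv H (conv H A)) 0 conv_one +%R conv_mul eq.
Proof. exact: conv_srt cocommH conv_mulCA. Qed.
Add Ring conv_conv_ring : conv_conv_srt.
Local Notation D := (conv H (conv H A)).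

Definition rtrD (f : conv H A) : D := Conv (rtr_is_linear f).
(* Bilinear maps in (g, h), seen as elements of Hom(H, Hom(H, A)): at g and h the
   values of K f, R f, C f and T f are ε(g) f(h), f(h g), ε(h) f(g) and h ⋅ f(g). *)
Local Notation K f := (conv_cst f : D).
Local Notation R f := (rtrD f).
Local Notation C f := (conv_map conv_cst f : D).
Local Notation T f := (conv_map acts f : D).

Let KM (f f' : conv H A) : K (f ⋆ f') = K f ⋆ K f'.
Proof. exact: (conv_cstM _ cA). Qed.

Let CM (f f' : conv H A) : C (f ⋆ f') = C f ⋆ C f'.
Proof. by apply: conv_mapM => x y; apply: conv_cstM. Qed.

Let TM (f f' : conv H A) : T (f ⋆ f') = T f ⋆ T f'.
Proof. by apply: conv_mapM => x y; apply: actsM. Qed.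

Lemma rtrDM (f f' : conv H A) : R (f ⋆ f') = R f ⋆ R f'.
Proof.
apply: convP => g; apply: convP => h; rewrite conv_tsumE /=.
rewrite comul_mulF; last lin.
exact: exchange_tsum.
Qed.

Lemma rtrD_alpha : R alpha = T alpha.
Proof. by apply: convP => g; apply: convP => h; rewrite /= (act_act ma). Qed.

Let K_alpha_T f : K alpha ⋆ T f = T f.
Proof.
apply: convP => g; rewrite (conv_cst_mull cocommH conv_mulCA).
exact: alpha_acts.
Qed.

(** Each summand of [alpha_rtr_gamma] contains an image of the coaction, which absorbs γ. *)
Let K_gamma_R : K gamma ⋆ (K alpha ⋆ R gamma) = K alpha ⋆ R gamma.
Proof.
apply: convP => g; rewrite !(conv_cst_mull cocommH conv_mulCA).
rewrite [alpha ∗ _]alpha_rtr_gamma amul_tsumr; apply: eq_tsum => v b.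
have := coact_gamma_mul commA idM (rtr one_A v); rewrite conv_map_idfun.
move=> e; rewrite -{2}e ?amulE; ring_in (conv H A).
Qed.

(** Here γ is evaluated at g: the A-leg of ρ(g) absorbs it, and a value of γ leaves the action as a
    constant next to α. *)
Let R_gamma_C : K alpha ⋆ R gamma ⋆ C gamma = K alpha ⋆ R gamma.
Proof.
apply: convP => g; rewrite [in RHS](conv_cst_mull cocommH conv_mulCA).
rewrite [RHS]alpha_rtr_gamma -gamma_coact; last lin.
apply: eq_tsum => g1 g2; rewrite (conv_cst_mull cocommH conv_mulCA).
rewrite [alpha ∗ _]alpha_rtr_gamma amul_tsuml; apply: eq_tsum => v b.
rewrite -eps_s_gamma actsM acts_eps_s /= eps_s_gamma.
by rewrite -{1}alpha_idem; set c := conv_cst _; ring_in (conv H A).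
Qed.

Lemma rtrD_ppi : R ppi = T alpha ⋆ R gamma.
Proof. by rewrite rtrDM rtrD_alpha. Qed.

(** Gives P(P(z) w) = P(z w): at g and h it reads π(h_1) π(h_2 g) = π(h g). *)
Lemma cst_ppi_rtrD : K ppi ⋆ R ppi = R ppi.
Proof.
rewrite rtrD_ppi -{1}[T alpha]K_alpha_T KM.
transitivity (K alpha ⋆ T alpha ⋆ (K gamma ⋆ (K alpha ⋆ R gamma))).
  ring_in (conv H (conv H A)).
by rewrite K_gamma_R K_alpha_T -{2}[T alpha]K_alpha_T; ring_in (conv H (conv H A)).
Qed.

(** Gives P(z P(w)) = P(z w): at g and h it reads (h_1 ⋅ π(g_1)) π(h_2 g_2) = π(h g). *)
Lemma acts_ppi_rtrD : T ppi ⋆ R ppi = R ppi.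
Proof.
have e : T gamma = K alpha ⋆ C gamma.
  apply: convP => g; rewrite (conv_cst_mull cocommH conv_mulCA).
  change (acts (gamma g) = alpha ⋆ conv_cst (gamma g)).
  by rewrite -eps_s_gamma acts_eps_s.
rewrite rtrD_ppi TM e.
transitivity (T alpha ⋆ T alpha ⋆ (K alpha ⋆ R gamma ⋆ C gamma));
  first ring_in (conv H (conv H A)).
by rewrite R_gamma_C -TM alpha_idem -[in RHS]K_alpha_T; ring_in (conv H (conv H A)).
Qed.

Let epsM (f f' : conv H A) : conv_map eps_s (f ⋆ f')
  = conv_map eps_s f ⋆ conv_map eps_s f'.
Proof. by rewrite conv_mapM //; exact: eps_sM commA. Qed.

(** Apply ε_s to [alpha_rtr_gamma]. By [coact_eps_s] every coaction turns into a comultiplication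
    with γ on one leg, so h and g are separated except for a scalar ε(h g). *)
Lemma alpha_s_rtr_gamma g :
  alpha_s ⋆ rtr gamma g
  = \Sw_(g1, g2 <- comul g) (alpha_s ⋆ gamma ⋆ rtr one_A g1 ⋆ conv_cst (gamma g2)).
Proof.
transitivity (conv_map eps_s (alpha ⋆ rtr gamma g)).
  by rewrite epsM; congr (_ ⋆ _); apply: convP => h; rewrite /= -[LHS]eps_s_gamma.
rewrite alpha_rtr_gamma linear_tsum.
rewrite -(@coact_eps_s _ (fun v c => alpha_s ⋆ gamma ⋆ rtr one_A v ⋆ conv_cst
  c)); last lin.
apply: eq_tsum => v b; rewrite /= !epsM.
have -> : conv_map eps_s (acts b) = alpha_s ⋆ conv_cst (eps_s b).
  by apply: convP => h; rewrite conv_cst_mulr; apply: eps_s_act.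
have -> : conv_map eps_s (rtr one_A v)^ρ = rtr one_A v ⋆ gamma.
  apply: convP => h; rewrite /= -(@coact_eps_s _ (fun u a => counit (u ∗ v) *:
    \1_A ∗ a)); last lin.
  by rewrite linear_tsum; apply: eq_tsum => u a; rewrite !amulZl !amul1l linearZ.
have e : alpha_s ⋆ alpha_s = alpha_s by rewrite -epsM alpha_idem.
by rewrite -/alpha_s -{3}e; ring_in (conv H A).
Qed.

Lemma K_alpha_s_R : K alpha_s ⋆ R gamma = K alpha_s ⋆ K gamma ⋆ R one_A ⋆ C gamma.
Proof.
apply: convP => g; rewrite -KM -conv_mulA !(conv_cst_mull cocommH conv_mulCA).
rewrite [LHS]alpha_s_rtr_gamma amul_tsumr; apply: eq_tsum => g1 g2.
by rewrite !amulE -conv_mulA.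
Qed.

(** The α part factors by axiom (iv) at x = g ⋅ 1; the scalar ε(h_2 g_2) comes from the γ part
    alone. *)
Lemma rtrD_ppi_s : R ppi_s = K ppi_s ⋆ C ppi_s ⋆ R one_A.
Proof.
have e : R alpha_s = K alpha_s ⋆ C alpha_s.
  apply: convP => g; apply: convP => h; rewrite (conv_cst_mull cocommH conv_mulCA).
  rewrite [RHS]conv_cst_mulr /= -(act_act ma).
  exact: eps_s_act.
rewrite ppi_sE rtrDM e KM CM.
transitivity (C alpha_s ⋆ (K alpha_s ⋆ R gamma)); first ring_in (conv H (conv H A)).
by rewrite K_alpha_s_R; ring_in (conv H (conv H A)).
Qed.

End MatchedPair.

(** * A commutative algebra receiving A, A and H *)

Lemma tens_linear_ext (k : fieldType) (U V W : lmodType k) (f g : U ⨂ V -> W) t :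
  linear f -> linear g -> (forall u v, f (u ⊗ v) = g (u ⊗ v)) -> f t = g t.
Proof.
move=> lf lg e; rewrite -[t]tsum_id (lin_tsum _ _ lf) (lin_tsum _ _ lg).
exact: eq_tsum.
Qed.

(* Reduces an identity between linear functions of the tensor t to pure
   tensors. *)
Ltac on_tensors t :=
  lazymatch goal with |- ?x = ?y =>
    let x' := eval pattern t in x in
    let y' := eval pattern t in y in
    lazymatch x' with ?f _ => lazymatch y' with ?g _ =>
      apply: (@tens_linear_ext _ _ _ _ f g t); [lin | lin | cbv beta; clear t]
    end end
  end.

Section TensorAlgebra.
Variables (k : fieldType) (U V : lmodType k) (aU : algebra U) (aV : algebra V).

Definition tens_mul (s t : U ⨂ V) : U ⨂ V :=
  \Sw_(u, v <- s) \Sw_(u', v' <- t) ((u ∗ u') ⊗ (v ∗ v')).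

Fact tens_mul_bilinear : is_bilinear tens_mul.
Proof. by rewrite /tens_mul; lin. Qed.

Lemma tens_mulE u v u' v' :
  tens_mul (u ⊗ v) (u' ⊗ v') = (u ∗ u') ⊗ (v ∗ v').
Proof. by rewrite /tens_mul tsum_tens ?tsum_tens //; lin. Qed.

Let bm := tens_mul_bilinear.

Fact tens_mulA : associative tens_mul.
Proof.
move=> s t r.
on_tensors s => u v; on_tensors t => u' v'; on_tensors r => u'' v''.
by rewrite !tens_mulE !amulA.
Qed.

Fact tens_mul1 : left_id (\1_U ⊗ \1_V) tens_mul.
Proof. by move=> t; on_tensors t => u v; rewrite tens_mulE !amul1l. Qed.

Fact tens_mulr1 : right_id (\1_U ⊗ \1_V) tens_mul.
Proof. by move=> t; on_tensors t => u v; rewrite tens_mulE !amul1r. Qed.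

Definition tensor_algebra : algebra (U ⨂ V) :=
  Algebra tens_mul_bilinear tens_mulA tens_mul1 tens_mulr1.

Lemma tens_mulC : (forall x y : U, x ∗ y = y ∗ x) -> (forall x y : V, x ∗ y
  = y ∗ x) ->
  commutative tens_mul.
Proof.
move=> cU cV s t; on_tensors s => u v; on_tensors t => u' v'.
by rewrite !tens_mulE cU cV.
Qed.

End TensorAlgebra.

Section SquareZero.
Variables (k : fieldType) (V : lmodType k).
Implicit Types p q : (k^o * V)%type.

(** The trivial extension k ⊕ V, in which V is an ideal of square zero: a commutative algebra
    containing an arbitrary vector space. *)
Definition sqz_mul p q : (k^o * V)%type := (p.1 * q.1, p.1 *: q.2 + q.1 *: p.2).

Fact sqz_mulC : commutative sqz_mul.
Proof. by move=> p q; rewrite /sqz_mul mulrC addrC. Qed.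

Fact sqz_mul_bilinear : is_bilinear sqz_mul.
Proof.
have l q : linear (sqz_mul q).
  move=> a u v; congr pair; rewrite /= ?mulrDr ?mulrA.
    by rewrite [q.1 * a]mulrC -mulrA.
  rewrite !scalerDr !scalerDl !scalerA [q.1 * a]mulrC -!addrA; congr (_ + _).
  by rewrite addrCA.
by split=> q a u v; rewrite ?[sqz_mul _ q]sqz_mulC l.
Qed.

Fact sqz_mulA : associative sqz_mul.
Proof.
move=> p q r; congr pair; rewrite /= ?mulrA // !scalerDr !scalerA -addrA.
by rewrite [r.1 * p.1]mulrC [r.1 * q.1]mulrC [X in _ + X]addrC.
Qed.

Fact sqz_mul1 : left_id (1, 0) sqz_mul.
Proof. by case=> c v; rewrite /sqz_mul /= mul1r scale1r scaler0 addr0. Qed.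
Fact sqz_mulr1 : right_id (1, 0) sqz_mul.
Proof. by move=> p; rewrite sqz_mulC sqz_mul1. Qed.

Definition sqz_algebra : algebra (k^o * V)%type :=
  Algebra sqz_mul_bilinear sqz_mulA sqz_mul1 sqz_mulr1.

End SquareZero.

Section TestRing.
Variables (k : fieldType) (A H : lmodType k) (aA : algebra A).
Hypothesis commA : forall x y : A, x ∗ y = y ∗ x.

(** The product of the images of a, b and h is (a ⊗ b) ⊗ (0, h), from which any trilinear function
    of a, b, h can be read off. H enters through k ⊕ H since its own product need not commute. *)
Definition test_ring : lmodType k := (A ⨂ A) ⨂ (k^o * H)%type.

#[local] Instance test_AA : algebra (A ⨂ A) := tensor_algebra aA aA.
#[local] Instance test_sqz : algebra (k^o * H)%type := sqz_algebra H.
Definition test_algebra : algebra test_ring := tensor_algebra test_AA test_sqz.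
#[local] Existing Instance test_algebra.

Lemma test_commutative (x y : test_ring) : x ∗ y = y ∗ x.
Proof. by apply: tens_mulC => u v; [apply: tens_mulC|apply: sqz_mulC]. Qed.

Fact test_i_linear : linear (fun a : A => (a ⊗ \1_A) ⊗ (1, 0) : test_ring).
Proof. lin. Qed.
Fact test_j_linear : linear (fun a : A => (\1_A ⊗ a) ⊗ (1, 0) : test_ring).
Proof. lin. Qed.
Fact test_chi_linear : linear (fun h : H => (\1_A ⊗ \1_A) ⊗ (0, h) : test_ring).
Proof. by apply: lin_tens_r; apply: lin_pair_r. Qed.
Definition test_i : {linear A -> test_ring} := Conv test_i_linear.
Definition test_j : {linear A -> test_ring} := Conv test_j_linear.
Definition test_chi := Conv test_chi_linear.

Lemma test_iM : amul_morphism aA test_algebra test_i.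
Proof.
move=> a b; rewrite /= tens_mulE; congr (_ ⊗ _).
  by rewrite [RHS]tens_mulE amul1l.
by rewrite [RHS]sqz_mul1.
Qed.

Lemma test_jM : amul_morphism aA test_algebra test_j.
Proof.
move=> a b; rewrite /= tens_mulE; congr (_ ⊗ _).
  by rewrite [RHS]tens_mulE amul1l.
by rewrite [RHS]sqz_mul1.
Qed.

Section Evaluation.
Variables (W : lmodType k) (F : A -> A -> H -> W).
Hypothesis tF : is_trilinear F.

Fact test_eval_linear :
  linear (fun t : test_ring => \Sw_(s, p <- t) \Sw_(a, b <- s) F a b p.2).
Proof.
apply: tsum_linear; split=> [p|s]; first by lin.
apply: linear_tsum_body => a b; have [_ _ F3] := tF.
by apply: (linear_app (F3 a b)).
Qed.
Definition test_eval := Conv test_eval_linear.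

Lemma test_evalE a b h : test_eval (test_i a ∗ test_j b ∗ test_chi h) = F a b h.
Proof.
have eAA (x y x' y' : A) : (x ⊗ y) ∗ (x' ⊗ y') = (x ∗ x') ⊗ (y ∗ y').
  exact: tens_mulE.
have eT (x y : A ⨂ A) (p q : (k^o * H)%type) :
    (x ⊗ p : test_ring) ∗ (y ⊗ q : test_ring) = (x ∗ y) ⊗ (p ∗ q).
  exact: tens_mulE.
have -> : test_i a ∗ test_j b ∗ test_chi h = ((a ⊗ b) ⊗ (0, h) : test_ring).
  rewrite [test_i a ∗ _]eT eAA amul1l amul1r [LHS]eT eAA !amul1r.
  congr (_ ⊗ _); congr pair; rewrite /= ?mulr0 //.
  by rewrite scale1r scale0r addr0.
have [F1 F2 F3] := tF; rewrite /= tsum_tens; last first.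
  split=> [p|s]; first by lin.
  by apply: linear_tsum_body => x y; apply: (linear_app (F3 x y)).
by rewrite tsum_tens //; lin.
Qed.

End Evaluation.
End TestRing.

(** * The smash product *)

Section SmashProduct.
Variables (k : fieldType) (H A : lmodType k).
Variables (bH : weak_bialgebra H) (bA : weak_bialgebra A).
Variables (act : {bilinear H -> A -> A}) (rho : {linear H -> H ⨂ A}).
Hypothesis cHA : compatible_weak_matched_pair bH bA act rho.
Local Notation "h ⋅ x" := (act h x).
Implicit Types (W : lmodType k) (h g : H) (x y a b : A) (z w l : A ⨂ H).

Local Notation mu := (smash_mul bH bA act).
Local Notation dl := (smash_comul bH bA rho).
Local Notation P := (smash_proj bH bA act rho).
Local Notation acts := (acts act).
Local Notation alpha := (alpha bA act).
Local Notation gamma := (gamma bH rho).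
Local Notation ppi := (ppi bH bA act rho).
Local Notation ppi_s := (ppi_s bH bA act rho).
Local Notation rtr := (rtr bH).

Let wmp := abelian_wmp cHA.
Let ma := wmp_module wmp.
Let cocommH := cocommH cHA.
Let commA := commA cHA.

Add Ring A_ring : (commutative_srt commA).
Add Ring conv_A_ring : (conv_srt cocommH commA).

Fact smash_mul_bilinear : is_bilinear mu.
Proof.
split=> [w|z]; first exact: tsum_linear (smash_mul_body_bilinear _ _ _ _).
by rewrite /smash_mul; lin.
Qed.
HB.instance Definition _ :=
  bilinear_isBilinear.Build k (A ⨂ H) (A ⨂ H) (A ⨂ H) *:%R *:%R mu
    smash_mul_bilinear.

Fact smash_comul_linear : linear dl.
Proof. exact: tsum_linear (smash_comul_body_bilinear _ _ _). Qed.
HB.instance Definition _ :=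
  GRing.isLinear.Build k (A ⨂ H) ((A ⨂ H) ⨂ (A ⨂ H)) *:%R dl smash_comul_linear.

Lemma smash_comulF W (G : A ⨂ H -> A ⨂ H -> W) x h : is_bilinear G ->
  tsum (dl (x ⊗ h)) G
  = \Sw_(x1, x2 <- comul x) \Sw_(h1, h2 <- comul h) \Sw_(u, a <- rho h1)
      G (x1 ⊗ u) ((x2 ∗ a) ⊗ h2).
Proof.
move=> bG; rewrite smash_comul_tens tsum_tsum //; apply: eq_tsum => x1 x2.
rewrite tsum_tsum //; apply: eq_tsum => h1 h2.
rewrite tsum_tsum //; apply: eq_tsum => u a.
by rewrite tsum_tens.
Qed.

Lemma smash_mulA : associative mu.
Proof.
move=> z w l; on_tensors z => x h; on_tensors w => y g; on_tensors l => t f.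
rewrite !smash_mul_tens.
rewrite (lin_tsum (f := mu (x ⊗ h))); last lin.
rewrite (lin_tsum (f := fun z => mu z (t ⊗ f))); last lin.
transitivity (\Sw_(g1, g2 <- comul g) \Sw_(h1, h' <- comul h) \Sw_(h2, h3 <- comul h')
   ((x ∗ ((h1 ⋅ y) ∗ ((h2 ∗ g1) ⋅ t))) ⊗ (h3 ∗ (g2 ∗ f)))).
  apply: eq_tsum => g1 g2; rewrite smash_mul_tens -coassocF; last lin.
  apply: eq_tsum => h1 h2; rewrite (act_mul ma) amul_tsumr tens_tsuml.
  by apply: eq_tsum => *; rewrite (act_act ma).
rewrite exchange_tsum; apply: eq_tsum => h1 h2.
rewrite smash_mul_tens comul_mulF; last lin.
rewrite exchange_tsum; apply: eq_tsum => k1 k2; apply: eq_tsum => g1 g2.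
by rewrite !amulA.
Qed.

Lemma smash_under_tens x h :
  smash_under bH bA act (x ⊗ h) = \Sw_(h1, h2 <- comul h) ((x ∗ alpha h1) ⊗ h2).
Proof.
by rewrite /smash_under smash_mul_tens; apply: eq_tsum => *; rewrite amul1r.
Qed.

Fact smash_counit_linear : linear (smash_counit bH bA : A ⨂ H -> k^o).
Proof. exact: tsum_linear (smash_counit_body_bilinear _ _). Qed.

Let counit_body_bilinear :
  is_bilinear (fun p q : A ⨂ H => smash_counit bH bA q *: p).
Proof.
split=> ?; first exact: lin_scale_r.
exact: (lin_scale_l _ smash_counit_linear).
Qed.

(** The γ half of P, [smash_under_tens] being the α half. The counit leaves a factor ε_s(h^1), and
    h^0 ⊗ ε_s(h^1) = h_1 ⊗ γ(h_2). *)
Lemma smash_over_tens x h :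
  \Sw_(p, q <- dl (x ⊗ h)) (smash_counit bH bA q *: p)
  = \Sw_(h1, h2 <- comul h) ((x ∗ gamma h1) ⊗ h2).
Proof.
rewrite smash_comulF //.
transitivity (\Sw_(u, a <- rho h) ((eps_s a ∗ x) ⊗ u)).
  rewrite exchange_tsum -{2}[h](@counitr _ _ _) linear_tsum tsum_tsum; last lin.
  apply: eq_tsum => h1 h2.
  rewrite linearZ /= (linZ _ _ (tsum_linear _)); last lin.
  rewrite exchange_tsum scale_tsumr; apply: eq_tsum => u a.
  rewrite -eps_s_mulE // tens_tsuml scale_tsumr; apply: eq_tsum => x1 x2.
  rewrite smash_counit_tens tensZl scalerA mulrC.
  by rewrite (commA x2).
rewrite (@coact_eps_s _ _ _ _ _ _ _ cHA _ (fun u a => (a ∗ x) ⊗ u)); last lin.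
by rewrite (cocommF cocommH); [apply: eq_tsum => *; rewrite commA|lin].
Qed.

Lemma smash_proj_tens x h :
  P (x ⊗ h) = \Sw_(h1, h2 <- comul h) ((x ∗ ppi h1) ⊗ h2).
Proof.
rewrite /smash_proj smash_under_tens linear_tsum tsum_tsum //.
rewrite -(@conv_mul_leg _ _ _ _ _ _ (fun a h => (x ∗ a) ⊗ h)); last lin.
apply: eq_tsum => h1 h2; rewrite smash_over_tens.
by apply: eq_tsum => *; rewrite amulA.
Qed.

(** * The projection and the product *)

Lemma ppi_idem : ppi ⋆ ppi = ppi.
Proof.
transitivity (alpha ⋆ alpha ⋆ (gamma ⋆ gamma)); first by rewrite /ppi;
  ring_in (conv H A).
by rewrite (alpha_idem cHA) (gamma_idem cHA).
Qed.

Lemma smash_projK z : P (P z) = P z.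
Proof.
on_tensors z => x h; rewrite smash_proj_tens linear_tsum.
transitivity (\Sw_(h1, h' <- comul h) \Sw_(h2, h3 <- comul h')
   ((x ∗ (ppi h1 ∗ ppi h2)) ⊗ h3)).
  apply: eq_tsum => *; rewrite /= smash_proj_tens.
  by apply: eq_tsum => *; rewrite amulA.
by rewrite (@conv_mul_leg _ _ _ _ _ _ (fun a h => (x ∗ a) ⊗ h)) ?ppi_idem //; lin.
Qed.

(** By Δ(h g) = Δ(h) Δ(g), the π of P becomes a right translate by g_1. Questions about P on
    products thus reduce to Hom(H, A). *)
Lemma smash_proj_mul_leg (f : conv H A) x h g :
  P (\Sw_(h1, h2 <- comul h) ((x ∗ f h1) ⊗ (h2 ∗ g)))
  = \Sw_(g1, g2 <- comul g) \Sw_(h1, h2 <- comul h)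
      ((x ∗ (f ⋆ rtr ppi g1) h1) ⊗ (h2 ∗ g2)).
Proof.
rewrite linear_tsum; transitivity (\Sw_(g1, g2 <- comul g)
    \Sw_(h1, h' <- comul h) \Sw_(h2, h3 <- comul h')
      ((x ∗ (f h1 ∗ rtr ppi g1 h2)) ⊗ (h3 ∗ g2))).
  rewrite exchange_tsum; apply: eq_tsum => h1 h2.
  rewrite /= smash_proj_tens comul_mulF; last lin.
  by rewrite exchange_tsum; apply: eq_tsum => *; apply: eq_tsum => *; rewrite amulA.
apply: eq_tsum => g1 g2.
by rewrite (@conv_mul_leg _ _ _ _ _ _ (fun a h => (x ∗ a) ⊗ (h ∗ g2))) //; lin.
Qed.

Lemma ppi_rtr_ppi g : ppi ⋆ rtr ppi g = rtr ppi g.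
Proof.
have := congr1 (fun f : conv H (conv H A) => f g) (cst_ppi_rtrD cHA).
by rewrite (@conv_cst_mull _ _ _ _ (cA cHA) cocommH (conv_mulC cocommH commA)).
Qed.

Lemma acts_ppi_rtr g :
  \Sw_(g1, g2 <- comul g) (acts (ppi g1) ⋆ rtr ppi g2) = rtr ppi g.
Proof. exact: (congr1 (fun f : conv H (conv H A) => f g) (acts_ppi_rtrD cHA)). Qed.

Lemma smash_proj_mull z w : P (mu (P z) w) = P (mu z w).
Proof.
on_tensors z => x h; on_tensors w => y g.
rewrite smash_proj_tens (lin_tsum (f := fun z => mu z (y ⊗ g))); last lin.
transitivity (P (\Sw_(h1, h2 <- comul h) ((x ∗ (ppi ⋆ acts y) h1) ⊗ (h2 ∗ g)))).
  congr (P _).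
  rewrite -(@conv_mul_leg _ _ _ _ _ _ (fun a h => (x ∗ a) ⊗ (h ∗ g))); last lin.
  apply: eq_tsum => *; rewrite smash_mul_tens.
  by apply: eq_tsum => *; rewrite amulA.
rewrite smash_mul_tens [RHS](@smash_proj_mul_leg (acts y)) smash_proj_mul_leg.
apply: eq_tsum => g1 g2; apply: eq_tsum => h1 h2.
congr ((_ ∗ _) ⊗ _); congr (conv_fun _ h1).
by rewrite -{2}ppi_rtr_ppi; ring_in (conv H A).
Qed.

Lemma smash_proj_mulr z w : P (mu z (P w)) = P (mu z w).
Proof.
on_tensors z => x h; on_tensors w => y g.
rewrite smash_proj_tens (lin_tsum (f := mu (x ⊗ h))); last lin.
rewrite smash_mul_tens [RHS](@smash_proj_mul_leg (acts y)) linear_tsum.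
transitivity (\Sw_(g1, g' <- comul g) \Sw_(g2, g3 <- comul g') \Sw_(h1, h2 <- comul h)
   ((x ∗ (acts (y ∗ ppi g1) ⋆ rtr ppi g2) h1) ⊗ (h2 ∗ g3))).
  by apply: eq_tsum => g1 g2;
    rewrite /= smash_mul_tens [LHS](@smash_proj_mul_leg (acts _)).
rewrite -coassocF; last lin.
apply: eq_tsum => g1 g2; rewrite exchange_tsum; apply: eq_tsum => h1 h2.
rewrite -[in RHS]acts_ppi_rtr conv_mul_tsumr conv_tsumE amul_tsumr tens_tsuml.
by apply: eq_tsum => g3 g4; rewrite (actsM cHA) conv_mulA.
Qed.

Lemma alpha_rtr_ppi g : alpha ⋆ rtr ppi g = rtr ppi g.
Proof.
by rewrite -[in LHS]ppi_rtr_ppi conv_mulA (alpha_ppi cHA) ppi_rtr_ppi.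
Qed.

Lemma smash_proj_alpha x h g :
  P (\Sw_(h1, h2 <- comul h) ((x ∗ alpha h1) ⊗ (h2 ∗ g))) = P (x ⊗ (h ∗ g)).
Proof.
rewrite smash_proj_mul_leg smash_proj_tens comul_mulF; last lin.
rewrite [RHS]exchange_tsum; apply: eq_tsum => g1 g2; apply: eq_tsum => h1 h2.
by rewrite alpha_rtr_ppi.
Qed.

Lemma smash_mulr1 z : P (mu z (\1_A ⊗ \1_H)) = P z.
Proof.
on_tensors z => x h; rewrite smash_mul_tens.
by rewrite [LHS](@smash_proj_alpha x h \1_H) amul1r.
Qed.

(** Write y as y 1. The unit axiom turns Δ²(1) into 1_1 ⊗ 1_2 1'_1 ⊗ 1'_2, and the legs of the first
    copy recombine into 1_H acting on y α(1'_1). *)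
Lemma act_one_leg W (G : A -> H -> W) y : is_bilinear G ->
  \Sw_(i1, i2 <- comul \1_H) G (i1 ⋅ y) i2
  = \Sw_(i1, i2 <- comul \1_H) G (y ∗ alpha i1) i2.
Proof.
move=> bG.
transitivity (\Sw_(i', i3 <- comul \1_H) \Sw_(i1, i2 <- comul i')
    G ((i1 ⋅ y) ∗ alpha i2) i3).
  apply: eq_tsum => i1 i2; rewrite -{1}[y]amul1r (act_mul ma).
  by rewrite (lin_tsum _ _ (bG.1 _)).
rewrite -(@comul_one_rF _ _ _ _ (fun p q r => G ((p ⋅ y) ∗ alpha q) r)); last lin.
rewrite exchange_tsum; apply: eq_tsum => b1 b2.
rewrite -[y ∗ _](act_one ma) (act_mul ma) (lin_tsum _ _ (bG.1 _)).
by apply: eq_tsum => a1 a2; rewrite /= (act_act ma).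
Qed.

(** α factors through ε_t. In Δ(1) Δ(g) the leg g_1 therefore survives only inside ε, and the counit
    axiom collects g in the other leg. *)
Lemma alpha_leg W (G : A -> H -> W) g : is_bilinear G ->
  \Sw_(g1, g2 <- comul g) G (alpha g1) g2
  = \Sw_(i1, i2 <- comul \1_H) G (alpha i1) (i2 ∗ g).
Proof.
move=> bG; rewrite -{1}[g]amul1l comul_mulF; last lin.
transitivity (\Sw_(g1, g2 <- comul g) \Sw_(i1, i2 <- comul \1_H) \Sw_(j1, j2 <-
  comul \1_H)
   (counit ((i1 ∗ j1) ∗ g1) *: G (alpha i2) (j2 ∗ g2))).
  rewrite [RHS]exchange_tsum2.
  apply: eq_tsum => j1 j2; apply: eq_tsum => g1 g2.
  have -> : alpha (j1 ∗ g1) = alpha (eps_t (j1 ∗ g1)) by exact: act_unit ma _.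
  rewrite /eps_t (lin_tsum _ _ (conv_lin alpha)) (lin_tsum _ _ (bG.1 _)).
  apply: eq_tsum => i1 i2.
  by rewrite (linZ _ _ (conv_lin alpha)) (linZ _ _ (bG.1 _)) amulA.
transitivity (\Sw_(g1, g2 <- comul g) \Sw_(i1, i' <- comul \1_H) \Sw_(i2, i3 <-
  comul i')
   (counit (i2 ∗ g1) *: G (alpha i1) (i3 ∗ g2))).
  apply: eq_tsum => g1 g2.
  rewrite (@comul_one_mul12 _ _ _ cocommH _ (fun p q r =>
     counit (p ∗ g1) *: G (alpha q) (r ∗ g2))); last lin.
  by rewrite (cocommAF cocommH); last lin.
rewrite exchange_tsum; apply: eq_tsum => i1 i'.
rewrite -[i' ∗ g](@counitl _ _ _) (lin_tsum _ _ (bG.2 _)) comul_mulF; last lin.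
rewrite exchange_tsum; apply: eq_tsum => *; apply: eq_tsum => *.
by rewrite (linZ _ _ (bG.2 _)).
Qed.

Lemma smash_mul1 z : P (mu (\1_A ⊗ \1_H) z) = P z.
Proof.
on_tensors z => y g; rewrite smash_mul_tens.
transitivity (P (\Sw_(g1, g2 <- comul g) ((y ∗ alpha g1) ⊗ g2))).
  congr (P _); rewrite (@act_one_leg _ (fun a i => (\1_A ∗ a) ⊗ (i ∗ g))); last lin.
  rewrite (@alpha_leg _ (fun a i => (y ∗ a) ⊗ i)); last lin.
  by apply: eq_tsum => *; rewrite amul1l.
transitivity (P (\Sw_(g1, g2 <- comul g) ((y ∗ alpha g1) ⊗ (g2 ∗ \1_H)))).
  by congr (P _); apply: eq_tsum => *; rewrite amul1r.
by rewrite smash_proj_alpha amul1r.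
Qed.

(** * The coproduct: multiplicativity, compatibility with the projection *)

Section TestEvaluation.
Variables (W : lmodType k) (G : A ⨂ H -> A ⨂ H -> W).
Hypothesis bG : is_bilinear G.

(* To be instantiated with test_ring; keeping B abstract prevents unification from
   unfolding its product. *)
Variables (B : lmodType k) (aB : algebra B).
Hypothesis commB : forall x y : B, x ∗ y = y ∗ x.
Variables (i j : {linear A -> B}) (chi : conv H B).
Hypothesis iM : amul_morphism wb_algebra aB i.
Hypothesis jM : amul_morphism wb_algebra aB j.
Variable E : A -> A -> H -> {linear B -> W}.
Hypothesis E_linear : forall x1 x2 (t : B), linear (fun h => E x1 x2 h t).
Hypothesis E_tens : forall x1 x2 h a b u (t : B),
  t = i a ∗ j b ∗ chi u -> E x1 x2 h t = G ((x1 ∗ a) ⊗ u) ((x2 ∗ b) ⊗ h).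
Local Notation "f ^ρ" := (coact rho aB j f) (at level 2, format "f ^ρ").

Add Ring B_ring : (commutative_srt commB).

Local Ltac lin_extra ::=
  first [apply: (linear_app (E_linear _ _ _)) | apply: lin_conv_app].

(** For fixed legs of x and fixed last legs of g and h, what remains is [comul_act_mul] in B; [E]
    translates values in B back to values of [G]. *)
Lemma smash_comul_mul z w :
  tsum (dl (mu z w)) G
  = \Sw_(z1, z2 <- dl z) \Sw_(w1, w2 <- dl w) G (mu z1 w1) (mu z2 w2).
Proof.
on_tensors z => x h; on_tensors w => y g.
have conv_mulE (f f' : conv H B) m :
  (f ⋆ f') m = \Sw_(h1, h2 <- comul m) (f h1 ∗ f' h2) by [].
have conv_mapE (f : {linear A -> B}) f' m : conv_map f f' m = f (f' m) by [].
have actsE t m : acts t m = m ⋅ t by [].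
have rtrE (f : conv H B) m n : rtr f n m = f (m ∗ n) by [].
have coactE f m : f^ρ m = \Sw_(u, a <- rho m) (f u ∗ j a) by [].
transitivity (\Sw_(x1, x2 <- comul x) \Sw_(g1, g2 <- comul g) \Sw_(m, l <- comul h)
   E x1 x2 (l ∗ g2) ((comul_act bA act aB j i y ⋆ rtr (chi^ρ) g1) m)).
  rewrite smash_mul_tens linear_tsum tsum_tsum //.
  transitivity (\Sw_(h1, h' <- comul h) \Sw_(h2, h3 <- comul h')
     \Sw_(x1, x2 <- comul x) \Sw_(g1, g2 <- comul g) \Sw_(y1, y2 <- comul (h1 ⋅ y))
     \Sw_(u, a <- rho (h2 ∗ g1))
       G ((x1 ∗ y1) ⊗ u) ((x2 ∗ y2 ∗ a) ⊗ (h3 ∗ g2))).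
    apply: eq_tsum => h1 h2; rewrite /= smash_comulF // comul_mulF; last lin.
    transitivity (\Sw_(x1, x2 <- comul x) \Sw_(y1, y2 <- comul (h1 ⋅ y))
       \Sw_(h3, h4 <- comul h2) \Sw_(g1, g2 <- comul g) \Sw_(u, a <- rho (h3 ∗ g1))
       G ((x1 ∗ y1) ⊗ u) ((x2 ∗ y2 ∗ a) ⊗ (h4 ∗ g2))).
      apply: eq_tsum => x1 x2; apply: eq_tsum => y1 y2.
      by rewrite comul_mulF //; lin.
    rewrite exchange_tsum2; apply: eq_tsum => h3 h4; apply: eq_tsum => x1 x2.
    exact: exchange_tsum.
  rewrite -coassocF; last lin.
  rewrite [RHS]exchange_tsum2; apply: eq_tsum => m l.
  rewrite -exchange_tsum2; apply: eq_tsum => x1 x2; apply: eq_tsum => g1 g2.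
  rewrite conv_mulE linear_tsum; apply: eq_tsum => h1 h2.
  rewrite amul_tsuml linear_tsum; apply: eq_tsum => y1 y2.
  rewrite [rtr _ _ _]coactE amul_tsumr linear_tsum; apply: eq_tsum => u a.
  rewrite (@E_tens _ _ _ y1 (y2 ∗ a) u) ?amulA //.
  by rewrite jM; ring_in B.
transitivity (\Sw_(x1, x2 <- comul x) \Sw_(g1, g2 <- comul g) \Sw_(m, l <- comul h)
   \Sw_(v, b <- rho g1) \Sw_(y1, y2 <- comul y) \Sw_(h1, h2 <- comul m)
   \Sw_(u, a <- rho h1) \Sw_(u1, u2 <- comul u)
     G ((x1 ∗ (u1 ⋅ y1)) ⊗ (u2 ∗ v)) ((x2 ∗ (a ∗ (h2 ⋅ (y2 ∗ b)))) ⊗ (l ∗ g2))).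
  apply: eq_tsum => x1 x2; apply: eq_tsum => g1 g2; apply: eq_tsum => m l.
  rewrite (comul_act_mul cHA commB jM) conv_tsumE linear_tsum; apply: eq_tsum => v b.
  rewrite conv_tsumE linear_tsum; apply: eq_tsum => y1 y2.
  rewrite conv_mulE linear_tsum; apply: eq_tsum => h1 h2.
  rewrite coactE amul_tsuml linear_tsum; apply: eq_tsum => u a.
  rewrite conv_mulE !amul_tsuml linear_tsum; apply: eq_tsum => u1 u2.
  apply: E_tens; rewrite jM !conv_mapE !actsE rtrE; ring_in B.
rewrite smash_comulF; last lin.
apply: eq_tsum => x1 x2; rewrite exchange_tsum.
transitivity (\Sw_(h1, h' <- comul h) \Sw_(h2, l <- comul h') \Sw_(u, a <- rho h1)
    \Sw_(y1, y2 <- comul y) \Sw_(g1, g2 <- comul g) \Sw_(v, b <- rho g1)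
    \Sw_(u1, u2 <- comul u)
     G ((x1 ∗ (u1 ⋅ y1)) ⊗ (u2 ∗ v)) ((x2 ∗ (a ∗ (h2 ⋅ (y2 ∗ b)))) ⊗ (l ∗ g2))).
  rewrite -coassocF; last lin.
  apply: eq_tsum => m l; etransitivity; first by pull_sum 3%N.
  apply: eq_tsum => h1 h2; etransitivity; first by pull_sum 3%N.
  apply: eq_tsum => u a; etransitivity; first by pull_sum 2%N.
  by [].
apply: eq_tsum => h1 h2; rewrite exchange_tsum; apply: eq_tsum => u a.
rewrite smash_comulF; last lin.
rewrite exchange_tsum; apply: eq_tsum => y1 y2.
rewrite exchange_tsum; apply: eq_tsum => g1 g2.
rewrite exchange_tsum; apply: eq_tsum => v b.
rewrite !smash_mul_tens (lin_tsum _ _ (bG.1 _)) exchange_tsum.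
apply: eq_tsum => u1 u2; rewrite (lin_tsum _ _ (bG.2 _)).
by apply: eq_tsum => *; rewrite amulA.
Qed.

(** γ(h_1) lies in the image of ε_s, so Δ carries it unchanged to the second leg, where the coaction
    absorbs it. *)
Lemma smash_comul_gamma x h :
  \Sw_(h1, h2 <- comul h) tsum (dl ((x ∗ gamma h1) ⊗ h2)) G = tsum (dl (x ⊗ h)) G.
Proof.
transitivity (\Sw_(h1, h' <- comul h) \Sw_(h2, h3 <- comul h')
    \Sw_(x1, x2 <- comul x) \Sw_(u, a <- rho h2)
      G (x1 ⊗ u) ((x2 ∗ (a ∗ gamma h1)) ⊗ h3)).
  apply: eq_tsum => h1 h2; rewrite smash_comulF // commA -(eps_s_gamma cHA).
  rewrite comul_eps_s_mul //; last lin.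
  rewrite (eps_s_gamma cHA) exchange_tsum; apply: eq_tsum => h3 h4.
  apply: eq_tsum => x1 x2; apply: eq_tsum => u a.
  by congr (G _ (_ ⊗ _)); ring_in A.
rewrite -coassocF; last lin.
rewrite smash_comulF // [RHS]exchange_tsum; apply: eq_tsum => h' h3.
rewrite exchange_tsum; apply: eq_tsum => x1 x2.
rewrite (cocommF cocommH); last lin.
by rewrite (@gamma_coact _ _ _ _ _ _ _ cHA _ (fun u a => G (x1 ⊗ u) ((x2 ∗ a) ⊗
  h3))); last lin.
Qed.

Lemma comul_mul_unit (f : A -> A -> W) x : is_bilinear f ->
  \Sw_(x1, x2 <- comul x) \Sw_(i1, i2 <- comul \1_A) f (x1 ∗ i1) (x2 ∗ i2)
  = tsum (comul x) f.
Proof. by move=> bf; rewrite -comul_mulF // amul1r. Qed.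

Hypothesis GPl : forall p q, G (P p) q = G p q.
Hypothesis GPr : forall p q, G p (P q) = G p q.

Let G_tens x h y g : G (x ⊗ h) (y ⊗ g)
  = \Sw_(h1, h2 <- comul h) \Sw_(g1, g2 <- comul g)
      G ((x ∗ ppi h1) ⊗ h2) ((y ∗ ppi g1) ⊗ g2).
Proof.
rewrite -GPl -GPr !smash_proj_tens (lin_tsum _ _ (bG.1 _)).
by apply: eq_tsum => h1 h2; rewrite (lin_tsum _ _ (bG.2 _)).
Qed.

Let CA : conv H B := comul_act bA act aB j i \1_A.
Let X : conv H B := (conv_map i ppi ⋆ chi)^ρ.
Let J : conv H B := conv_map j ppi.
Let D : B := \Sw_(i1, i2 <- comul \1_A) (i i1 ∗ j i2).

(** Since [G] absorbs P on both sides, a π may be inserted in each argument. These are the factors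
    [comul_act_ppi] needs to reduce Δ(h_1 ⋅ 1) to Δ(1), which Δ(x) then absorbs. *)
Lemma smash_comul_alpha x h :
  \Sw_(h1, h2 <- comul h) tsum (dl ((x ∗ alpha h1) ⊗ h2)) G = tsum (dl (x ⊗ h)) G.
Proof.
have conv_mulE (f f' : conv H B) m :
  (f ⋆ f') m = \Sw_(h1, h2 <- comul m) (f h1 ∗ f' h2) by [].
have conv_mapE (f : {linear A -> B}) f' (m : H) : conv_map f f' m = f (f' m) by [].
have coactE f m : f^ρ m = \Sw_(u, a <- rho m) (f u ∗ j a) by [].
transitivity (\Sw_(m, l <- comul h) \Sw_(x1, x2 <- comul x)
    E x1 x2 l ((CA ⋆ (X ⋆ J)) m)).
  transitivity (\Sw_(h1, h' <- comul h) \Sw_(h2, l <- comul h')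
     \Sw_(x1, x2 <- comul x) E x1 x2 l (CA h1 ∗ (X ⋆ J) h2)); last first.
    rewrite -coassocF; last lin.
    apply: eq_tsum => m l; rewrite exchange_tsum; apply: eq_tsum => x1 x2.
    by rewrite conv_mulE linear_tsum.
  apply: eq_tsum => h1 h'.
  rewrite smash_comulF // comul_mulF; last lin.
  transitivity (\Sw_(h2, n <- comul h') \Sw_(h3, l <- comul n)
     \Sw_(x1, x2 <- comul x) E x1 x2 l (CA h1 ∗ (X h2 ∗ J h3))); last first.
    rewrite -coassocF; last lin.
    apply: eq_tsum => m l; rewrite exchange_tsum; apply: eq_tsum => x1 x2.
    by rewrite conv_mulE amul_tsumr linear_tsum.
  rewrite exchange_tsum2; apply: eq_tsum => h2 n.
  rewrite [RHS]exchange_tsum; apply: eq_tsum => x1 x2.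
  transitivity (\Sw_(y1, y2 <- comul (alpha h1)) \Sw_(u, a <- rho h2)
     \Sw_(u1, u2 <- comul u) \Sw_(h3, l <- comul n)
       G ((x1 ∗ (y1 ∗ ppi u1)) ⊗ u2) ((x2 ∗ (y2 ∗ a ∗ ppi h3)) ⊗ l)).
    apply: eq_tsum => y1 y2; apply: eq_tsum => u a; rewrite G_tens.
    by apply: eq_tsum => *; apply: eq_tsum => *; rewrite !amulA.
  etransitivity; first by pull_sum 3%N.
  apply: eq_tsum => h3 l.
  rewrite amul_tsuml linear_tsum; apply: eq_tsum => y1 y2.
  rewrite coactE amul_tsuml amul_tsumr linear_tsum; apply: eq_tsum => u a.
  rewrite conv_mulE [in RHS]amul_tsuml [in RHS]amul_tsuml [in RHS]amul_tsumr
    linear_tsum; apply: eq_tsum => u1 u2.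
  apply: esym; apply: E_tens; rewrite iM !jM !conv_mapE.
  by ring_in B.
transitivity (\Sw_(m, l <- comul h) \Sw_(x1, x2 <- comul x)
    E x1 x2 l ((X ⋆ J) m ∗ D)).
  apply: eq_tsum => m l; apply: eq_tsum => x1 x2; congr (E x1 x2 l _).
  rewrite conv_mulA (comul_act_ppi cHA commB jM _ iM).
  by rewrite conv_cst_mulr.
transitivity (\Sw_(m, l <- comul h) \Sw_(h1, h2 <- comul m)
   \Sw_(u, a <- rho h1) \Sw_(u1, u2 <- comul u) \Sw_(x1, x2 <- comul x)
     G ((x1 ∗ ppi u1) ⊗ u2) ((x2 ∗ (a ∗ ppi h2)) ⊗ l)).
  apply: eq_tsum => m l.
  transitivity (\Sw_(x1, x2 <- comul x) \Sw_(h1, h2 <- comul m)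
   \Sw_(u, a <- rho h1) \Sw_(u1, u2 <- comul u) \Sw_(i1, i2 <- comul \1_A)
     G ((x1 ∗ i1 ∗ ppi u1) ⊗ u2) ((x2 ∗ i2 ∗ (a ∗ ppi h2)) ⊗ l)).
    apply: eq_tsum => x1 x2.
    rewrite conv_mulE amul_tsuml linear_tsum; apply: eq_tsum => h1 h2.
    rewrite coactE !amul_tsuml linear_tsum; apply: eq_tsum => u a.
    rewrite conv_mulE !amul_tsuml linear_tsum; apply: eq_tsum => u1 u2.
    rewrite amul_tsumr linear_tsum; apply: eq_tsum => i1 i2.
    rewrite (@E_tens _ _ _ (i1 ∗ ppi u1) (i2 ∗ (a ∗ ppi h2)) u2) ?amulA //.
    by rewrite iM !jM !conv_mapE; ring_in B.
  rewrite exchange_tsum; apply: eq_tsum => h1 h2.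
  rewrite exchange_tsum; apply: eq_tsum => u a.
  rewrite exchange_tsum; apply: eq_tsum => u1 u2.
  by rewrite (@comul_mul_unit (fun y y' :
    A => G ((y ∗ ppi u1) ⊗ u2) ((y' ∗ (a ∗ ppi h2)) ⊗ l))); last lin.
rewrite coassocF; last lin.
rewrite smash_comulF // [RHS]exchange_tsum; apply: eq_tsum => h1 n.
transitivity (\Sw_(x1, x2 <- comul x) \Sw_(u, a <- rho h1) \Sw_(u1, u2 <- comul u)
  \Sw_(h2, l <- comul n) G ((x1 ∗ ppi u1) ⊗ u2) ((x2 ∗ (a ∗ ppi h2)) ⊗ l));
    last first.
  apply: eq_tsum => x1 x2; apply: eq_tsum => u a; rewrite G_tens.
  by apply: eq_tsum => *; apply: eq_tsum => *; rewrite !amulA.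
apply: esym; etransitivity; first by pull_sum 3%N.
apply: eq_tsum => h2 l.
rewrite exchange_tsum; apply: eq_tsum => u a.
exact: exchange_tsum.
Qed.

Lemma smash_comul_proj z : tsum (dl (P z)) G = tsum (dl z) G.
Proof.
on_tensors z => x h; rewrite -smash_comul_alpha.
transitivity (\Sw_(h1, h' <- comul h) \Sw_(h2, h3 <- comul h')
    tsum (dl ((x ∗ (alpha h1 ∗ gamma h2)) ⊗ h3)) G).
  rewrite smash_proj_tens.
  rewrite (@conv_mul_leg _ _ _ _ _ _ (fun a h => tsum (dl ((x ∗ a) ⊗ h)) G));
    last lin.
  by rewrite linear_tsum tsum_tsum.
apply: eq_tsum => h1 h'; rewrite -smash_comul_gamma.
by apply: eq_tsum => *; rewrite amulA.
Qed.

End TestEvaluation.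

Lemma smash_comul_mulF W (G : A ⨂ H -> A ⨂ H -> W) z w : is_bilinear G ->
  tsum (dl (mu z w)) G
  = \Sw_(z1, z2 <- dl z) \Sw_(w1, w2 <- dl w) G (mu z1 w1) (mu z2 w2).
Proof.
move=> bG.
have tF x1 x2 h : is_trilinear (fun a b u => G ((x1 ∗ a) ⊗ u) ((x2 ∗ b) ⊗ h)).
  by lin.
apply: (smash_comul_mul bG (test_commutative commA) (test_jM H wb_algebra)
  (E := fun x1 x2 h => test_eval (tF x1 x2 h))) => x1 x2 h a b u t ->.
exact: test_evalE.
Qed.

Lemma smash_comul_projF W (G : A ⨂ H -> A ⨂ H -> W) z : is_bilinear G ->
  (forall p q, G (P p) q = G p q) -> (forall p q, G p (P q) = G p q) ->
  tsum (dl (P z)) G = tsum (dl z) G.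
Proof.
move=> bG GPl GPr.
have tF x1 x2 h : is_trilinear (fun a b u => G ((x1 ∗ a) ⊗ u) ((x2 ∗ b) ⊗ h)).
  by lin.
apply: (smash_comul_proj bG (test_commutative commA) (test_iM H wb_algebra)
  (test_jM H wb_algebra) (E := fun x1 x2 h => test_eval (tF x1 x2 h))) => //
  [x1 x2 t|x1 x2 h a b u t ->].
  by rewrite /=; lin.
exact: test_evalE.
Qed.

(** On the left, ρ meets Δ and then itself, which uses two comodule coalgebra axioms; on the right,
    multiplicativity of Δ on A is enough. *)
Lemma smash_coassocF W (F : A ⨂ H -> A ⨂ H -> A ⨂ H -> W) z : is_trilinear F ->
  \Sw_(z', z3 <- dl z) \Sw_(z1, z2 <- dl z') F z1 z2 z3
  = \Sw_(z1, z' <- dl z) \Sw_(z2, z3 <- dl z') F z1 z2 z3.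
Proof.
move=> tF; on_tensors z => x h.
transitivity (\Sw_(x1, x' <- comul x) \Sw_(x2, x3 <- comul x')
  \Sw_(h1, h' <- comul h) \Sw_(h2, h3 <- comul h') \Sw_(u, a <- rho h1)
  \Sw_(v, c <- rho h2) \Sw_(a1, a2 <- comul a)
    F (x1 ⊗ u) ((x2 ∗ a1) ⊗ v) ((x3 ∗ (a2 ∗ c)) ⊗ h3)).
  rewrite smash_comulF; last lin.
  rewrite -coassocF; last lin.
  apply: eq_tsum => x' x3; rewrite exchange_tsum.
  transitivity (\Sw_(h', h3 <- comul h) \Sw_(h1, h2 <- comul h')
    \Sw_(x1, x2 <- comul x') \Sw_(u, a <- rho h1)
    \Sw_(v, c <- rho h2) \Sw_(a1, a2 <- comul a)
      F (x1 ⊗ u) ((x2 ∗ a1) ⊗ v) ((x3 ∗ (a2 ∗ c)) ⊗ h3)); last first.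
    rewrite coassocF; last lin.
    apply: eq_tsum => h1 h2; exact: exchange_tsum.
  apply: eq_tsum => h1 h2.
  transitivity (\Sw_(u, a <- rho h1) \Sw_(u1, u2 <- comul u)
      \Sw_(x1, x2 <- comul x') \Sw_(v, b <- rho u1)
       F (x1 ⊗ v) ((x2 ∗ b) ⊗ u2) ((x3 ∗ a) ⊗ h2)).
    apply: eq_tsum => u a; rewrite smash_comulF; last lin.
    exact: exchange_tsum.
  rewrite (coact_comulF cHA); last lin.
  apply: eq_tsum => m1 m2.
  rewrite exchange_tsum2; apply: eq_tsum => x1 x2.
  transitivity (\Sw_(u, a <- rho m1) \Sw_(v, b <- rho u) \Sw_(w, c <- rho m2)
       F (x1 ⊗ v) ((x2 ∗ b) ⊗ w) ((x3 ∗ (a ∗ c)) ⊗ h2)).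
    by apply: eq_tsum => u a; rewrite exchange_tsum.
  rewrite (@coact_coactF _ _ _ _ _ _ _ cHA _ (fun v b a => \Sw_(w, c <- rho m2)
       F (x1 ⊗ v) ((x2 ∗ b) ⊗ w) ((x3 ∗ (a ∗ c)) ⊗ h2))); last lin.
  by apply: eq_tsum => u a; rewrite exchange_tsum.
rewrite smash_comulF; last lin.
apply: eq_tsum => x1 x'; rewrite exchange_tsum; apply: eq_tsum => h1 h'.
transitivity (\Sw_(u, a <- rho h1) \Sw_(x2, x3 <- comul x')
  \Sw_(h2, h3 <- comul h') \Sw_(v, c <- rho h2) \Sw_(a1, a2 <- comul a)
    F (x1 ⊗ u) ((x2 ∗ a1) ⊗ v) ((x3 ∗ (a2 ∗ c)) ⊗ h3)).
  rewrite exchange_tsum2; apply: eq_tsum => u a.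
  by rewrite exchange_tsum.
apply: eq_tsum => u a; rewrite smash_comulF; last lin.
rewrite comul_mulF; last lin.
apply: eq_tsum => x2 x3; rewrite [RHS]exchange_tsum; apply: eq_tsum => h2 h3.
rewrite exchange_tsum; apply: eq_tsum => a1 a2; apply: eq_tsum => v c.
by rewrite amulA.
Qed.

(** * The counit *)

Definition phi (z : A ⨂ H) : k^o := \Sw_(x, h <- z) counit (x ∗ ppi h).

Let phi_bilinear : is_bilinear (fun x h => counit (x ∗ ppi h) : k^o).
Proof. lin. Qed.

Lemma phi_linear : linear phi.
Proof. exact: tsum_linear phi_bilinear. Qed.

Lemma phi_tens x h : phi (x ⊗ h) = counit (x ∗ ppi h).
Proof. exact: (tsum_tens phi_bilinear). Qed.

(** [phi] is ε(x) ε(h) composed with P, and π ⋆ π = π. *)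
Lemma phi_proj z : phi (P z) = phi z.
Proof.
have lp := phi_linear; on_tensors z => x h.
rewrite smash_proj_tens (lin_tsum _ _ phi_linear).
transitivity (counit (x ∗ (ppi ⋆ ppi) h)); last by rewrite ppi_idem phi_tens.
rewrite /= amul_tsumr counit_tsum; apply: eq_tsum => h1 h2.
by rewrite phi_tens amulA.
Qed.

Let smash_proj_leg (f : conv H A) x h :
  P (\Sw_(h1, h2 <- comul h) ((x ∗ f h1) ⊗ h2))
  = \Sw_(h1, h2 <- comul h) ((x ∗ (f ⋆ ppi) h1) ⊗ h2).
Proof.
rewrite linear_tsum -(@conv_mul_leg _ _ _ _ _ _ (fun a h => (x ∗ a) ⊗ h)); last lin.
apply: eq_tsum => h1 h2; rewrite /= smash_proj_tens.
by apply: eq_tsum => h3 h4; rewrite amulA.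
Qed.

(** The counit of the first leg leaves the factor ε_t(π(h_1^0)) h_1^1, which P absorbs by
    [coact_eps_t_ppi]. *)
Lemma smash_counitl z : P (\Sw_(z1, z2 <- dl z) ((phi z1 : k) *: z2)) = P z.
Proof.
have lp := phi_linear; on_tensors z => x h.
rewrite smash_comulF; last lin.
transitivity (P (\Sw_(h1, h2 <- comul h)
    ((x ∗ coact rho wb_algebra (lid A) (conv_map eps_t ppi) h1) ⊗ h2))).
  congr (P _); rewrite exchange_tsum; apply: eq_tsum => h1 h2.
  rewrite -[coact _ _ _ _ _]/(\Sw_(u, a <- rho h1) (eps_t (ppi u) ∗ a)).
  rewrite amul_tsumr tens_tsuml exchange_tsum.
  apply: eq_tsum => u a.
  transitivity ((eps_t (ppi u) ∗ x ∗ a) ⊗ h2).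
    rewrite -eps_t_mulE // amul_tsuml tens_tsuml; apply: eq_tsum => x1 x2.
    by rewrite phi_tens commA amulZl tensZl.
  by congr (_ ⊗ _); ring_in A.
by rewrite smash_proj_leg (coact_eps_t_ppi cHA) smash_proj_tens.
Qed.

(** The counit of the second leg leaves ε_s(h_1^1) p(h_2), hence γ ⋆ p = p, which P absorbs because
    π ⋆ p = π. *)
Lemma smash_counitr z : P (\Sw_(z1, z2 <- dl z) ((phi z2 : k) *: z1)) = P z.
Proof.
have lp := phi_linear; on_tensors z => x h.
rewrite smash_comulF; last lin.
transitivity (P (\Sw_(h1, h2 <- comul h) ((x ∗ ppi_s h1) ⊗ h2))).
  congr (P _); rewrite exchange_tsum.
  transitivity (\Sw_(h1, h2 <- comul h) \Sw_(u, a <- rho h1)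
      ((x ∗ (eps_s a ∗ ppi_s h2)) ⊗ u)).
    apply: eq_tsum => h1 h2; rewrite exchange_tsum; apply: eq_tsum => u a.
    transitivity ((eps_s (a ∗ ppi h2) ∗ x) ⊗ u).
      rewrite -eps_s_mulE // tens_tsuml; apply: eq_tsum => x1 x2.
      rewrite phi_tens tensZl; congr (_ *: _).
      by apply: (congr1 (fun t : A => counit t)); ring_in A.
    by rewrite eps_sM // -[eps_s (ppi h2)]/(ppi_s h2); congr (_ ⊗ _); ring_in A.
  transitivity (\Sw_(h1, h2 <- comul h) \Sw_(k1, k2 <- comul h1)
      ((x ∗ (gamma k2 ∗ ppi_s h2)) ⊗ k1)).
    apply: eq_tsum => h1 h2.
    by rewrite (@coact_eps_s _ _ _ _ _ _ _ cHA _ (fun u a => (x ∗ (a ∗ ppi_s h2))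
      ⊗ u)); last lin.
  rewrite coassocF; last lin.
  rewrite [RHS](cocommF cocommH); last lin.
  apply: eq_tsum => h1 h2; rewrite -tens_tsuml -amul_tsumr -conv_mulE.
  congr ((_ ∗ _) ⊗ _); congr (conv_fun _ h2).
  by rewrite (ppi_sE cHA) -{3}(gamma_idem cHA); ring_in (conv H A).
rewrite smash_proj_leg smash_proj_tens.
by rewrite conv_mulC // (ppi_ppi_s cHA).
Qed.

(** Under ε the action h_1 ⋅ y becomes multiplication by α(h_1), which the right translate of π
    absorbs. *)
Lemma phi_mul x h y g : phi (mu (x ⊗ h) (y ⊗ g)) = counit (x ∗ y ∗ ppi (h ∗ g)).
Proof.
rewrite smash_mul_tens (lin_tsum _ _ phi_linear).
rewrite -[ppi (h ∗ g)]/(rtr ppi g h) -alpha_rtr_ppi conv_mulE.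
rewrite amul_tsumr counit_tsum; apply: eq_tsum => h1 h2; rewrite phi_tens.
transitivity (counit ((h1 ⋅ y) ∗ (x ∗ rtr ppi g h2))).
  by apply: (congr1 (fun t : A => counit t)); rewrite /=; ring_in A.
rewrite (counit_act cHA); apply: (congr1 (fun t : A => counit t)).
ring_in A.
Qed.

Let counit_eps_sr x a : counit (x ∗ eps_s a) = counit (x ∗ a).
Proof. by rewrite commA counit_eps_s commA. Qed.

Let ppi_sM h g :
  ppi_s (h ∗ g) = \Sw_(h1, h2 <- comul h) \Sw_(g1, g2 <- comul g)
                    (counit (h2 ∗ g2) *: (ppi_s h1 ∗ ppi_s g1)).
Proof.
have := congr1 (fun f : conv H (conv H A) => f g h) (rtrD_ppi_s cHA).
rewrite -[LHS]/(ppi_s (h ∗ g)) => ->.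
rewrite exchange_tsum conv_mulE conv_tsumE; apply: eq_tsum => g1 g2.
rewrite (@conv_cst_mull _ _ _ _ (cA cHA) cocommH (conv_mulC cocommH commA)).
rewrite [_ ∗ _]/(_ ⋆ _) -[conv_map _ _ g1]/(conv_cst (ppi_s g1)).
rewrite conv_mulE; apply: eq_tsum => h1 h2.
by rewrite conv_cst_mulr amulZr amul1r.
Qed.

Fact ltr_linear h : linear (fun g => ppi_s (h ∗ g)).
Proof. lin. Qed.
Let ltr h : conv H A := Conv (ltr_linear h).
Fact counit_ltr_linear h : linear (fun g => counit (h ∗ g) *: \1_A).
Proof. lin. Qed.
Let cltr h : conv H A := Conv (counit_ltr_linear h).
Fact counit_rtr_linear h : linear (fun g => counit (g ∗ h) *: \1_A).
Proof. lin. Qed.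
Let crtr h : conv H A := Conv (counit_rtr_linear h).

Let ppi_s_gamma : ppi_s ⋆ gamma ⋆ ppi_s = ppi_s.
Proof.
have e : alpha_s bA act ⋆ alpha_s bA act = alpha_s bA act.
  rewrite /alpha_s -conv_mapM ?(alpha_idem cHA) //; exact: eps_sM commA.
rewrite !(ppi_sE cHA) -{3}e -{4}(gamma_idem cHA) -{4}(gamma_idem cHA).
ring_in (conv H A).
Qed.

(** Expand both outer factors by [ppi_sM]. The legs of g meet in p ⋆ γ ⋆ p = p, and the two scalars
    combine into ε(h_2 g_2 f_2) by weak multiplicativity of ε on H. *)
Let ppi_s_mul3 h g f : (ltr h ⋆ gamma ⋆ rtr ppi_s f) g = ppi_s (h ∗ (g ∗ f)).
Proof.
have el : ltr h = \Sw_(h1, h2 <- comul h) (conv_cst (ppi_s h1) ⋆ ppi_s ⋆ cltr h2).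
  apply: convP => g'; rewrite conv_tsumE [LHS]ppi_sM; apply: eq_tsum => h1 h2.
  rewrite conv_mulE; apply: eq_tsum => g1 g2.
  by rewrite conv_cst_mull // -[cltr h2 g2]/(counit (h2 ∗ g2) *: \1_A) amulZr amul1r.
have er : rtr ppi_s f
  = \Sw_(f1, f2 <- comul f) (conv_cst (ppi_s f1) ⋆ ppi_s ⋆ crtr f2).
  apply: convP => g'; rewrite conv_tsumE [LHS]ppi_sM exchange_tsum.
  apply: eq_tsum => f1 f2; rewrite conv_mulE; apply: eq_tsum => g1 g2.
  rewrite conv_cst_mull // -[crtr f2 g2]/(counit (g2 ∗ f2) *: \1_A) amulZr amul1r.
  by rewrite commA.
transitivity (\Sw_(h1, h2 <- comul h) \Sw_(f1, f2 <- comul f) \Sw_(g1, g2 <- comul g)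
   (counit (h2 ∗ (g2 ∗ f2)) *: (ppi_s h1 ∗ (ppi_s g1 ∗ ppi_s f1)))).
  rewrite el er !conv_mul_tsuml conv_tsumE; apply: eq_tsum => h1 h2.
  rewrite conv_mul_tsumr conv_tsumE; apply: eq_tsum => f1 f2.
  transitivity ((conv_cst (ppi_s h1 ∗ ppi_s f1) ⋆ (ppi_s ⋆ (cltr h2 ⋆ crtr f2))) g).
    congr (conv_fun _ g).
    transitivity (conv_cst (ppi_s h1) ⋆ conv_cst (ppi_s f1)
        ⋆ (ppi_s ⋆ gamma ⋆ ppi_s ⋆ (cltr h2 ⋆ crtr f2))).
      ring_in (conv H A).
    by rewrite ppi_s_gamma conv_cstM.
  rewrite conv_cst_mull // conv_mulE amul_tsumr; apply: eq_tsum => g1 g2.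
  have -> : (cltr h2 ⋆ crtr f2) g2 = counit (h2 ∗ (g2 ∗ f2)) *: \1_A.
    rewrite conv_mulE amulA counit_mul12 scale_tsuml; apply: eq_tsum => p q.
    by rewrite /= amulZl amul1l scalerA.
  by rewrite !amulZr amul1r; congr (_ *: _); ring_in A.
rewrite ppi_sM; apply: eq_tsum => h1 h2; apply: esym.
rewrite comul_mulF; last lin.
transitivity (\Sw_(g', g3 <- comul g) \Sw_(g1, g2 <- comul g')
    \Sw_(f', f3 <- comul f) \Sw_(f1, f2 <- comul f')
   (counit (h2 ∗ (g3 ∗ f3)) *: (ppi_s h1 ∗ (counit (g2 ∗ f2) *:
     (ppi_s g1 ∗ ppi_s f1))))).
  apply: eq_tsum => g1 g2; rewrite [RHS]exchange_tsum; apply: eq_tsum => f1 f2.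
  rewrite ppi_sM amul_tsumr scale_tsumr; apply: eq_tsum => g3 g4.
  by rewrite amul_tsumr scale_tsumr.
rewrite coassocF; last lin.
rewrite [RHS]exchange_tsum; apply: eq_tsum => g1 g'.
transitivity (\Sw_(g2, g3 <- comul g') \Sw_(f1, f' <- comul f) \Sw_(f2, f3 <-
  comul f')
   (counit (h2 ∗ (g3 ∗ f3)) *: (ppi_s h1 ∗ (counit (g2 ∗ f2) *:
     (ppi_s g1 ∗ ppi_s f1))))).
  by apply: eq_tsum => g2 g3; rewrite coassocF //; lin.
rewrite exchange_tsum; apply: eq_tsum => f1 f'.
have -> : counit (h2 ∗ (g' ∗ f')) = \Sw_(g2, g3 <- comul g') \Sw_(f2, f3 <- comul f')
    (counit (g2 ∗ f2) * counit (h2 ∗ (g3 ∗ f3))).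
  rewrite -{1}[g' ∗ f'](@counitl _ _ _) comul_mulF; last lin.
  rewrite amul_tsumr counit_tsum; apply: eq_tsum => g2 g3.
  rewrite amul_tsumr counit_tsum; apply: eq_tsum => f2 f3.
  by rewrite amulZr counitZ.
rewrite scale_tsuml; apply: eq_tsum => g2 g3.
rewrite scale_tsuml; apply: eq_tsum => f2 f3.
by rewrite amulZr scalerA mulrC.
Qed.

Let phi_mul3 x h y g t f : phi (mu (mu (x ⊗ h) (y ⊗ g)) (t ⊗ f))
  = counit (x ∗ y ∗ t ∗ ppi_s (h ∗ (g ∗ f))).
Proof.
have lp := phi_linear.
rewrite counit_eps_sr -[ppi (h ∗ _)]/(rtr ppi (g ∗ f) h) -alpha_rtr_ppi conv_mulE.
rewrite amul_tsumr counit_tsum smash_mul_tens.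
rewrite (lin_tsum (f := fun z => phi (mu z (t ⊗ f)))); last lin.
apply: eq_tsum => h1 h2; rewrite phi_mul.
transitivity (counit ((h1 ⋅ y) ∗ (x ∗ t ∗ rtr ppi (g ∗ f) h2))).
  apply: (congr1 (fun t : A => counit t)).
  by rewrite -[rtr ppi _ _]/(ppi (h2 ∗ (g ∗ f))) (amulA h2); ring_in A.
rewrite (counit_act cHA); apply: (congr1 (fun t : A => counit t)).
ring_in A.
Qed.

Let counit_split x y a t h f :
  counit (x ∗ y ∗ t ∗ (ppi h ∗ a ∗ ppi f))
  = counit (x ∗ y ∗ t ∗ (ppi_s h ∗ eps_s a ∗ ppi_s f)).
Proof. by rewrite -counit_eps_sr !eps_sM. Qed.

Let coact_split x g (F1 F2 : conv H A) :
  \Sw_(g1, g2 <- comul g) \Sw_(u, a <- rho g1)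
     (counit (x ∗ (F1 u ∗ eps_s a ∗ F2 g2)) : k^o)
  = counit (x ∗ (F1 ⋆ gamma ⋆ F2) g).
Proof.
transitivity (\Sw_(g1, g2 <- comul g) \Sw_(k1, k2 <- comul g1)
     (counit (x ∗ (F1 k1 ∗ gamma k2 ∗ F2 g2)) : k^o)).
  apply: eq_tsum => g1 g2.
  by rewrite (@coact_eps_s _ _ _ _ _ _ _ cHA _
     (fun u a => counit (x ∗ (F1 u ∗ a ∗ F2 g2)) : k^o)); last lin.
rewrite conv_mulE amul_tsumr counit_tsum; apply: eq_tsum => g1 g2.
by rewrite conv_mulE amul_tsuml amul_tsumr counit_tsum.
Qed.

(** Weak multiplicativity of ε on A joins the two values. The factors π(h g_1^0), g_1^1 and π(g_2 f)
    then count only through ε_s, and [ppi_s_mul3] recombines them. *)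
Lemma phi_mul12 z w l :
  phi (mu (mu z w) l)
  = \Sw_(w1, w2 <- dl w) ((phi (mu z w1) : k) * phi (mu w2 l) : k^o).
Proof.
have lp := phi_linear.
on_tensors z => x h; on_tensors w => y g; on_tensors l => t f.
rewrite phi_mul3 -ppi_s_mul3 -coact_split smash_comulF; last lin.
rewrite exchange_tsum; apply: eq_tsum => g1 g2.
rewrite exchange_tsum; apply: eq_tsum => u a.
rewrite [LHS]/= -counit_split.
transitivity (counit (x ∗ ppi (h ∗ u) ∗ y ∗ (a ∗ t ∗ ppi (g2 ∗ f)))).
  by apply: (congr1 (fun t : A => counit t)); ring_in A.
rewrite counit_mul12; apply: eq_tsum => y1 y2; rewrite !phi_mul.
by congr (_ * _); apply: (congr1 (fun t : A => counit t)); ring_in A.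
Qed.

Lemma phi_mul21 z w l :
  phi (mu (mu z w) l)
  = \Sw_(w1, w2 <- dl w) ((phi (mu z w2) : k) * phi (mu w1 l) : k^o).
Proof.
have lp := phi_linear.
on_tensors z => x h; on_tensors w => y g; on_tensors l => t f.
(* Commutativity of Hom(H, A) exchanges the roles of the legs of g. *)
have e : (ltr h ⋆ gamma ⋆ rtr ppi_s f) = (rtr ppi_s f ⋆ gamma ⋆ ltr h).
  ring_in (conv H A).
rewrite phi_mul3 -ppi_s_mul3 e -coact_split smash_comulF; last lin.
rewrite exchange_tsum; apply: eq_tsum => g1 g2.
rewrite exchange_tsum; apply: eq_tsum => u a.
rewrite [LHS]/= -counit_split.
transitivity (counit (x ∗ a ∗ ppi (h ∗ g2) ∗ y ∗ (t ∗ ppi (u ∗ f)))).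
  by apply: (congr1 (fun t : A => counit t)); ring_in A.
rewrite counit_mul21; apply: eq_tsum => y1 y2; rewrite !phi_mul.
by congr (_ * _); apply: (congr1 (fun t : A => counit t)); ring_in A.
Qed.

(** * The unit axioms *)

Local Notation one := (\1_A ⊗ \1_H).

Lemma smash_comul_one W (G : A ⨂ H -> A ⨂ H -> W) : is_bilinear G ->
  tsum (dl one) G
  = \Sw_(i1, i2 <- comul \1_A) \Sw_(m1, m' <- comul \1_H) \Sw_(m2, m3 <- comul m')
      G (i1 ⊗ m1) ((i2 ∗ gamma m2) ⊗ m3).
Proof.
move=> bG; rewrite smash_comulF //; apply: eq_tsum => i1 i2.
by rewrite (@coact_one_leg _ _ _ _ _ _ _ cHA _
  (fun u a m => G (i1 ⊗ u) ((i2 ∗ a) ⊗ m))); last lin.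
Qed.

Lemma act_mul_gamma h x m : h ⋅ (x ∗ gamma m) = (h ⋅ x) ∗ gamma m.
Proof.
rewrite -[LHS]/(acts (x ∗ gamma m) h) (actsM cHA) -(eps_s_gamma cHA).
rewrite (acts_eps_s cHA) conv_mulA conv_cst_mulr; congr (_ ∗ _).
by rewrite conv_mulC // (alpha_acts cHA).
Qed.

Section Absorbing.
Variables (W : lmodType k) (Q : A -> A ⨂ H -> W).
Hypotheses (bQ : is_bilinear Q) (QP : forall a z, Q a (P z) = Q a z).

Let Q_alpha a x h g :
  Q a (\Sw_(h1, h2 <- comul h) ((x ∗ alpha h1) ⊗ (h2 ∗ g))) = Q a (x ⊗ (h ∗ g)).
Proof. by rewrite -QP smash_proj_alpha QP. Qed.

(** With 1_H acting on the companion leg of Δ(1_A), the compatibility condition replaces h_1 ⋅ i2 by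
    α(h_1) i2, and P absorbs α. *)
Lemma smash_mul_one_r x h m g :
  \Sw_(i1, i2 <- comul \1_A) Q i1 (mu (x ⊗ h) ((i2 ∗ gamma m) ⊗ g))
  = \Sw_(i1, i2 <- comul \1_A) Q i1 ((x ∗ (i2 ∗ gamma m)) ⊗ (h ∗ g)).
Proof.
transitivity (\Sw_(h1, h2 <- comul h) \Sw_(i1, i2 <- comul \1_A)
    Q i1 ((x ∗ ((h1 ⋅ i2) ∗ gamma m)) ⊗ (h2 ∗ g))).
  rewrite exchange_tsum; apply: eq_tsum => i1 i2.
  rewrite smash_mul_tens (lin_tsum _ _ (bQ.2 _)).
  by apply: eq_tsum => h1 h2; rewrite act_mul_gamma.
transitivity (\Sw_(h1, h2 <- comul h) \Sw_(i1, i2 <- comul \1_A)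
    Q i1 ((x ∗ (i2 ∗ gamma m) ∗ alpha h1) ⊗ (h2 ∗ g))).
  apply: eq_tsum => h1 h2.
  transitivity (\Sw_(i1, i2 <- comul \1_A)
      Q (\1_H ⋅ i1) ((x ∗ ((h1 ⋅ i2) ∗ gamma m)) ⊗ (h2 ∗ g))).
    by apply: eq_tsum => *; rewrite (act_one ma).
  rewrite (@compatible_comulF _ _ _ _ _ _ _ cHA _
    (fun y t => Q y ((x ∗ (t ∗ gamma m)) ⊗ (h2 ∗ g)))); last lin.
  apply: eq_tsum => i1 i2; rewrite (act_one ma) amul1l.
  by rewrite -[h1 ⋅ _]/(alpha h1); congr (Q _ (_ ⊗ _)); ring_in A.
rewrite exchange_tsum; apply: eq_tsum => i1 i2.
by rewrite -(lin_tsum _ _ (bQ.2 _)) Q_alpha.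
Qed.

Lemma smash_mul_one_l x h g :
  \Sw_(i1, i2 <- comul \1_A) Q i2 (mu (x ⊗ h) (i1 ⊗ g))
  = \Sw_(i1, i2 <- comul \1_A) Q i2 ((x ∗ i1) ⊗ (h ∗ g)).
Proof.
transitivity (\Sw_(h1, h2 <- comul h) \Sw_(i1, i2 <- comul \1_A)
    Q i2 ((x ∗ (h1 ⋅ i1)) ⊗ (h2 ∗ g))).
  rewrite exchange_tsum; apply: eq_tsum => i1 i2.
  by rewrite smash_mul_tens (lin_tsum _ _ (bQ.2 _)).
transitivity (\Sw_(h1, h2 <- comul h) \Sw_(i1, i2 <- comul \1_A)
    Q i2 ((x ∗ i1 ∗ alpha h1) ⊗ (h2 ∗ g))).
  apply: eq_tsum => h1 h2.
  transitivity (\Sw_(i1, i2 <- comul \1_A)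
      Q (\1_H ⋅ i2) ((x ∗ (h1 ⋅ i1)) ⊗ (h2 ∗ g))).
    by apply: eq_tsum => *; rewrite (act_one ma).
  rewrite (@compatible_comulF _ _ _ _ _ _ _ cHA _
    (fun t y => Q y ((x ∗ t) ⊗ (h2 ∗ g)))); last lin.
  apply: eq_tsum => i1 i2; rewrite (act_one ma) amul1l.
  by rewrite -[h1 ⋅ _]/(alpha h1); congr (Q _ (_ ⊗ _)); ring_in A.
rewrite exchange_tsum; apply: eq_tsum => i1 i2.
by rewrite -(lin_tsum _ _ (bQ.2 _)) Q_alpha.
Qed.

End Absorbing.

Section UnitAxioms.
Variables (W : lmodType k) (F : A ⨂ H -> A ⨂ H -> A ⨂ H -> W).
Hypotheses (tF : is_trilinear F) (FP : forall p q r, F p (P q) r = F p q r).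

(** Common normal form of both sides of the unit axioms: three legs of 1_A and five of 1_H, the
    second and fourth of these inside γ. *)
Let N := \Sw_(i', i3 <- comul \1_A) \Sw_(i1, i2 <- comul i')
  \Sw_(m1, q1 <- comul \1_H) \Sw_(m2, q2 <- comul q1)
  \Sw_(m3, q3 <- comul q2) \Sw_(m4, m5 <- comul q3)
    F (i1 ⊗ m1) ((i2 ∗ gamma m2) ⊗ m3) ((i3 ∗ gamma m4) ⊗ m5).

Let comul2_one :
  \Sw_(p', p3 <- dl one) \Sw_(p1, p2 <- dl p') F p1 p2 p3 = N.
Proof.
rewrite smash_comul_one; last lin.
apply: eq_tsum => i' i3.
transitivity (\Sw_(m', q <- comul \1_H) \Sw_(m1, m2 <- comul m')
   \Sw_(i1, i2 <- comul i') \Sw_(u, a <- rho m1) \Sw_(m4, m5 <- comul q)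
    F (i1 ⊗ u) ((i2 ∗ a) ⊗ m2) ((i3 ∗ gamma m4) ⊗ m5)).
  apply: eq_tsum => m' q.
  transitivity (\Sw_(m4, m5 <- comul q) \Sw_(i1, i2 <- comul i')
      \Sw_(m1, m2 <- comul m') \Sw_(u, a <- rho m1)
      F (i1 ⊗ u) ((i2 ∗ a) ⊗ m2) ((i3 ∗ gamma m4) ⊗ m5)).
    by apply: eq_tsum => m4 m5; rewrite smash_comulF //; lin.
  apply: esym; etransitivity; first by pull_sum 3%N.
  apply: eq_tsum => m4 m5; rewrite exchange_tsum; apply: eq_tsum => i1 i2.
  by [].
rewrite coassocF; last lin.
transitivity (\Sw_(i1, i2 <- comul i') \Sw_(m1, q' <- comul \1_H)
   \Sw_(u, a <- rho m1) \Sw_(m2, q <- comul q') \Sw_(m4, m5 <- comul q)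
    F (i1 ⊗ u) ((i2 ∗ a) ⊗ m2) ((i3 ∗ gamma m4) ⊗ m5)).
  rewrite [RHS]exchange_tsum; apply: eq_tsum => m1 q'.
  rewrite exchange_tsum; apply: eq_tsum => i1 i2.
  by rewrite exchange_tsum.
apply: eq_tsum => i1 i2.
by rewrite (@coact_one_leg _ _ _ _ _ _ _ cHA _ (fun u a q' =>
  \Sw_(m2, q <- comul q') \Sw_(m4, m5 <- comul q)
    F (i1 ⊗ u) ((i2 ∗ a) ⊗ m2) ((i3 ∗ gamma m4) ⊗ m5))); last lin.
Qed.

Let legs i1 i2 i3 :
  \Sw_(r, d <- comul \1_H) \Sw_(b, c <- comul r)
    \Sw_(b1, b2 <- comul b) \Sw_(d1, d2 <- comul d)
    F (i1 ⊗ b1) ((i2 ∗ gamma b2) ⊗ c) ((i3 ∗ gamma d1) ⊗ d2)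
  = \Sw_(m1, q1 <- comul \1_H) \Sw_(m2, q2 <- comul q1)
    \Sw_(m3, q3 <- comul q2) \Sw_(m4, m5 <- comul q3)
    F (i1 ⊗ m1) ((i2 ∗ gamma m2) ⊗ m3) ((i3 ∗ gamma m4) ⊗ m5).
Proof.
rewrite coassocF; last lin.
rewrite -[RHS]coassocF; last lin.
by apply: eq_tsum => b q; rewrite exchange_tsum.
Qed.

(** [smash_mul_one_r] makes the middle leg a product in A next to a product in H, so the unit axioms
    of A and H apply separately. *)
Lemma smash_unit_l :
  \Sw_(p1, p2 <- dl one) \Sw_(q1, q2 <- dl one) F q1 (mu p1 q2) p2
  = \Sw_(p', p3 <- dl one) \Sw_(p1, p2 <- dl p') F p1 p2 p3.
Proof.
rewrite comul2_one smash_comul_one; last lin.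
transitivity (\Sw_(i1, i2 <- comul \1_A) \Sw_(m1, m' <- comul \1_H)
    \Sw_(m2, m3 <- comul m') \Sw_(k1, k2 <- comul \1_A)
    \Sw_(n1, n' <- comul \1_H) \Sw_(n2, n3 <- comul n')
      F (k1 ⊗ n1) ((i1 ∗ k2 ∗ gamma n2) ⊗ (m1 ∗ n3)) ((i2 ∗ gamma m2) ⊗ m3)).
  apply: eq_tsum => i1 i2; apply: eq_tsum => m1 m'; apply: eq_tsum => m2 m3.
  rewrite smash_comul_one; last lin.
  rewrite exchange_tsum [RHS]exchange_tsum; apply: eq_tsum => n1 n'.
  rewrite exchange_tsum [RHS]exchange_tsum; apply: eq_tsum => n2 n3.
  rewrite (@smash_mul_one_r _ (fun a z => F (a ⊗ n1) z ((i2 ∗ gamma m2) ⊗ m3)))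
    //; last lin.
  by apply: eq_tsum => *; rewrite amulA.
transitivity (\Sw_(i1, i2 <- comul \1_A) \Sw_(k1, k2 <- comul \1_A)
    \Sw_(m1, m' <- comul \1_H) \Sw_(m2, m3 <- comul m')
    \Sw_(n1, n' <- comul \1_H) \Sw_(n2, n3 <- comul n')
      F (k1 ⊗ n1) ((i1 ∗ k2 ∗ gamma n2) ⊗ (m1 ∗ n3)) ((i2 ∗ gamma m2) ⊗ m3)).
  by apply: eq_tsum => i1 i2; etransitivity; first by pull_sum 2%N.
rewrite (@comul_one_lF _ _ bA _ (fun k1 c i2 =>
    \Sw_(m1, m' <- comul \1_H) \Sw_(m2, m3 <- comul m')
    \Sw_(n1, n' <- comul \1_H) \Sw_(n2, n3 <- comul n')
      F (k1 ⊗ n1) ((c ∗ gamma n2) ⊗ (m1 ∗ n3)) ((i2 ∗ gamma m2) ⊗ m3))); last lin.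
apply: eq_tsum => i' i3; apply: eq_tsum => i1 i2; rewrite -legs -comul_one_lF;
  last lin.
apply: eq_tsum => m1 m'; rewrite coassocF; last lin.
rewrite exchange_tsum; apply: eq_tsum => n1 n'.
by rewrite exchange_tsum.
Qed.

Lemma smash_unit_r :
  \Sw_(p1, p2 <- dl one) \Sw_(q1, q2 <- dl one) F p1 (mu p2 q1) q2
  = \Sw_(p', p3 <- dl one) \Sw_(p1, p2 <- dl p') F p1 p2 p3.
Proof.
rewrite comul2_one smash_comul_one; last lin.
transitivity (\Sw_(i1, i2 <- comul \1_A) \Sw_(m1, m' <- comul \1_H)
    \Sw_(m2, m3 <- comul m') \Sw_(k1, k2 <- comul \1_A)
    \Sw_(n1, n' <- comul \1_H) \Sw_(n2, n3 <- comul n')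
      F (i1 ⊗ m1) ((i2 ∗ k1 ∗ gamma m2) ⊗ (m3 ∗ n1)) ((k2 ∗ gamma n2) ⊗ n3)).
  apply: eq_tsum => i1 i2; apply: eq_tsum => m1 m'; apply: eq_tsum => m2 m3.
  rewrite smash_comul_one; last lin.
  rewrite exchange_tsum [RHS]exchange_tsum; apply: eq_tsum => n1 n'.
  rewrite exchange_tsum [RHS]exchange_tsum; apply: eq_tsum => n2 n3.
  rewrite (@smash_mul_one_l _ (fun a z => F (i1 ⊗ m1) z ((a ∗ gamma n2) ⊗ n3)))
    //; last lin.
  by apply: eq_tsum => *; congr (F _ (_ ⊗ _) _); ring_in A.
transitivity (\Sw_(i1, i2 <- comul \1_A) \Sw_(k1, k2 <- comul \1_A)
    \Sw_(m1, m' <- comul \1_H) \Sw_(m2, m3 <- comul m')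
    \Sw_(n1, n' <- comul \1_H) \Sw_(n2, n3 <- comul n')
      F (i1 ⊗ m1) ((i2 ∗ k1 ∗ gamma m2) ⊗ (m3 ∗ n1)) ((k2 ∗ gamma n2) ⊗ n3)).
  by apply: eq_tsum => i1 i2; etransitivity; first by pull_sum 2%N.
rewrite (@comul_one_rF _ _ bA _ (fun i1 c k2 =>
    \Sw_(m1, m' <- comul \1_H) \Sw_(m2, m3 <- comul m')
    \Sw_(n1, n' <- comul \1_H) \Sw_(n2, n3 <- comul n')
      F (i1 ⊗ m1) ((c ∗ gamma m2) ⊗ (m3 ∗ n1)) ((k2 ∗ gamma n2) ⊗ n3))); last lin.
apply: eq_tsum => i' i3; apply: eq_tsum => i1 i2; rewrite -legs -comul_one_rF;
  last lin.
rewrite -coassocF; last lin.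
by apply: eq_tsum => m' m3; rewrite exchange_tsum.
Qed.

End UnitAxioms.
End SmashProduct.

(** * The weak smash product *)

Section WeakSmash.
Variables (k : fieldType) (H A : lmodType k).
Variables (bH : weak_bialgebra H) (bA : weak_bialgebra A).
Variables (act : {bilinear H -> A -> A}) (rho : {linear H -> H ⨂ A}).
Hypothesis cHA : compatible_weak_matched_pair bH bA act rho.

Local Notation mu := (smash_mul bH bA act).
Local Notation dl := (smash_comul bH bA rho).
Local Notation P := (smash_proj bH bA act rho).
Local Notation V := (weak_smash bH bA act rho).
Local Notation cor := (corestr P).
Local Notation val := (@limage_val _ _ _ P).
Local Notation one := (\1_A ⊗ \1_H).
Implicit Types (z w : A ⨂ H) (a b c : V).

Fact cor_linear : linear (cor : A ⨂ H -> V).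
Proof. by move=> c z w; apply: val_inj; rewrite /= linearP. Qed.

Fact val_linear : linear (val : V -> A ⨂ H).
Proof. by []. Qed.

Lemma cor_val a : cor (val a) = a.
Proof.
have /asboolP[z ev] := valP a; apply: val_inj; rewrite /= in ev *.
by rewrite ev (smash_projK cHA).
Qed.

Lemma cor_proj z : cor (P z) = cor z.
Proof. by apply: val_inj; rewrite /= (smash_projK cHA). Qed.

Definition wmul a b : V := cor (mu (val a) (val b)).

Lemma cor_mul z w : wmul (cor z) (cor w) = cor (mu z w).
Proof.
apply: val_inj; rewrite /=.
by rewrite (smash_proj_mull cHA) (smash_proj_mulr cHA).
Qed.

Fact wmul_bilinear : is_bilinear wmul.
Proof.
have lc := cor_linear.
split=> b; apply: (linear_app lc).
  by apply: lin_bil_l; apply: (linear_app val_linear).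
by apply: lin_bil_r; apply: (linear_app val_linear).
Qed.

HB.instance Definition _ :=
  bilinear_isBilinear.Build k V V V *:%R *:%R wmul wmul_bilinear.

Fact wmulA : associative wmul.
Proof.
move=> a b c; rewrite -(cor_val a) -(cor_val b) -(cor_val c) !cor_mul.
by rewrite (smash_mulA cHA).
Qed.

Fact wmul1 : left_id (cor one) wmul.
Proof.
move=> a; rewrite -(cor_val a) cor_mul -cor_proj (smash_mul1 cHA).
exact: cor_proj.
Qed.

Fact wmulr1 : right_id (cor one) wmul.
Proof.
move=> a; rewrite -(cor_val a) cor_mul -cor_proj (smash_mulr1 cHA).
exact: cor_proj.
Qed.

Definition weak_smash_algebra : algebra V :=
  Algebra wmul_bilinear wmulA wmul1 wmulr1.

Definition wcomul a : V ⨂ V := \Sw_(p, q <- dl (val a)) (cor p ⊗ cor q).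

Fact wcomul_linear : linear wcomul.
Proof.
have lc := cor_linear; have lv := val_linear.
apply: linear_tsum_arg; first by lin.
exact: linear_app (smash_comul_linear _ _ _) lv.
Qed.
HB.instance Definition _ :=
  GRing.isLinear.Build k V (V ⨂ V) *:%R wcomul wcomul_linear.

(** [wcomul] uses the representative [val], but any preimage z will do: [G] composed with [cor]
    absorbs P in both arguments. *)
Lemma wcomulF (W : lmodType k) (G : V -> V -> W) z : is_bilinear G ->
  tsum (wcomul (cor z)) G = \Sw_(p, q <- dl z) G (cor p) (cor q).
Proof.
have lc := cor_linear; move=> bG; rewrite tsum_tsum //.
rewrite (@smash_comul_projF _ _ _ _ _ _ _ cHA _
   (fun p q => tsum (cor p ⊗ cor q) G)) => [||p q|p q]; rewrite ?cor_proj //.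
  by apply: eq_tsum => p q; rewrite tsum_tens.
by have lG := tsum_linear bG; lin.
Qed.

Definition wcounit a : k^o := phi bH bA act rho (val a).

Fact wcounit_linear : scalar wcounit.
Proof.
have lv := val_linear; have lp := phi_linear bH bA act rho.
by move=> c a b; rewrite /wcounit lv lp.
Qed.
HB.instance Definition _ :=
  GRing.isLinear.Build k V k *%R wcounit wcounit_linear.

Lemma wcounit_cor z : wcounit (cor z) = phi bH bA act rho z.
Proof. exact: phi_proj. Qed.

Fact wcoassoc a :
  \Sw_(h', h3 <- wcomul a) \Sw_(h1, h2 <- wcomul h') (h1 ⊗ h2 ⊗ h3)
  = \Sw_(h1, h' <- wcomul a) \Sw_(h2, h3 <- wcomul h') (h1 ⊗ h2 ⊗ h3).
Proof.
have lc := cor_linear; rewrite -(cor_val a) !wcomulF; [|lin|lin].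
transitivity (\Sw_(z', z3 <- dl (val a)) \Sw_(z1, z2 <- dl z')
   (cor z1 ⊗ cor z2 ⊗ cor z3)).
  by apply: eq_tsum => p q; rewrite wcomulF //; lin.
rewrite (smash_coassocF cHA); last lin.
by apply: eq_tsum => p q; rewrite wcomulF //; lin.
Qed.

Let lw : linear (wcounit : V -> k^o) := wcounit_linear.

Fact wcounitl a : \Sw_(h1, h2 <- wcomul a) (wcounit h1 *: h2) = a.
Proof.
have lc := cor_linear; rewrite -[RHS]cor_val -{1}(cor_val a).
rewrite wcomulF; last by move: lw => ?; lin.
rewrite -[RHS]cor_proj -(smash_counitl cHA) cor_proj (lin_tsum _ _ lc).
by apply: eq_tsum => p q; rewrite wcounit_cor (linZ _ _ lc).
Qed.

Fact wcounitr a : \Sw_(h1, h2 <- wcomul a) (wcounit h2 *: h1) = a.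
Proof.
have lc := cor_linear; rewrite -[RHS]cor_val -{1}(cor_val a).
rewrite wcomulF; last by move: lw => ?; lin.
rewrite -[RHS]cor_proj -(smash_counitr cHA) cor_proj (lin_tsum _ _ lc).
by apply: eq_tsum => p q; rewrite wcounit_cor (linZ _ _ lc).
Qed.

Definition weak_smash_coalgebra : coalgebra V :=
  @Coalgebra k V wcomul wcounit wcoassoc wcounitl wcounitr.

Fact wcomul_mul a b :
  wcomul (wmul a b)
  = \Sw_(a1, a2 <- wcomul a) \Sw_(b1, b2 <- wcomul b) (wmul a1 b1 ⊗ wmul a2 b2).
Proof.
have lc := cor_linear; rewrite -(cor_val a) -(cor_val b) cor_mul.
rewrite -[LHS]tsum_id wcomulF; last lin.
rewrite (smash_comul_mulF cHA); last lin.
rewrite wcomulF; last lin.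
apply: eq_tsum => p q; rewrite wcomulF; last lin.
by apply: eq_tsum => *; rewrite !cor_mul.
Qed.

Fact wcounit_mul12 a b c :
  wcounit (wmul (wmul a b) c)
  = \Sw_(b1, b2 <- wcomul b) ((wcounit (wmul a b1) : k) * wcounit (wmul b2 c) : k^o).
Proof.
have lc := cor_linear; rewrite -(cor_val a) -(cor_val b) -(cor_val c) !cor_mul.
rewrite wcounit_cor (phi_mul12 cHA) wcomulF; last first.
  by move: lw => ?; lin.
by apply: eq_tsum => p q; rewrite !cor_mul !wcounit_cor.
Qed.

Fact wcounit_mul21 a b c :
  wcounit (wmul (wmul a b) c)
  = \Sw_(b1, b2 <- wcomul b) ((wcounit (wmul a b2) : k) * wcounit (wmul b1 c) : k^o).
Proof.
have lc := cor_linear; rewrite -(cor_val a) -(cor_val b) -(cor_val c) !cor_mul.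
rewrite wcounit_cor (phi_mul21 cHA) wcomulF; last first.
  by move: lw => ?; lin.
by apply: eq_tsum => p q; rewrite !cor_mul !wcounit_cor.
Qed.

Let wcomul2_one :
  \Sw_(a', a3 <- wcomul (cor one)) \Sw_(a1, a2 <- wcomul a') (a1 ⊗ a2 ⊗ a3)
  = \Sw_(p', p3 <- dl one) \Sw_(p1, p2 <- dl p') (cor p1 ⊗ cor p2 ⊗ cor p3).
Proof.
have lc := cor_linear; rewrite wcomulF; last lin.
by apply: eq_tsum => p q; rewrite wcomulF //; lin.
Qed.

Fact wcomul_one_l :
  \Sw_(a1, a2 <- wcomul (cor one)) \Sw_(b1, b2 <- wcomul (cor one))
    (wmul (cor one) b1 ⊗ wmul a1 b2 ⊗ wmul a2 (cor one))
  = \Sw_(a', a3 <- wcomul (cor one)) \Sw_(a1, a2 <- wcomul a') (a1 ⊗ a2 ⊗ a3).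
Proof.
have lc := cor_linear; rewrite wcomul2_one wcomulF; last lin.
rewrite -(smash_unit_l cHA) => [||p q r]; [|lin|by rewrite cor_proj].
apply: eq_tsum => p q; rewrite wcomulF; last lin.
by apply: eq_tsum => p' q'; rewrite wmul1 wmulr1 cor_mul.
Qed.

Fact wcomul_one_r :
  \Sw_(a1, a2 <- wcomul (cor one)) \Sw_(b1, b2 <- wcomul (cor one))
    (wmul a1 (cor one) ⊗ wmul a2 b1 ⊗ wmul (cor one) b2)
  = \Sw_(a', a3 <- wcomul (cor one)) \Sw_(a1, a2 <- wcomul a') (a1 ⊗ a2 ⊗ a3).
Proof.
have lc := cor_linear; rewrite wcomul2_one wcomulF; last lin.
rewrite -(smash_unit_r cHA) => [||p q r]; [|lin|by rewrite cor_proj].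
apply: eq_tsum => p q; rewrite wcomulF; last lin.
by apply: eq_tsum => p' q'; rewrite wmul1 wmulr1 cor_mul.
Qed.

Definition weak_smash_bialgebra : weak_bialgebra V :=
  @WeakBialgebra k V weak_smash_algebra weak_smash_coalgebra
    wcomul_mul wcounit_mul12 wcounit_mul21 wcomul_one_l wcomul_one_r.

End WeakSmash.

Theorem theorem4p14 (k : fieldType) (H A : lmodType k)
    (bH : weak_bialgebra H) (bA : weak_bialgebra A)
    (act : {bilinear H -> A -> A}) (rho : {linear H -> H ⨂ A})
    (cHA : compatible_weak_matched_pair bH bA act rho) :
  exists W : weak_bialgebra (weak_smash bH bA act rho),
    let sm := wsmash bH bA act rho in
    [/\ forall (x y : A) (h g : H),
          sm x h ∗ sm y g
          = \Sw_(h1, h2 <- comul h) sm (x ∗ act h1 y) (h2 ∗ g),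
        \1_(weak_smash bH bA act rho) = sm \1_A \1_H,
        forall (x : A) (h : H),
          comul (sm x h)
          = \Sw_(x1, x2 <- comul x) \Sw_(h1, h2 <- comul h)
              \Sw_(u, a <- rho h1) (sm x1 u ⊗ sm (x2 ∗ a) h2)
      & forall (x : A) (h : H),
          counit (sm x h)
          = \Sw_(h1, h2 <- comul h) \Sw_(u, a <- rho h1)
              counit (x ∗ act u \1_A ∗ a ∗ act h2 \1_A)].
Proof.
exists (weak_smash_bialgebra cHA) => sm; have lc := cor_linear bH bA act rho.
split=> // [x y h g|x h|x h].
- rewrite [LHS](cor_mul cHA) smash_mul_tens (lin_tsum _ _ lc).
  exact: eq_tsum.
- rewrite -[LHS]tsum_id [LHS](wcomulF cHA); last lin.
  by rewrite smash_comulF //; lin.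
- rewrite [LHS](wcounit_cor cHA) phi_tens (counit_ppi cHA).
  by [].
Qed.
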